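(* Let $\Omega$ be a non-empty completely regular Hausdorff space, $v\colon\Omega\to(0,\infty)$ continuous, $(E,\|\cdot\|_E)$ a normed space over $\mathbb{K}$, and \[ \mathcal{C}v(\Omega,E):=\Bigl\{f\in\mathcal{C}(\Omega,E):\|f\|^E:=\sup_{x\in\Omega}\|f(x)\|_Ev(x)<\infty\Bigr\}, \] where $\mathcal{C}(\Omega,E)$ is the space of continuous functions $\Omega\to E$. Then the following assertions hold. (a) $(\mathcal{C}v(\Omega,E),\|\cdot\|^E,\tau_{\mathrm{co}}^E)$ is a Saks space, $\gamma(\|\cdot\|^E,\tau_{\mathrm{co}}^E)=\gamma_{\mathrm{s}}(\|\cdot\|^E,\tau_{\mathrm{co}}^E)$, and the mixed topology $\gamma(\|\cdot\|^E,\tau_{\mathrm{co}}^E)$ is generated by the system of seminorms \[ |||f|||^E_{(K_n,a_n)_{n\in\mathbb{N}}}:=\sup_{n\in\mathbb{N}}\sup_{x\in K_n}\|f(x)\|_Ev(x)a_n,\quad f\in\mathcal{C}v(\Omega,E), \] where $(K_n)_{n\in\mathbb{N}}$ is a sequence of compact subsets of $\Omega$ and $(a_n)_{n\in\mathbb{N}}\in c_0^+$. (b) If $\Omega$ is discrete, then $\mathcal{C}v(\Omega,E)=\mathcal{C}v(\Omega,E)_\sigma$, $\gamma(\|\cdot\|^E,\tau_{\mathrm{co}}^E)=\gamma_{\mathrm{s}}(\|\cdot\|^E,\tau_{\mathcal{N}_\Omega}^E)$ and $\gamma(\|\cdot\|^E,\tau_{\mathrm{co}}^E)$ is also generated by the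 system of seminorms \[ |||f|||^E_{(x_n,a_n)_{n\in\mathbb{N}}}:=\sup_{n\in\mathbb{N}}\|f(x_n)\|_Ev(x_n)a_n,\quad f\in\mathcal{C}v(\Omega,E), \] where $(x_n)_{n\in\mathbb{N}}$ is a sequence in $\Omega$ and $(a_n)_{n\in\mathbb{N}}\in c_0^+$. (c) If $\Omega$ is a $k_{\mathbb{R}}$-space and $E$ a Banach space, then $(\mathcal{C}v(\Omega,E),\|\cdot\|^E,\tau_{\mathrm{co}}^E)$ is complete. (d) If $\Omega$ is hemicompact, then $(\mathcal{C}v(\Omega,E),\|\cdot\|^E,\tau_{\mathrm{co}}^E)$ is C-sequential. (e) If $\Omega$ is a hemicompact $k_{\mathbb{R}}$-space, or a completely metrisable space, then $(\mathcal{C}v(\Omega,E),\gamma(\|\cdot\|^E,\tau_{\mathrm{co}}^E))$ is a Mackey space. If $E$ is in addition a Banach space, then $(\mathcal{C}v(\Omega,E),\gamma(\|\cdot\|^E,\tau_{\mathrm{co}}^E))$ is a strong Mackey space. (f) Let $\mathcal{W}_0:=\mathcal{W}^+_{\mathrm{b},0}(\Omega)$ or $\mathcal{W}_0:=\mathcal{W}^+_{\mathrm{usc},0}(\Omega)$. Then $\gamma(\|\cdot\|^E,\tau_{\mathrm{co}}^E)$ is also generated by the system of seminorms \[ |f|_w^E:=\sup_{x\in\Omega}\|f(x)\|_Ev(x)w(x),\quad f\in\mathcal{C}v(\Omega,E), \] for $w\in\mathcal{W}_0$. If $\Omega$ is locally compact, we may replace $\mathcal{W}_0$ by $\mathcal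{C}_0^+(\Omega)$.
   Context: $\mathbb{K}\in\{\mathbb{R},\mathbb{C}\}$. $c_0^+$ is the family of real non-negative null-sequences; suprema of non-negative quantities over the empty set are $0$. Saks spaces. Let $(X,\|\cdot\|)$ be a normed space and $\tau$ a locally convex Hausdorff topology on $X$ coarser than the norm topology $\tau_{\|\cdot\|}$. The mixed topology $\gamma=\gamma(\|\cdot\|,\tau)$ is the finest linear topology on $X$ that coincides with $\tau$ on $\|\cdot\|$-bounded sets and lies between $\tau$ and $\tau_{\|\cdot\|}$; it is locally convex Hausdorff. $(X,\|\cdot\|,\tau)$ is a Saks space if there is a directed system $\Gamma_\tau$ of continuous seminorms generating $\tau$ with $\|x\|=\sup_{q\in\Gamma_\tau}q(x)$ for all $x$. The submixed topology $\gamma_{\mathrm{s}}(\|\cdot\|,\tau)$ is generated by the seminorms $x\mapsto\sup_{n\in\mathbb{N}}q_n(x)a_n$ with $(q_n)_{n\in\mathbb{N}}\subset\Gamma_\tau$ and $(a_n)_{n\in\mathbb{N}}\in c_0^+$ (independent of the choice of such $\Gamma_\tau$). A Saks space is complete if $(X,\gamma)$ is complete, and C-sequential if every convex sequentially open subset of $(X,\gamma)$ is open. $(X,\gamma)$ is a Mackey space if $\gamma$ is the Mackey topology of the dual pairing $\langle X,Y\rangle$ with $Y=(X,\gamma)'$ (a Banach space, topologically isomorphic to the strong dual $(X,\gamma)'_b$); it is a strong Mackey space if it is a Mackey space and every $\sigma(Y,X)$-compact subset of $Y$ is $\gamma$-equicontinuous. Topologies. $\tau_{\mathrm{co}}^E$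 is the topology of uniform convergence on compact subsets of $\Omega$ (the compact-open topology) on $\mathcal{C}v(\Omega,E)$. $\tau_{\mathcal{N}_\Omega}^E$ is generated by the seminorms $f\mapsto\sup_{x\in N}\|f(x)\|_Ev(x)$, $N\subset\Omega$ finite. Weak version. With $\mathcal{C}v(\Omega):=\mathcal{C}v(\Omega,\mathbb{K})$, $\mathcal{C}v(\Omega,E)_\sigma:=\{f\colon\Omega\to E: e^*\circ f\in\mathcal{C}v(\Omega)\text{ for all }e^*\in E^*\}$. Topological notions. A completely regular space $\Omega$ is a $k_{\mathbb{R}}$-space if for every completely regular space $Y$, any map $f\colon\Omega\to Y$ whose restriction to each compact $K\subset\Omega$ is continuous is continuous on $\Omega$. $\Omega$ is hemicompact if there is a sequence $(K_n)_{n\in\mathbb{N}}$ of compact subsets of $\Omega$ such that every compact $K\subset\Omega$ is contained in some $K_N$. A function $w\colon\Omega\to[0,\infty)$ vanishes at infinity if $\{x\in\Omega:w(x)\ge\varepsilon\}$ is compact for every $\varepsilon>0$; $\mathcal{W}^+_{\mathrm{b},0}(\Omega)$, $\mathcal{W}^+_{\mathrm{usc},0}(\Omega)$, $\mathcal{C}_0^+(\Omega)$ are the families of bounded, upper semicontinuous, resp. continuous functions $w\colon\Omega\to[0,\infty)$ vanishing at infinity.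
   Formalization: The submixed topology depends on the choice of the generating system of seminorms, contrary to the stated independence; it is taken here for the largest admissible system, namely all τ-continuous seminorms q with q(x) ≤ ‖x‖ for every x. *)

(* Defs.v *)
From HB Require Import structures.
From mathcomp Require Import all_boot all_order all_algebra.
From mathcomp Require Import all_classical all_reals all_analysis.
From mathcomp Require Import complex.

Set Implicit Arguments.
Unset Strict Implicit.
Unset Printing Implicit Defensive.

Import Order.TTheory GRing.Theory Num.Theory.
Import numFieldTopology.Exports numFieldNormedType.Exports.

Local Open Scope classical_set_scope.
Local Open Scope ring_scope.

Variant scalars := Reals | Complexes.

Definition scalar_field (R : realType) (s : scalars) : numFieldType :=
  match s with
  | Reals => R : numFieldType
  | Complexes => R[i] : numFieldType
  end.

(* The library's norm of a K-module is K-valued.  It is a nonnegative real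
   element of K, and [nrm] reads it in R. *)
Definition real_of (R : realType) (s : scalars) : scalar_field R s -> R :=
  match s as s0 return scalar_field R s0 -> R with
  | Reals => fun x => x
  | Complexes => fun z => complex.Re z
  end.

Definition nrm (R : realType) (s : scalars)
  (V : normedZmodType (scalar_field R s)) (x : V) : R := @real_of R s `|x|.

Section nrm_lemmas.
Context (R : realType) (s : scalars).

Lemma real_ofD (x y : scalar_field R s) : real_of (x + y) = real_of x + real_of y.
Proof. by case: s x y => //= -[a b] [c d]. Qed.

Lemma real_of_le (x y : scalar_field R s) : x <= y -> real_of x <= real_of y.
Proof. by case: s x y => //= -[a b] [c d]; rewrite lecE => /andP[]. Qed.

Lemma real_of_ge0M (x y : scalar_field R s) :
  0 <= x -> real_of (x * y) = real_of x * real_of y.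
Proof.
case: s x y => //= -[a b] [c d].
by rewrite lecE/= => /andP[/eqP -> _]; rewrite mul0r subr0.
Qed.

Lemma real_of0 : real_of (0 : scalar_field R s) = 0.
Proof. by case: s. Qed.

Lemma nrm_ge0 (V : normedZmodType (scalar_field R s)) (x : V) : 0 <= nrm x.
Proof. by rewrite -real_of0; exact/real_of_le/normr_ge0. Qed.

Lemma nrm0 (V : normedZmodType (scalar_field R s)) : nrm (0 : V) = 0.
Proof. by rewrite /nrm normr0 real_of0. Qed.

Lemma nrmD (V : normedZmodType (scalar_field R s)) (x y : V) :
  nrm (x + y) <= nrm x + nrm y.
Proof. by rewrite -real_ofD; exact/real_of_le/ler_normD. Qed.

Lemma nrmZ (V : normedModType (scalar_field R s)) (a : scalar_field R s)
  (x : V) :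
  nrm (a *: x) = nrm a * nrm x.
Proof. by rewrite /nrm normrZ real_of_ge0M. Qed.

End nrm_lemmas.

(* Several topologies on one vector space are compared, so that a topology is
   a value here; [topologized T] is X with the canonical topology T. *)
Record topology (X : choiceType) := Topology {
  opens : set (set X) ;
  opensT : opens setT ;
  opensI : setI_closed opens ;
  opens_bigU : forall (I : Type) (f : I -> set X),
    (forall i, opens (f i)) -> opens (\bigcup_i f i)
}.

Definition topologized (X : choiceType) (T : topology X) : Type := X.

HB.instance Definition _ (X : choiceType) (T : topology X) :=
  Choice.on (topologized T).
HB.instance Definition _ (X : choiceType) (T : topology X) :=
  @isOpenTopological.Build (topologized T) (opens T)
    (opensT T) (@opensI X T) (@opens_bigU X T).

Definition coarser (X : choiceType) (T T' : topology X) : Prop :=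
  opens T `<=` opens T'.

Definition coincide_on (X : choiceType) (B : set X) (T T' : topology X) : Prop :=
  [set U `&` B | U in opens T] = [set U `&` B | U in opens T'].

Section induced_topology.
Context (X : choiceType) (Z : topologicalType) (f : X -> Z).

Let op : set (set X) := [set f @^-1` U | U in open].

Let opT : op setT.
Proof. by exists setT; [exact: openT|rewrite preimage_setT]. Qed.

Let opI : setI_closed op.
Proof.
by move=> _ _ [U oU <-] [V oV <-]; exists (U `&` V);
  [exact: openI|rewrite preimage_setI].
Qed.

Let op_bigU (I : Type) (g : I -> set X) :
  (forall i, op (g i)) -> op (\bigcup_i g i).
Proof.
move=> og; have /choice[h hP] : forall i, exists U, open U /\ f @^-1` U = g i.
  by move=> i; have [U oU gU] := og i; exists U.
exists (\bigcup_i h i); first by apply: bigcup_open => i _; exact: (hP i).1.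
by rewrite preimage_bigcup; apply: eq_bigcupr => i _; exact: (hP i).2.
Qed.

Definition induced_topology : topology X := Topology opT opI op_bigU.

End induced_topology.

Section seminorm_topology.
Context (R : realType) (X : zmodType) (P : set (X -> R)).

Let op : set (set X) := [set U | forall x, U x ->
  exists F : set (X -> R), [/\ finite_set F, F `<=` P &
    exists2 e : R, 0 < e & forall y, (forall p, F p -> p (y - x) < e) -> U y]].

Let opT : op setT.
Proof.
move=> x _; exists set0; split; [exact: finite_set0|exact: sub0set|].
by exists 1; first exact: ltr01.
Qed.

Let opI : setI_closed op.
Proof.
move=> U V oU oV x [/oU[F [finF FP [e e0 eU]]] /oV[G [finG GP [d d0 dV]]]].
exists (F `|` G); split; first by rewrite finite_setU.
  by move=> p [/FP|/GP].
exists (Num.min e d); first by rewrite lt_min e0 d0.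
move=> y yFG; split.
  by apply: eU => p Fp; have := yFG p (or_introl Fp); rewrite lt_min => /andP[].
by apply: dV => p Gp; have := yFG p (or_intror Gp); rewrite lt_min => /andP[].
Qed.

Let op_bigU (I : Type) (g : I -> set X) :
  (forall i, op (g i)) -> op (\bigcup_i g i).
Proof.
move=> og x [i _ /og[F [finF FP [e e0 eU]]]].
by exists F; split => //; exists e => // y /eU giy; exists i.
Qed.

Definition seminorm_topology : topology X := Topology opT opI op_bigU.

End seminorm_topology.

Section saks_spaces.
Context (R : realType) (s : scalars).
Local Notation K := (scalar_field R s).
Context (X : lmodType K).
Implicit Types (T tau gamma : topology X) (N p q : X -> R).

Definition is_seminorm p : Prop :=
  [/\ forall x, 0 <= p x,
      forall x y, p (x + y) <= p x + p y &
      forall (a : K) x, p (a *: x) = nrm a * p x].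

Definition is_norm N : Prop := is_seminorm N /\ forall x, N x = 0 -> x = 0.

Definition norm_topology N : topology X := seminorm_topology [set N].

Definition norm_bounded N (B : set X) : Prop :=
  exists M : R, forall x, B x -> N x <= M.

Definition linear_topology T : Prop :=
  continuous (fun z : topologized T * topologized T =>
    ((z.1 : X) + (z.2 : X) : topologized T)) /\
  continuous (fun z : K^o * topologized T =>
    ((z.1 : K) *: (z.2 : X) : topologized T)).

Definition locally_convex_hausdorff T : Prop :=
  [/\ linear_topology T,
      exists2 B : set (set (topologized T)),
        (forall b, B b -> convex_set (b : set (convex_lmodType X))) & basis B &
      hausdorff_space (topologized T)].

Definition mixable N tau T : Prop :=
  [/\ linear_topology T, coarser tau T, coarser T (norm_topology N) &
      forall B, norm_bounded N B -> coincide_on B T tau].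

Definition mixed_topology N tau gamma : Prop :=
  mixable N tau gamma /\ forall T, mixable N tau T -> coarser T gamma.

Definition directed_system (Gamma : set (X -> R)) : Prop :=
  Gamma !=set0 /\ forall p q, Gamma p -> Gamma q ->
    exists2 r, Gamma r & forall x, p x <= r x /\ q x <= r x.

Definition saks_system N tau (Gamma : set (X -> R)) : Prop :=
  [/\ directed_system Gamma,
      forall q, Gamma q ->
        is_seminorm q /\ continuous (q : topologized tau -> R^o),
      tau = seminorm_topology Gamma &
      forall x, ereal_sup [set (q x)%:E | q in Gamma] = (N x)%:E].

Definition saks_space N tau : Prop :=
  [/\ is_norm N, locally_convex_hausdorff tau, coarser tau (norm_topology N) &
      exists Gamma, saks_system N tau Gamma].

Definition c0_plus (a : nat -> R) : Prop :=
  (forall n, 0 <= a n) /\ a n @[n --> \oo] --> (0 : R).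

(* The sequences (q_n) of the submixed topology are drawn from this system.  It
   is the largest Gamma with [saks_system N tau Gamma]
   (lemma max_saks_system_saks), and so depends on N and tau only. *)
Definition max_saks_system N tau : set (X -> R) :=
  [set q | [/\ is_seminorm q, continuous (q : topologized tau -> R^o) &
                forall x, q x <= N x]].

Lemma seminorm_topology_sub (P Q : set (X -> R)) :
  P `<=` Q -> coarser (seminorm_topology P) (seminorm_topology Q).
Proof.
move=> PQ U /= oU x /oU[F [finF FP FU]]; exists F; split => //.
exact: subset_trans PQ.
Qed.

Lemma max_saks_system_saks N tau :
  saks_space N tau -> saks_system N tau (max_saks_system N tau).
Proof.
move=> [normN [[addc _] _ _] _ [G [[[p0 Gp0] Gdir] Gsn tauG GN]]].
have GM : G `<=` max_saks_system N tau.
  move=> q Gq; have [sq cq] := Gsn _ Gq; split => // x.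
  by rewrite -lee_fin -GN; apply: ereal_sup_ubound; exists q.
have topEP (T T' : topology X) : opens T = opens T' -> T = T'.
  case: T T' => [op1 a b c] [op2 a2 b2 c2] /= oE; move: a b c a2 b2 c2.
  rewrite oE => ? ? ? ? ? ?; congr Topology; exact: Prop_irrelevance.
split.
- split; first by exists p0; exact: GM.
  move=> p q [[p_ge0 pD pZ] cp pN] [[q_ge0 qD qZ] cq qN].
  exists (fun x => Num.max (p x) (q x)); last first.
    by move=> x; rewrite !le_max !lexx orbT.
  split; first split => /=.
  + by move=> x; rewrite le_max p_ge0.
  + move=> x y; rewrite ge_max; apply/andP; split.
      by apply: (le_trans (pD _ _)); rewrite lerD// le_max lexx.
    by apply: (le_trans (qD _ _)); rewrite lerD// le_max lexx orbT.
  + by move=> a x; rewrite pZ qZ maxr_pMr// nrm_ge0.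
  + by move=> x; apply: (@continuous_max _ (topologized tau)); [exact: cp|exact: cq].
  + by move=> x; rewrite ge_max pN qN.
- by move=> q [].
- apply: topEP; apply/seteqP; split.
    by rewrite {1}tauG; exact: seminorm_topology_sub.
  move=> U oU; suff : open (U : set (topologized tau)) by [].
  rewrite openE => x /oU[F [finF FM [e e0 eU]]]; rewrite /interior/=.
  apply: (@filterS _ (nbhs (x : topologized tau)) _
    (\bigcap_(p in F) [set y | p ((y : X) - x) < e])).
    by move=> y yF; apply: eU => p Fp; exact: yF.
  have /finite_fsetP[D FD] := finF; rewrite FD.
  apply: filter_bigI => p pD; have /FM[[p_ge0 pA pZ] cp _] : F p by rewrite FD.
  have p0E : p 0 = 0 by rewrite -(scale0r (0 : X)) pZ nrm0 mul0r.
  have cx : {for (x : topologized tau), continuous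
      (fun y : topologized tau => (p : topologized tau -> R^o) ((y : X) - x))}.
    apply: (@continuous_comp _ _ _ (fun y : topologized tau =>
      ((y : X) - x : topologized tau)) (p : topologized tau -> R^o)); last exact: cp.
    move=> V /(addc (x, - x))[[A B] /= [nA nB] AB].
    apply: (@filterS _ (nbhs (x : topologized tau)) _ A) nA => y Ay.
    by apply: (AB (y, - x)); split => /=;
      [exact: Ay|exact: (@nbhs_singleton (topologized tau) _ _ nB)].
  have : nbhs (p (x - x) : R^o) [set r | r < e].
    rewrite subrr p0E; exact: (@lt_nbhsl R 0 e).
  exact: cx.
- move=> x; apply/eqP; rewrite eq_le; apply/andP; split.
    by apply: ge_ereal_sup => _ [q [_ _ qN] <-]; rewrite lee_fin.
  rewrite -GN; apply: ereal_sup_le => _ [q Gq <-].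
  by exists q => //; exact: GM.
Qed.

Definition submixed_topology N tau : topology X :=
  seminorm_topology [set p | exists (q : nat -> X -> R) (a : nat -> R),
    [/\ forall n, max_saks_system N tau (q n), c0_plus a &
        p = fun x => sup [set q n x * a n | n in [set: nat]]]].

Definition complete_topology T : Prop :=
  forall F : set_system (topologized T), ProperFilter F ->
    (forall U : set (topologized T), nbhs ((0 : X) : topologized T) U ->
      exists2 A, F A & forall x y : X, A x -> A y -> U (x - y)) ->
    exists x : topologized T, F --> x.

Definition sequentially_open T (U : set X) : Prop :=
  forall (x_ : nat -> X) (x : X), U x ->
    (x_ : nat -> topologized T) n @[n --> \oo] --> (x : topologized T) ->
    \forall n \near \oo, U (x_ n).

Definition C_sequential T : Prop :=
  forall U : set X, convex_set (U : set (convex_lmodType X)) ->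
    sequentially_open T U -> opens T U.

Definition top_dual T : set (X -> K^o) :=
  [set y | linear y /\ continuous (y : topologized T -> K^o)].

(* sigma(Y, X) is the topology that Y inherits from {ptws X -> K}, and
   compactness does not depend on the surrounding space. *)
Definition weakly_compact (B : set (X -> K^o)) : Prop :=
  compact (B : set {ptws X -> K^o}).

Definition absolutely_convex (B : set (X -> K^o)) : Prop :=
  forall (y z : X -> K^o) (a b : K), B y -> B z -> nrm a + nrm b <= 1 ->
    B (fun x => a *: y x + b *: z x).

Definition mackey_topology (Y : set (X -> K^o)) : topology X :=
  seminorm_topology [set p | exists B : set (X -> K^o),
    [/\ B `<=` Y, absolutely_convex B, weakly_compact B &
        p = fun x => sup [set nrm (y x) | y in B]]].

Definition mackey_space T : Prop := T = mackey_topology (top_dual T).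

Definition strong_mackey_space T : Prop :=
  mackey_space T /\ forall B : set (X -> K^o), B `<=` top_dual T ->
    weakly_compact B ->
    equicontinuous B (fun y => (y : topologized T -> K^o)).

End saks_spaces.

Section topological_notions.
Context (R : realType) (Omega : topologicalType).

Definition kR_space : Prop :=
  forall Y : topologicalType, completely_regular_space Y ->
  forall f : Omega -> Y,
    (forall C : set Omega, compact C -> {within C, continuous f}) ->
    continuous f.

Definition hemicompact : Prop :=
  exists C : nat -> set Omega, (forall n, compact (C n)) /\
    forall D : set Omega, compact D -> exists n, D `<=` C n.

Definition completely_metrisable : Prop :=
  exists d : Omega -> Omega -> R,
  [/\ [/\ forall x y, 0 <= d x y,
          forall x y, d x y = 0 <-> x = y,
          forall x y, d x y = d y x &
          forall x y z, d x z <= d x y + d y z],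
      forall (x : Omega) (A : set Omega),
        nbhs x A <-> exists2 e, 0 < e & [set y | d x y < e] `<=` A &
      forall x_ : nat -> Omega,
        (forall e, 0 < e -> exists n0, forall m n : nat,
          (n0 <= m)%N -> (n0 <= n)%N -> d (x_ m) (x_ n) < e) ->
        exists x : Omega, x_ n @[n --> \oo] --> x].

Definition discrete_space : Prop := forall A : set Omega, open A.

Definition upper_semicontinuous (w : Omega -> R) : Prop :=
  forall x a, w x < a -> \forall y \near x, w y < a.

Definition vanishes_at_infinity (w : Omega -> R) : Prop :=
  forall e, 0 < e -> compact [set x | e <= w x].

Definition Wb0 : set (Omega -> R) :=
  [set w | [/\ forall x, 0 <= w x, vanishes_at_infinity w &
                exists M, forall x, w x <= M]].

Definition Wusc0 : set (Omega -> R) :=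
  [set w | [/\ forall x, 0 <= w x, vanishes_at_infinity w &
                upper_semicontinuous w]].

Definition C0_plus : set (Omega -> R) :=
  [set w | [/\ forall x, 0 <= w x, vanishes_at_infinity w &
                continuous (w : Omega -> R^o)]].

End topological_notions.

Section weighted_space.
Context (R : realType) (s : scalars).
Local Notation K := (scalar_field R s).
Context (Omega : topologicalType) (v : Omega -> {posnum R}).
Context (E : normedModType K).

Definition Cv_set : set (Omega -> E) :=
  [set f | continuous f /\ exists M : R, forall x, nrm (f x) * (v x)%:num <= M].

Definition Cv_pred : {pred Omega -> E} := mem Cv_set.

Lemma Cv_submod_closed : submod_closed Cv_pred.
Proof.
split=> [|a f g].
  rewrite inE; split=> [x|]; first exact: cvg_cst.
  by exists 0 => x; rewrite nrm0 mul0r.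
rewrite !inE => -[cf [M fM]] [cg [L gL]]; split=> [x|].
  by apply: cvgD; [apply: cvgZr; exact: cf|exact: cg].
exists (nrm a * M + L) => x; apply: (@le_trans _ _
    (nrm a * (nrm (f x) * (v x)%:num) + nrm (g x) * (v x)%:num)).
  rewrite mulrA -mulrDl ler_wpM2r// -nrmZ; exact: nrmD.
by rewrite lerD// ler_wpM2l// nrm_ge0.
Qed.

HB.instance Definition _ :=
  GRing.isSubmodClosed.Build _ _ Cv_pred Cv_submod_closed.

Record Cv := MkCv { Cv_fun :> Omega -> E ; Cv_funP : Cv_fun \in Cv_pred }.

HB.instance Definition _ := [isSub for Cv_fun].
HB.instance Definition _ := [Choice of Cv by <:].
HB.instance Definition _ := [SubChoice_isSubLmodule of Cv by <:].

Definition wval (f : Cv) (x : Omega) : R := nrm (f x) * (v x)%:num.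

Definition Cv_norm (f : Cv) : R := sup [set wval f x | x in [set: Omega]].

(* {family compact, Omega -> E} is the library's topology of uniform
   convergence on compact sets. *)
Definition tau_co : topology Cv :=
  @induced_topology Cv {family compact, Omega -> E} Cv_fun.

Definition tau_N : topology Cv :=
  seminorm_topology [set p : Cv -> R | exists2 N : set Omega, finite_set N &
    p = fun f => sup [set wval f x | x in N]].

Definition compact_seminorms : set (Cv -> R) :=
  [set p | exists (C : nat -> set Omega) (a : nat -> R),
    [/\ forall n, compact (C n), c0_plus a &
        p = fun f => sup [set sup [set wval f x * a n | x in C n]
                         | n in [set: nat]]]].

Definition point_seminorms : set (Cv -> R) :=
  [set p | exists (x_ : nat -> Omega) (a : nat -> R),
    c0_plus a /\
    p = fun f => sup [set wval f (x_ n) * a n | n in [set: nat]]].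

Definition weight_seminorms (W : set (Omega -> R)) : set (Cv -> R) :=
  [set p | exists2 w, W w &
    p = fun f => sup [set wval f x * w x | x in [set: Omega]]].

End weighted_space.

Arguments Cv_set {R s Omega} v E.
Arguments Cv_norm {R s Omega} v E.
Arguments tau_co {R s Omega} v E.
Arguments tau_N {R s Omega} v E.
Arguments compact_seminorms {R s Omega} v E.
Arguments point_seminorms {R s Omega} v E.
Arguments weight_seminorms {R s Omega} v E.
Arguments Wb0 : clear implicits.
Arguments Wusc0 : clear implicits.
Arguments C0_plus : clear implicits.
Arguments completely_metrisable : clear implicits.

Definition Cv_sigma (R : realType) (s : scalars) (Omega : topologicalType)
    (v : Omega -> {posnum R}) (E : normedModType (scalar_field R s)) :
    set (Omega -> E) :=
  [set f : Omega -> E | forall e : E -> (scalar_field R s)^o, linear e -> continuous e ->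
            Cv_set v (scalar_field R s)^o (e \o f)].

Arguments Cv_sigma {R s Omega} v E.

Definition banach (K : numFieldType) (E : normedModType K) : Prop :=
  forall F : set_system E, ProperFilter F -> cauchy F -> cvg F.

(* Main.v *)
(** Truncating [f] radially at the levels 0, 1, 2, ... writes a function of weighted
norm at most [m] as a sum of [m] layers of norm at most 1, the [n]-th of which
vanishes wherever the weighted norm of [f] is at most [n].  If moreover that norm
is at most [n] on a compact set [C n] for each [n], then the layers lie in any
neighbourhoods prescribed on the unit ball by the [C n].  So the topology generated
by the seminorms of (a) is finer than every linear topology that coincides with the
compact-open topology on bounded sets, and convex sets that are neighbourhoods of 0 relative to bounded
sets are neighbourhoods of 0; this gives (a) and (d), and (f) follows by comparing
seminorms.

For (e), the Mackey seminorms dominate those of (a) by the Hahn-Banach theorem.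
Conversely, by the same layers, a weakly compact set [B] of functionals is
equicontinuous as soon as it is norm bounded (uniform boundedness, for [B] a disc
or for [E] complete) and uniformly tight.  If tightness failed, one could build
a bounded continuous function by superposing humps [f] that vanish on larger and
larger compact sets, each new hump multiplying the previous sum by
[1 - |f|] to keep the norm at most 1; its values under the functionals that see
the humps stay away from the value under a cluster point of these functionals.
In a metric space the humps vanish on uniform neighbourhoods of compact sets only,
and completeness turns the outcome into compact sets as in Prohorov's theorem. *)

Require Import Defs.
From HB Require Import structures.
From mathcomp Require Import all_boot all_order all_algebra.
From mathcomp Require Import all_classical all_reals all_analysis.
From mathcomp Require Import complex ring lra.

Set Implicit Arguments.
Unset Strict Implicit.
Unset Printing Implicit Defensive.

Import Order.TTheory GRing.Theory Num.Theory.
Import numFieldTopology.Exports numFieldNormedType.Exports.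

Local Open Scope classical_set_scope.
Local Open Scope ring_scope.

(** * Real scalars and norms *)

(** Radial truncation uses only the norm of [E] and the continuity of [v], so it works on every
    Omega, whereas cut-off functions in the domain would require more of the space. The competitors
    in the definition of the mixed topology are merely linear, hence convex combinations of layers
    are replaced there by neighbourhoods all of whose finite sums stay in a given one; for
    C-sequentiality the set is convex but not known to be a neighbourhood, and dyadic convex
    combinations take over. In the hump construction the obstacle is that a new hump may overlap the
    earlier ones. Damping by [1 - |f|] does disturb the previous sum, but only off the collar of the
    current compact set, so the sums still stabilise. Weak compactness gives cluster points, not
    convergent subsequences, and it is used twice: for functionals indexed by all compact sets
    (cluster point [yi]), then for the sequence [y] selected from them (cluster point [z]). Two
    iterated limits clash: [y n] is close to [yi] on every earlier sum [g j] but far from it on the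
    limit [h], while tightness of the single functionals [yi] and [z] lets [g j] replace [h]. *)

Section real_scalars.
Context (R : realType) (s : scalars).
Local Notation K := (scalar_field R s).

(** Modules here are over [K] only, so every real coefficient has to pass through this embedding. *)
Definition kreal (r : R) : K :=
  match s as s0 return scalar_field R s0 with
  | Reals => r
  | Complexes => r%:C%C
  end.

Lemma krealD a b : kreal (a + b) = kreal a + kreal b.
Proof. by rewrite /kreal; case: s => //=; rewrite rmorphD. Qed.

Lemma krealM a b : kreal (a * b) = kreal a * kreal b.
Proof. by rewrite /kreal; case: s => //=; rewrite rmorphM. Qed.

Lemma krealN a : kreal (- a) = - kreal a.
Proof. by rewrite /kreal; case: s => //=; rewrite rmorphN. Qed.

Lemma kreal0 : kreal 0 = 0.
Proof. by rewrite /kreal; case: s. Qed.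

Lemma kreal1 : kreal 1 = 1.
Proof. by rewrite /kreal; case: s. Qed.

Lemma krealB a b : kreal (a - b) = kreal a - kreal b.
Proof. by rewrite krealD krealN. Qed.

Lemma kreal_ge0 r : (0 <= kreal r) = (0 <= r).
Proof. by rewrite /kreal; case: s => //=; rewrite ler0c. Qed.

Lemma kreal_gt0 r : (0 < kreal r) = (0 < r).
Proof. by rewrite /kreal; case: s => //=; rewrite ltcR. Qed.

Lemma kreal_lt a b : (kreal a < kreal b) = (a < b).
Proof. by rewrite -subr_gt0 -krealB kreal_gt0 subr_gt0. Qed.

Lemma real_of_kreal r : real_of (kreal r) = r.
Proof. by rewrite /kreal /real_of; case: s. Qed.

Lemma kreal_real_of (x : K) : 0 <= x -> kreal (real_of x) = x.
Proof. by rewrite /kreal /real_of; move: x; case: s => //= x /ger0_real/RRe_real. Qed.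

Lemma kreal_nrm (V : normedZmodType K) (x : V) : kreal (nrm x) = `|x|.
Proof. exact/kreal_real_of/normr_ge0. Qed.

Lemma nrm_kreal r : nrm (kreal r) = `|r|.
Proof.
case: (ger0P r) => r0; rewrite /nrm.
  by rewrite ger0_norm ?kreal_ge0// real_of_kreal.
rewrite -normrN -krealN ger0_norm ?real_of_kreal// kreal_ge0 oppr_ge0; exact: ltW.
Qed.

Lemma nrmN (V : normedZmodType K) (x : V) : nrm (- x) = nrm x.
Proof. by rewrite /nrm normrN. Qed.

Lemma nrmB (V : normedZmodType K) (x y : V) : nrm (x - y) = nrm (y - x).
Proof. by rewrite /nrm distrC. Qed.

Lemma nrm_eq0 (V : normedZmodType K) (x : V) : nrm x = 0 -> x = 0.
Proof. by move=> x0; apply/eqP; rewrite -normr_eq0 -kreal_nrm x0 kreal0. Qed.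

Lemma nrm1 : nrm (1 : K) = 1.
Proof. by rewrite -kreal1 nrm_kreal normr1. Qed.

Lemma nrmM (x y : K) : nrm (x * y) = nrm x * nrm y.
Proof. by rewrite /nrm normrM real_of_ge0M. Qed.

Lemma nrm_ler_dist (V : normedZmodType K) (x y : V) :
  `|nrm x - nrm y| <= nrm (x - y).
Proof.
have := nrmD (x - y) y; have := nrmD (y - x) x.
by rewrite !subrK (nrmB y x) ler_norml => h1 h2; apply/andP; split; lra.
Qed.

Lemma nrm_dist_triangle (V : normedZmodType K) (x y z : V) :
  nrm (x - z) <= nrm (x - y) + nrm (y - z).
Proof. by have := nrmD (x - y) (y - z); rewrite addrA subrK. Qed.

Lemma nbhs_nrmP (V : normedModType K) (x : V) (A : set V) :
  nbhs x A <-> exists2 r : R, 0 < r & forall y, nrm (x - y) < r -> A y.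
Proof.
rewrite -nbhs_nbhs_norm; split=> [[e /= e0 eA]|[r r0 rA]].
  exists (real_of e); first by rewrite -kreal_gt0 kreal_real_of ?ltW.
  move=> y xy; apply: eA => /=.
  by rewrite -kreal_nrm -(@kreal_real_of e) ?kreal_lt// ltW.
exists (kreal r); first by rewrite /= kreal_gt0.
by move=> y /=; rewrite -kreal_nrm kreal_lt => /rA.
Qed.

Lemma cvg_nrmP (V : normedModType K) (T : Type) (F : set_system T) (FF : Filter F)
    (f : T -> V) (l : V) :
  f @ F --> l <-> forall e : R, 0 < e -> F [set t | nrm (l - f t) < e].
Proof.
split=> [fl e e0|fl A /nbhs_nrmP[r r0 rA]].
  by apply: (fl [set y | nrm (l - y) < e]); apply/nbhs_nrmP; exists e.
by apply: filterS (fl _ r0) => t; exact: rA.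
Qed.

Lemma continuous_nrmP (V : normedModType K) (T : topologicalType) (f : T -> V) :
  continuous f <-> forall x (e : R), 0 < e -> \forall y \near x, nrm (f x - f y) < e.
Proof.
split=> [cf x e e0|cf x].
  by have := cf x; move/cvg_nrmP; apply.
by apply/cvg_nrmP => e e0; exact: cf.
Qed.

Lemma continuous_kreal : continuous (kreal : R -> K^o).
Proof.
apply/continuous_nrmP => x e e0.
have : nbhs x (ball x e) by exact: nbhsx_ballx.
by apply: filterS => y; rewrite /ball/= -krealB nrm_kreal.
Qed.

Lemma continuous_nrm (V : normedModType K) : continuous (@nrm R s V : V -> R).
Proof.
move=> x; apply/cvgrPdist_lt => e e0.
have : nbhs x [set y : V | nrm (x - y) < e] by apply/nbhs_nrmP; exists e.
by apply: filterS => y; exact/le_lt_trans/nrm_ler_dist.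
Qed.

Lemma continuous_nrmo : continuous (fun z : K^o => nrm z : R).
Proof. exact: (@continuous_nrm K^o). Qed.

End real_scalars.
Arguments kreal {R} s r.

(** The disc is closed in a segment, or in the continuous image of a square. These discs are the
    factors in the Tychonoff argument of [polar_compact]. *)
Lemma compact_nrm_le (R : realType) (s : scalars) (r : R) :
  compact [set z : (scalar_field R s)^o | nrm z <= r].
Proof.
have clD t : closed [set z : (scalar_field R t)^o | nrm z <= r].
  apply: (@preimage_closed _ _ (fun z : (scalar_field R t)^o => nrm z) [set x | x <= r]).
    by move=> x _; exact: continuous_nrmo.
  exact: closed_le.
have sqrt_le (a b : R) : Num.sqrt (a ^+ 2 + b ^+ 2) <= `|a| + `|b|.
  have ab0 : 0 <= `|a| + `|b| by rewrite addr_ge0.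
  rewrite -[leRHS](ger0_norm ab0) -(sqrtr_sqr (`|a| + `|b|)).
  rewrite ler_sqrt ?sqr_ge0// (sqrrD `|a|) !real_normK ?num_real// addrAC.
  by rewrite lerDl mulrn_wge0// mulr_ge0.
case: s.
  apply: (@subclosed_compact (scalar_field R Reals)^o _ (`[- r, r] : set R)).
  - exact: (clD Reals).
  - exact: segment_compact.
  - by move=> z /=; rewrite in_itv /= -ler_norml.
have boxc := compact_setX (@segment_compact R (- r) r) (@segment_compact R (- r) r).
pose f (z : R * R) : (scalar_field R Complexes)^o := (z.1 +i* z.2)%C.
have cf : continuous f.
  apply/continuous_nrmP => z e e0.
  have e20 : 0 < e / 2 by rewrite divr_gt0.
  have zN : nbhs z (ball z (e / 2)) by exact: nbhsx_ballx.
  apply: filterS zN => w [/= zw1 zw2].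
  pose a := z.1 - w.1; pose b := z.2 - w.2.
  suff : nrm ((a +i* b)%C : (scalar_field R Complexes)^o) < e by [].
  have -> : nrm ((a +i* b)%C : (scalar_field R Complexes)^o) = Num.sqrt (a ^+ 2 + b ^+ 2).
    exact: (congr1 (@complex.Re R) (normc_def (a +i* b)%C)).
  by rewrite (le_lt_trans (sqrt_le _ _))// (splitr e) ltrD.
apply: (@subclosed_compact (scalar_field R Complexes)^o _
  (f @` (`[- r, r] `*` `[- r, r]))); first exact: clD.
  apply: continuous_compact boxc; exact/continuous_subspaceT.
move=> z /= zr; exists (complex.Re z, complex.Im z); last by rewrite /f/=; case: (z).
have {}zr : Num.sqrt (complex.Re z ^+ 2 + complex.Im z ^+ 2) <= r by move: zr; case: (z).
split => /=; rewrite in_itv /= -ler_norml; apply: le_trans zr.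
  by rewrite -sqrtr_sqr ler_sqrt ?addr_ge0 ?sqr_ge0// lerDl sqr_ge0.
by rewrite -sqrtr_sqr ler_sqrt ?addr_ge0 ?sqr_ge0// lerDr sqr_ge0.
Qed.

(** * The Hahn-Banach theorem *)

Section hahn_banach.
Context (R : realType) (s : scalars).
Local Notation K := (scalar_field R s).
Context (V : lmodType K).
Implicit Types (p q : V -> R) (u x y : V).

(** Homogeneity is an inequality, which passes easily to infima; applied to [t^-1] it gives the
    equality of [sublinearZ]. *)
Definition sublinear p : Prop :=
  (forall x y, p (x + y) <= p x + p y) /\
  (forall t x, 0 < t -> p (kreal s t *: x) <= t * p x).

Lemma sublinear0 p : sublinear p -> p 0 = 0.
Proof.
move=> [pD pZ]; have := pD 0 0; have := pZ 2^-1 0.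
by rewrite addr0 scaler0 => /(_ _)h1 h2; have := h1 ltac:(by rewrite invr_gt0); lra.
Qed.

Lemma sublinearZ p t x : sublinear p -> 0 <= t -> p (kreal s t *: x) = t * p x.
Proof.
move=> sp; rewrite le_eqVlt => /predU1P[<-|t0].
  by rewrite kreal0 scale0r mul0r sublinear0.
have [pD pZ] := sp; apply/eqP; rewrite eq_le pZ//=.
have := pZ t^-1 (kreal s t *: x); rewrite invr_gt0 => /(_ t0).
by rewrite scalerA -krealM mulVf ?gt_eqF// kreal1 scale1r ler_pdivlMl.
Qed.

Lemma sublinear_geN p x : sublinear p -> - p (- x) <= p x.
Proof.
move=> sp; have := sp.1 x (- x); rewrite subrr (sublinear0 sp); lra.
Qed.

(* [slope p u] is sublinear, at most [p], and [slope p u (- u) <= - p u]; hence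
   a minimal sublinear functional equals all its slopes and so is odd. *)
Definition slope_set p u x : set R :=
  [set p (x + kreal s t *: u) - t * p u | t in [set t | 0 <= t]].

Definition slope p u x : R := inf (slope_set p u x).

Lemma slope_has_inf p u x : sublinear p -> has_inf (slope_set p u x).
Proof.
move=> sp; split; first by exists (p (x + kreal s 0 *: u) - 0 * p u); exists 0 => /=.
exists (- p (- x)) => _ [t /= t0 <-].
have := sp.1 (x + kreal s t *: u) (- x).
by rewrite addrAC subrr add0r (sublinearZ _ sp t0); lra.
Qed.

Lemma slope_le p u x t : sublinear p -> 0 <= t ->
  slope p u x <= p (x + kreal s t *: u) - t * p u.
Proof.
by move=> sp t0; apply: inf_lbound; [exact: (slope_has_inf u x sp).2|exists t].
Qed.

Lemma slope_le_id p u x : sublinear p -> slope p u x <= p x.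
Proof.
move=> sp; apply: (le_trans (slope_le u x sp (lexx 0))).
by rewrite kreal0 scale0r addr0 mul0r subr0.
Qed.

Lemma slopeN p u : sublinear p -> slope p u (- u) <= - p u.
Proof.
move=> sp; apply: (le_trans (slope_le u (- u) sp ler01)).
by rewrite kreal1 scale1r addNr (sublinear0 sp) mul1r sub0r.
Qed.

Lemma sublinear_slope p u : sublinear p -> sublinear (slope p u).
Proof.
move=> sp; split=> [x y|t x t0].
  rewrite -lerBlDr; apply: lb_le_inf; first exact: (slope_has_inf u x sp).1.
  move=> _ [a /= a0 <-]; rewrite lerBlDr -lerBlDl.
  apply: lb_le_inf; first exact: (slope_has_inf u y sp).1.
  move=> _ [b /= b0 <-].
  have := slope_le u (x + y) sp (addr_ge0 a0 b0).
  have := sp.1 (x + kreal s a *: u) (y + kreal s b *: u).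
  rewrite addrACA -scalerDl -krealD mulrDl; lra.
rewrite -ler_pdivrMl//; apply: lb_le_inf; first exact: (slope_has_inf u x sp).1.
move=> _ [a /= a0 <-]; rewrite ler_pdivrMl//.
have ta0 : 0 <= t * a by rewrite mulr_ge0// ltW.
apply: (le_trans (slope_le u _ sp ta0)).
rewrite krealM -scalerA -scalerDr mulrBr mulrA lerB//.
exact: sp.2.
Qed.

(** Zorn's lemma for the reversed pointwise order. The infimum of a chain is finite because every
    member is at least [- p (- x)] at [x], and it is subadditive because of any two members the
    smaller one serves for both summands. *)
Lemma minimal_sublinear p : sublinear p ->
  exists q, [/\ sublinear q, forall x, q x <= p x &
    forall q', sublinear q' -> (forall x, q' x <= q x) -> q' = q].
Proof.
move=> sp; pose T := {q : V -> R | sublinear q /\ forall x, q x <= p x}.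
pose r (a b : T) := `[< forall x, sval b x <= sval a x >].
have [||||q qmin] := @Zorn T r.
- by move=> a; apply/asboolP.
- by move=> b a c /asboolP ab /asboolP bc; apply/asboolP => x; exact: le_trans (bc x) (ab x).
- move=> [a aP] [b bP] /asboolP/= ab /asboolP/= ba; apply: eq_exist => /=.
  by apply/funext => x; apply/eqP; rewrite eq_le ab ba.
- move=> A Atot; have [->|/set0P[a0 Aa0]] := eqVneq A set0.
    by exists (exist _ p (conj sp (fun x => lexx (p x)))).
  pose S x := [set sval a x | a in A].
  have Sinf x : has_inf (S x).
    split; first by exists (sval a0 x); exists a0.
    exists (- p (- x)) => _ [[a [sa ap]] Aa <-] /=.
    by apply: le_trans (sublinear_geN x sa); rewrite lerN2.
  have Sle a x : A a -> inf (S x) <= sval a x.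
    by move=> Aa; apply: inf_lbound; [exact: (Sinf x).2|exists a].
  have m_sub : sublinear (fun x => inf (S x)).
    split=> [x y|t x t0].
      rewrite -lerBlDr; apply: lb_le_inf; first exact: (Sinf x).1.
      move=> _ [a Aa <-]; rewrite lerBlDr -lerBlDl.
      apply: lb_le_inf; first exact: (Sinf y).1.
      move=> _ [b Ab <-]; rewrite lerBlDl.
      case: (Atot _ _ Aa Ab) => /asboolP ab.
        apply: (le_trans (Sle b _ Ab)).
        by apply: (le_trans ((svalP b).1.1 x y)); rewrite lerD2r.
      apply: (le_trans (Sle a _ Aa)).
      by apply: (le_trans ((svalP a).1.1 x y)); rewrite lerD2l.
    rewrite -ler_pdivrMl//; apply: lb_le_inf; first exact: (Sinf x).1.
    move=> _ [a Aa <-]; rewrite ler_pdivrMl//.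
    exact: (le_trans (Sle a _ Aa) ((svalP a).1.2 t x t0)).
  have m_le x : inf (S x) <= p x.
    by apply: (le_trans (Sle a0 _ Aa0)); exact: (svalP a0).2.
  exists (exist (fun q => sublinear q /\ forall x, q x <= p x) _ (conj m_sub m_le)).
  by move=> a Aa; apply/asboolP => x /=; exact: Sle.
exists (sval q); have [sq qp] := svalP q; split => // q' sq' q'q.
have q'p x : q' x <= p x by exact: le_trans (q'q x) (qp x).
by rewrite -(qmin (exist _ q' (conj sq' q'p)))//; apply/asboolP.
Qed.

(** Minimising below [slope p u] instead of below [p] forces the value at [u]: oddness gives [- l u
    = l (- u) <= slope p u (- u) <= - p u]. *)
Lemma real_hahn_banach p u : sublinear p ->
  exists l : V -> R, [/\ forall x y, l (x + y) = l x + l y,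
    forall t x, l (kreal s t *: x) = t * l x, forall x, l x <= p x & l u = p u].
Proof.
move=> sp; have [l [sl lp lmin]] := minimal_sublinear (sublinear_slope u sp).
have lN x : l (- x) = - l x.
  have lx : slope l x = l.
    by apply: lmin; [exact: sublinear_slope|move=> y; exact: slope_le_id].
  apply/eqP; rewrite eq_le; apply/andP; split; first by rewrite -{1}lx slopeN.
  by have := sublinear_geN (- x) sl; rewrite opprK.
have lep x : l x <= p x by apply: le_trans (lp x) (slope_le_id u x sp).
exists l; split => //.
- move=> x y; apply/eqP; rewrite eq_le sl.1/=.
  by have := sl.1 (- x) (- y); rewrite -opprD !lN; lra.
- move=> t x; have [t0|t0] := leP 0 t; first exact: sublinearZ.
  have := sublinearZ (- x) sl (ltac:(by rewrite oppr_ge0 ltW) : 0 <= - t).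
  by rewrite lN mulrNN krealN scaleNr scalerN opprK.
- apply/eqP; rewrite eq_le lep/=.
  by have := le_trans (lp (- u)) (slopeN u sp); rewrite lN; lra.
Qed.

End hahn_banach.

Lemma hahn_banach (R : realType) (s : scalars) (V : lmodType (scalar_field R s))
    (p : V -> R) (u : V) : is_seminorm p ->
  exists e : V -> (scalar_field R s)^o,
    [/\ linear e, forall x, nrm (e x) <= p x & nrm (e u) = p u].
Proof.
move=> [p0 pD pZ].
have sp : sublinear p.
  by split => // t x t0; rewrite pZ nrm_kreal gtr0_norm.
have [l [lD lZ lp lu]] := real_hahn_banach u sp.
case: s V p u p0 pD pZ sp l lD lZ lp lu => V p u p0 pD pZ sp l lD lZ lp lu.
  exists l; split.
  - by move=> a x y; rewrite lD (lZ a).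
  - move=> x; rewrite /nrm /= ler_norml lp andbT.
    have := lp (- x); have := lZ (-1) x; have := pZ (-1) x.
    by rewrite /kreal /= !scaleN1r mulN1r /nrm /= normrN1 mul1r => -> ->; lra.
  - by rewrite /nrm /= lu ger0_norm.
have lN x : l (- x) = - l x by have := lZ (-1) x; rewrite krealN kreal1 scaleN1r mulN1r.
(* The complex functional with real part [l]. Its modulus at [x] is the value of [l] at a rotation
   of [x], and [p] is invariant under rotations. *)
pose e x : (scalar_field R Complexes)^o := (l x +i* - l ('i%C *: x))%C.
have eD x y : e (x + y) = e x + e y.
  by apply/eqP; rewrite eq_complex /= scalerDr !lD opprD !eqxx.
have eZ a x : e (a *: x) = a *: e x.
  case: a => a b.
  have aE : (a +i* b)%C = kreal Complexes a + 'i%C * kreal Complexes b.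
    by apply/eqP; rewrite eq_complex /=; apply/andP; split; apply/eqP; ring.
  have lab y : l ((a +i* b)%C *: y) = a * l y + b * l ('i%C *: y).
    by rewrite aE scalerDl lD mulrC -scalerA !lZ.
  have iab : 'i%C *: ((a +i* b)%C *: x) = (a +i* b)%C *: ('i%C *: x).
    by rewrite !scalerA mulrC.
  have iix : 'i%C *: ('i%C *: x) = - x.
    by rewrite scalerA -expr2 sqr_i scaleN1r.
  apply/eqP; rewrite eq_complex /= iab !lab iix lN.
  by apply/andP; split; apply/eqP; ring.
have ep x : nrm (e x) <= p x.
  have [e0|e0] := eqVneq (e x) 0; first by rewrite e0 nrm0.
  have n0 : `|e x : R[i]| != 0 by rewrite normr_eq0.
  pose c : R[i] := `|e x : R[i]| / (e x : R[i]).
  have ec : e (c *: x) = `|e x : R[i]| by rewrite eZ /c -[LHS]/(_ * _) mulrVK ?unitfE.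
  have nc : nrm (c : scalar_field R Complexes) = 1.
    by rewrite /nrm /c normrM normfV normr_id mulfV //= real_of_kreal.
  have <- : p (c *: x) = p x by rewrite pZ nc mul1r.
  by apply: le_trans (lp _); have := congr1 (@complex.Re R) ec => /= ->.
exists e; split => //.
- by move=> a x y; rewrite eD eZ.
- apply/eqP; rewrite eq_le ep/= -lu.
  have := @real_of_le R Complexes _ _ (normc_ge_Re (e u)); apply: le_trans.
  exact: ler_norm.
Qed.

(** * Topologies generated by seminorms *)

Lemma topology_ext (X : choiceType) (T T' : topology X) :
  coarser T T' -> coarser T' T -> T = T'.
Proof.
move=> TT' T'T; have oE : opens T = opens T' by exact/seteqP.
case: T T' oE {TT' T'T} => [A a1 b1 c1] [B a2 b2 c2] /= oE.
move: a1 b1 c1 a2 b2 c2; rewrite oE => *; congr Topology; exact: Prop_irrelevance.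
Qed.

(** If [P A] failed, the sets [B] with [P (A \ B)] would form a proper filter containing [A], and
    the local hypothesis at a cluster point would contradict it. This stands in for the extraction
    of finite subcovers. *)
Lemma compact_induction (T : topologicalType) (P : set T -> Prop) (A : set T) :
  compact A -> P set0 -> (forall B C, B `<=` C -> P C -> P B) ->
  (forall B C, P B -> P C -> P (B `|` C)) ->
  (forall x, A x -> exists2 U, nbhs x U & P (U `&` A)) -> P A.
Proof.
move=> cA P0 Psub PU Ploc; apply: contrapT => nPA.
pose F : set_system T := [set B | P (A `\` B)].
have FF : ProperFilter F.
  split; first by rewrite /F /= setD0.
  split; first by rewrite /F /= setDT.
    by move=> B C PB PC; rewrite /F /= setDIr; exact: PU.
  by move=> B C BC; rewrite /F /=; apply: Psub => x [Ax nCx]; split => // /BC.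
have FA : F A by rewrite /F /= setDv.
have [x [Ax xF]] := cA _ FF FA; have [U xU PUA] := Ploc _ Ax.
have FU : F (~` U) by rewrite /F /= setDE setCK setIC.
by have [y [nUy Uy]] := xF _ _ FU xU.
Qed.

Lemma nbhs_topologized (X : choiceType) (T : topology X) (x : topologized T)
    (A : set (topologized T)) :
  nbhs x A <-> exists U : set X, [/\ opens T U, U x & U `<=` A].
Proof.
rewrite nbhsE; split=> [[U [oU Ux] UA]|[U [oU Ux UA]]]; first by exists U.
by exists U.
Qed.

Section seminorms.
Context (R : realType) (s : scalars).
Local Notation K := (scalar_field R s).
Context (X : lmodType K).
Implicit Types (p q : X -> R) (P Q : set (X -> R)).

Lemma seminorm0 p : is_seminorm p -> p 0 = 0.
Proof. by move=> [_ _ pZ]; rewrite -(scale0r (0 : X)) pZ nrm0 mul0r. Qed.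

Lemma seminormN p x : is_seminorm p -> p (- x) = p x.
Proof. by move=> [_ _ pZ]; rewrite -scaleN1r pZ nrmN nrm1 mul1r. Qed.

Lemma seminormB p x y : is_seminorm p -> p (x - y) = p (y - x).
Proof. by move=> sp; rewrite -(seminormN (y - x) sp) opprB. Qed.

Lemma seminorm_triangle p y x z : is_seminorm p -> p (x - z) <= p (x - y) + p (y - z).
Proof. by move=> [_ pD _]; have := pD (x - y) (y - z); rewrite addrA subrK. Qed.

Lemma seminorm_dist p x y : is_seminorm p -> `|p x - p y| <= p (x - y).
Proof.
move=> sp; have := seminorm_triangle y x 0 sp; have := seminorm_triangle x y 0 sp.
by rewrite !subr0 (seminormB y x sp) ler_norml => h1 h2; apply/andP; split; lra.
Qed.

Lemma seminorm_bound p q e : is_seminorm p -> is_seminorm q -> 0 < e ->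
  (forall x, p x < e -> q x <= 1) -> forall x, q x <= 2 / e * p x.
Proof.
move=> [p0 pD pZ] [q0 qD qZ] e0 pq x; rewrite leNgt; apply/negP => qx.
have qx0 : 0 < q x.
  by apply: le_lt_trans qx; rewrite mulr_ge0// divr_ge0// ltW.
(* Rescaled to [q]-value 2, beyond the bound 1, the vector still has [p]-value below [e]; the
   argument covers [p x = 0]. *)
have t0 : 0 <= 2 / q x by rewrite divr_ge0// ltW.
have := pq (kreal s (2 / q x) *: x); rewrite pZ qZ nrm_kreal ger0_norm//.
rewrite divfK ?gt_eqF// => /(_ _).
suff : 2 / q x * p x < e by move=> h1 h2; have := h2 h1; lra.
by rewrite mulrAC ltr_pdivrMr// -ltr_pdivrMl// mulrCA mulrA.
Qed.

Lemma linear_subr (W : lmodType K) (y : X -> W) a b : linear y -> y (a - b) = y a - y b.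
Proof. by move=> ly; rewrite addrC -scaleN1r ly scaleN1r addrC. Qed.

Lemma is_seminorm_nrm (f : X -> K^o) : linear f -> is_seminorm (fun x => nrm (f x)).
Proof.
move=> lf; have fD x y : f (x + y) = f x + f y.
  by have := lf 1 x y; rewrite !scale1r.
have f0 : f 0 = 0 by apply: (addrI (f 0)); rewrite -fD !addr0.
split=> [x|x y|a x]; [exact: nrm_ge0|by rewrite fD nrmD|].
by have := lf a x 0; rewrite !addr0 f0 addr0 => ->; rewrite (@nrmZ R s K^o).
Qed.

Lemma directed_finite P (F : set (X -> R)) : directed_system P ->
  finite_set F -> F `<=` P -> exists2 r, P r & forall p, F p -> forall x, p x <= r x.
Proof.
move=> [[p0 Pp0] Pdir] /finite_seqP[l ->]; elim: l => [|p l IH] lP.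
  by exists p0.
have [|r Pr lr] := IH; first by move=> q ql; apply: lP => /=; rewrite inE [_ \in _]ql orbT.
have Pp : P p by apply: lP; rewrite /= mem_head.
have [r' Pr' rr'] := Pdir _ _ Pp Pr; exists r' => // q /=.
rewrite inE => /predU1P[->|ql] x; first exact: (rr' x).1.
exact: le_trans (lr _ ql x) (rr' x).2.
Qed.

Lemma seminorm_topology_open_ball P p x e : P p -> is_seminorm p ->
  opens (seminorm_topology P) [set y | p (y - x) < e].
Proof.
move=> Pp sp /= y yx; exists [set p]; split; [exact: finite_set1|by move=> _ ->|].
exists (e - p (y - x)); first by rewrite subr_gt0.
move=> z /(_ p erefl) zy; have := seminorm_triangle y z x sp; lra.
Qed.

Lemma nbhs_seminormP P (x : topologized (seminorm_topology P))
    (A : set (topologized (seminorm_topology P))) :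
  (forall p, P p -> is_seminorm p) -> directed_system P ->
  nbhs x A <-> exists2 p, P p & exists2 e : R, 0 < e &
    forall y : X, p (y - (x : X)) < e -> A y.
Proof.
move=> sP Pdir; rewrite nbhs_topologized; split=> [[U [oU Ux UA]]|].
  have [F [finF FP [e e0 eU]]] := oU _ Ux.
  have [r Pr Fr] := directed_finite Pdir finF FP.
  exists r => //; exists e => // y ye; apply/UA/eU => p Fp.
  exact: le_lt_trans (Fr p Fp _) ye.
move=> [p Pp [e e0 eA]]; exists [set y | p (y - (x : X)) < e]; split => //.
  by apply: seminorm_topology_open_ball => //; exact: sP.
by rewrite /= subrr seminorm0//; exact: sP.
Qed.

Lemma coarser_seminorm P Q : directed_system Q ->
  (forall q, Q q -> is_seminorm q) ->
  (forall p, P p -> exists2 q, Q q & exists2 C, 0 < C & forall x, p x <= C * q x) ->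
  coarser (seminorm_topology P) (seminorm_topology Q).
Proof.
move=> Qdir sQ PQ U oU /= x Ux; have [F [finF FP [e e0 eU]]] := oU _ Ux.
have [q Qq [C C0 Fq]] : exists2 q, Q q &
    exists2 C, 0 < C & forall p, F p -> forall x, p x <= C * q x.
  move/finite_seqP: finF => [l Fl]; rewrite {}Fl in FP * => {eU}.
  elim: l FP => [|p l IH] lP.
    by have [[q0 Qq0] _] := Qdir; exists q0 => //; exists 1.
  have [|r Qr [C C0 lr]] := IH.
    by move=> q ql; apply: lP => /=; rewrite inE [_ \in _]ql orbT.
  have [q Qq [D D0 pq]] : exists2 q, Q q & exists2 C, 0 < C & forall x, p x <= C * q x.
    by apply: PQ; apply: lP; rewrite /= mem_head.
  have [r' Qr' rr'] := Qdir.2 _ _ Qq Qr; exists r' => //; exists (D + C).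
    by rewrite addr_gt0.
  have [r'0 _ _] := sQ _ Qr'.
  move=> p' /=; rewrite inE => /predU1P[->|p'l] y; rewrite mulrDl.
    apply: (le_trans (pq y)); rewrite -[leLHS]addr0 lerD// ?mulr_ge0// ?(ltW C0)//.
    by rewrite ler_pM2l// (rr' y).1.
  apply: (le_trans (lr _ p'l y)); rewrite -[leLHS]add0r lerD// ?mulr_ge0// ?(ltW D0)//.
  by rewrite ler_pM2l// (rr' y).2.
exists [set q]; split; [exact: finite_set1|by move=> _ ->|].
exists (e / C); first by rewrite divr_gt0.
move=> y /(_ q erefl) yx; apply: eU => p Fp; apply: (le_lt_trans (Fq p Fp _)).
by rewrite mulrC -ltr_pdivlMr.
Qed.

(** Domination with constant 1 keeps the radius, so a finite family is treated member by member.
    This suits [point_seminorms] and [weight_seminorms], for which directedness is not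
    established. *)
Lemma coarser_seminorm_le P Q :
  (forall p, P p -> exists2 q, Q q & forall x, p x <= q x) ->
  coarser (seminorm_topology P) (seminorm_topology Q).
Proof.
move=> PQ U oU /= x Ux; have [F [finF FP [e e0 eU]]] := oU _ Ux.
have /choice[h hP] p : exists q, P p -> Q q /\ forall x, p x <= q x.
  have [Pp|nPp] := pselect (P p); last by exists p.
  by have [q Qq pq] := PQ _ Pp; exists q.
exists (h @` F); split; first exact: finite_image.
  by move=> _ [p Fp <-]; exact: (hP p (FP _ Fp)).1.
exists e => // y yx; apply: eU => p Fp.
apply: le_lt_trans (yx (h p) _); last by exists p.
exact: (hP p (FP _ Fp)).2.
Qed.

Section seminorm_topology_properties.
Context (P : set (X -> R)).
Hypotheses (sP : forall p, P p -> is_seminorm p) (Pdir : directed_system P).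
Local Notation T := (topologized (seminorm_topology P)).

Lemma seminorm_topology_linear : linear_topology (seminorm_topology P).
Proof.
split=> [[x y] A /= /(nbhs_seminormP _ _ sP Pdir)[p Pp [e e0 eA]]|].
  have [_ pD _] := sP Pp; have e20 : 0 < e / 2 by rewrite divr_gt0.
  have ball z : nbhs (z : T) [set w : X | p (w - (z : X)) < e / 2].
    by apply/(nbhs_seminormP _ _ sP Pdir); exists p => //; exists (e / 2).
  exists ([set w : X | p (w - x) < e / 2], [set w : X | p (w - y) < e / 2]).
    by split; exact: ball.
  move=> [a b] [/= ax yb]; apply: eA => /=.
  rewrite opprD addrACA; apply: (le_lt_trans (pD _ _)); rewrite (splitr e); exact: ltrD.
move=> [a x] A /= /(nbhs_seminormP _ _ sP Pdir)[p Pp [e e0 eA]].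
have [p0 pD pZ] := sP Pp.
(* Radii for the splitting [b w - a x = b (w - x) + (b - a) x]: [d <= 1] keeps [nrm b] below
   [nrm a + 1], and adding 1 to [p x] and to [nrm a] avoids zero denominators. *)
pose d := Num.min 1 (e / 2 / (p x + 1)); pose d' := e / 2 / (nrm a + 1).
have px1 : 0 < p x + 1 by rewrite ltr_pwDr.
have a1 : 0 < nrm a + 1 by rewrite ltr_pwDr// nrm_ge0.
have d0 : 0 < d by rewrite lt_min ltr01/= !divr_gt0.
have d'0 : 0 < d' by rewrite !divr_gt0.
exists ([set b : K^o | nrm ((a : K^o) - b) < d], [set w : X | p (w - x) < d']).
  split => /=; first by apply/nbhs_nrmP; exists d.
  by apply/(nbhs_seminormP _ _ sP Pdir); exists p => //; exists d'.
move=> [b w] [/= ab xw]; apply: eA => /=.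
have -> : (b : K) *: (w : X) - (a : K) *: (x : X) =
    (b : K) *: ((w : X) - x) + ((b : K) - a) *: (x : X).
  by rewrite scalerBr scalerBl addrA subrK.
apply: (le_lt_trans (pD _ _)); rewrite !pZ (splitr e).
have ba : nrm b <= nrm a + 1.
  have := nrm_dist_triangle (b : K^o) (a : K^o) 0; rewrite !subr0 (nrmB (b : K^o)).
  by move: ab; rewrite lt_min => /andP[ab _]; move: ab => /=; lra.
apply: ler_ltD.
  apply: (@le_trans _ _ ((nrm a + 1) * d')).
    by rewrite ler_pM ?nrm_ge0// ltW.
  by rewrite /d' mulrC divfK// gt_eqF.
rewrite -[ltRHS](@divfK _ (p x + 1)) ?gt_eqF//.
apply: (@le_lt_trans _ _ (nrm ((b : K) - a) * (p x + 1))).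
  by rewrite ler_wpM2l ?nrm_ge0// lerDl.
rewrite ltr_pM2r// (nrmB (b : K^o)).
by move: ab; rewrite lt_min => /andP[_].
Qed.

Lemma convex_seminorm_ball p x e : is_seminorm p ->
  convex_set ([set y | p (y - x) < e] : set (convex_lmodType X)).
Proof.
move=> [p0 pD pZ]; apply/convex_setW => y z; rewrite !inE /= => ye ze k k0 k1.
rewrite inE /=; set t := real_of k%:num.
have kE : k%:num = kreal s t by rewrite /t kreal_real_of// ltW.
have t0 : 0 < t by rewrite -(kreal_gt0 s) -kE.
have t1 : 0 < 1 - t by rewrite subr_gt0 -(kreal_lt s) -kE kreal1.
have -> : (conv k y z : convex_lmodType X) - x =
    kreal s t *: ((y : X) - x) + kreal s (1 - t) *: ((z : X) - x).
  rewrite !scalerBr addrACA -opprD -scalerDl -krealD (addrC t) subrK kreal1 scale1r.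
  by rewrite krealB kreal1 -kE.
apply: (le_lt_trans (pD _ _)); rewrite !pZ !nrm_kreal !gtr0_norm//.
have -> : e = t * e + (1 - t) * e by ring.
by rewrite ltrD// ltr_pM2l.
Qed.

Lemma seminorm_topology_lch : (forall x, (forall p, P p -> p x = 0) -> x = 0) ->
  locally_convex_hausdorff (seminorm_topology P).
Proof.
move=> sepP; split; first exact: seminorm_topology_linear.
  exists [set [set y : X | pxe.1.1 (y - pxe.1.2) < pxe.2] | pxe in
    [set pxe : (X -> R) * X * R | P pxe.1.1 /\ 0 < pxe.2]].
    move=> _ [[[p x] e] [/= Pp e0] <-]; exact/convex_seminorm_ball/sP.
  split.
    move=> _ [[[p x] e] [/= Pp e0] <-].
    by apply: seminorm_topology_open_ball => //; exact: sP.
  move=> x A /(nbhs_seminormP _ _ sP Pdir)[p Pp [e e0 eA]].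
  exists [set y : X | p (y - (x : X)) < e]; last exact: eA.
  split; first by exists (p, x : X, e).
  by rewrite /= subrr seminorm0//; exact: sP.
move=> x y xy; apply/eqP; rewrite -subr_eq0; apply/eqP; apply: (sepP ((x : X) - y)) => p Pp.
have sp := sP Pp; have [p0 _ _] := sp; apply/eqP; rewrite eq_le p0 andbT leNgt.
apply/negP => pxy; pose e := p ((x : X) - y) / 2.
have e0 : 0 < e by rewrite divr_gt0.
have ball z : nbhs (z : T) [set w : X | p (w - (z : X)) < e].
  by apply/(nbhs_seminormP _ _ sP Pdir); exists p => //; exists e.
have [z [/= zx zy]] := xy _ _ (ball x) (ball y).
have := seminorm_triangle z (x : X) y sp; rewrite (seminormB (x : X) z sp).
by move: zx zy; rewrite /e; lra.
Qed.

Lemma continuous_seminormP q : is_seminorm q ->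
  continuous (q : T -> R^o) <-> exists2 p, P p & exists2 C, 0 < C & forall x, q x <= C * p x.
Proof.
move=> sq; split=> [cq|[p Pp [C C0 qp]] x].
  have : nbhs ((0 : X) : T) [set x : X | q x < 1].
    apply: (cq (0 : X) [set r | r < 1]); rewrite seminorm0//; exact: (@lt_nbhsl R 0 1).
  move=> /(nbhs_seminormP _ _ sP Pdir)[p Pp [e e0 eq]].
  exists p => //; exists (2 / e); first by rewrite divr_gt0.
  apply: seminorm_bound => //; first exact: sP.
  by move=> x px; apply/ltW/eq; rewrite subr0.
apply/(@cvgrPdist_lt _ R^o _ _ (@nbhs_filter T x)) => e e0; rewrite near_nbhs.
apply/(nbhs_seminormP _ _ sP Pdir); exists p => //; exists (e / C); first by rewrite divr_gt0.
move=> y yx; apply: (le_lt_trans (seminorm_dist _ _ sq)).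
rewrite seminormB//; apply: (le_lt_trans (qp _)).
by rewrite mulrC -ltr_pdivlMr.
Qed.

Lemma continuous_functionalP (y : X -> K^o) : linear y ->
  continuous (y : T -> K^o) <->
  exists2 p, P p & exists2 C, 0 < C & forall x, nrm (y x) <= C * p x.
Proof.
move=> ly; have sy := is_seminorm_nrm ly.
split=> [cy|[p Pp [C C0 qp]]].
  apply/(continuous_seminormP sy) => x; apply: continuous_comp; first exact: cy.
  exact: continuous_nrmo.
apply/continuous_nrmP => x e e0.
apply/(nbhs_seminormP _ _ sP Pdir); exists p => //; exists (e / C); first by rewrite divr_gt0.
move=> z zx; rewrite -linear_subr//; apply: (le_lt_trans (qp _)); rewrite (seminormB _ _ (sP Pp)).
by rewrite mulrC -ltr_pdivlMr.
Qed.

End seminorm_topology_properties.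

Section linear_topology.
Context (T : topology X).
Hypothesis (lT : linear_topology T).

Lemma linear_nbhs_split (U : set X) : nbhs ((0 : X) : topologized T) U ->
  exists2 V : set X, nbhs ((0 : X) : topologized T) V &
    forall x y, V x -> V y -> U (x + y).
Proof.
move=> U0; have : nbhs ((0 : X) + (0 : X) : topologized T) U by rewrite addr0.
move=> /(lT.1 ((0 : X), (0 : X)))[[A B] /= [nA nB] AB].
exists (A `&` B); first exact: (@filterI (topologized T)).
by move=> x y [Ax _] [_ By]; exact: (AB (x, y)).
Qed.

Lemma linear_nbhs_translate (x : X) (U : set X) : nbhs (x : topologized T) U ->
  nbhs ((0 : X) : topologized T) [set h | U (x + h)].
Proof.
move=> Ux; have : nbhs (x + (0 : X) : topologized T) U by rewrite addr0.
move=> /(lT.1 (x, (0 : X)))[[A B] /= [nA nB] AB].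
apply: filterS nB => h Bh; apply: (AB (x, h)); split => //=.
exact: (@nbhs_singleton (topologized T) _ _ nA).
Qed.

End linear_topology.

Lemma closed_affine_eq (T : topologicalType) (f g h : T -> K^o) (a : K) :
  continuous f -> continuous g -> continuous h ->
  closed [set t | f t = a *: g t + h t].
Proof.
move=> cf cg ch.
rewrite (_ : mkset _ = (fun t => f t - (a *: g t + h t)) @^-1` [set 0]).
  apply: preimage_closed.
    move=> t _; apply: cvgB; first exact: cf.
    by apply: cvgD; [apply: cvgZr; exact: cg|exact: ch].
  apply: accessible_closed_set1; apply: hausdorff_accessible; exact: norm_hausdorff.
apply/seteqP; split=> t /=; first by move=> ->; rewrite subrr.
by move=> /eqP; rewrite subr_eq0 => /eqP.
Qed.

Lemma closed_nrm_le (T : topologicalType) (f : T -> K^o) (r : R) :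
  continuous f -> closed [set t | nrm (f t) <= r].
Proof.
move=> cf; apply: (@preimage_closed _ _ (fun t => nrm (f t)) [set x | x <= r]).
  by move=> t _; apply: continuous_comp; [exact: cf|exact: continuous_nrmo].
exact: closed_le.
Qed.

(** Banach-Alaoglu: the polar is closed in a product of compact discs, since linearity and each
    bound are closed conditions on finitely many coordinates. *)
Lemma polar_compact p : is_seminorm p ->
  weakly_compact [set y : X -> K^o | linear y /\ forall x, nrm (y x) <= p x].
Proof.
move=> sp; rewrite /weakly_compact.
apply: (@subclosed_compact {ptws X -> K^o} _
    [set y : X -> K^o | forall x, nrm (y x) <= p x]); last by move=> y [].
  have ev (x : X) : continuous (fun y : {ptws X -> K^o} => y x).
    exact: (@proj_continuous X (fun=> K^o) x).
  have -> : [set y : X -> K^o | linear y /\ forall x, nrm (y x) <= p x] =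
      (\bigcap_(axz in [set: K * X * X])
        [set y : X -> K^o | y (axz.1.1 *: axz.1.2 + axz.2) =
           axz.1.1 *: y axz.1.2 + y axz.2]) `&`
      \bigcap_(x in [set: X]) [set y : X -> K^o | nrm (y x) <= p x].
    apply/seteqP; split=> y.
      by move=> [ly yp]; split=> [[[a x] z] _|x _] /=; [exact: ly|exact: yp].
    by move=> [ly yp]; split=> [a x z|x]; [exact: (ly (a, x, z))|exact: yp].
  apply: closedI.
    apply: closed_bigI => -[[a x] z] _ /=.
    exact: (@closed_affine_eq {ptws X -> K^o} (fun y => y (a *: x + z)) (fun y => y x)
      (fun y => y z) a (ev _) (ev x) (ev z)).
  apply: closed_bigI => x _.
  exact: (@closed_nrm_le {ptws X -> K^o} (fun y => y x) (p x) (ev x)).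
have := @tychonoff X (fun=> K^o) (fun x => [set z : K^o | nrm z <= p x])
  (fun x => @compact_nrm_le R s (p x)).
by [].
Qed.

Lemma polar_absolutely_convex p :
  absolutely_convex [set y : X -> K^o | linear y /\ forall x, nrm (y x) <= p x].
Proof.
move=> y z a b [ly yp] [lz zp] ab; split.
  move=> c u w; rewrite ly lz !scalerDr !scalerA addrACA (mulrC a) (mulrC b).
  by rewrite -!scalerA.
move=> x; apply: (le_trans (nrmD _ _)); rewrite !(@nrmZ R s K^o).
apply: (@le_trans _ _ ((nrm a + nrm b) * p x)).
  by rewrite mulrDl lerD// ler_wpM2l ?nrm_ge0.
by rewrite ler_piMl// (le_trans (nrm_ge0 (y x))).
Qed.

Lemma weakly_compact_bounded (B : set (X -> K^o)) x : weakly_compact B ->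
  exists M, forall y, B y -> nrm (y x) <= M.
Proof.
move=> cB; have ev : continuous (fun y : {ptws X -> K^o} => y x).
  exact: (@proj_continuous X (fun=> K^o) x).
apply: (compact_induction (T := {ptws X -> K^o})
  (P := fun D => exists M, forall y, D y -> nrm (y x) <= M) cB).
- by exists 0.
- by move=> D D' DD' [M MP]; exists M => y /DD'; exact: MP.
- move=> D D' [M MP] [M' M'P]; exists (Num.max M M') => y [/MP|/M'P] h.
    by rewrite le_max h.
  by rewrite le_max h orbT.
move=> y By; exists [set z | nrm (y x - z x) < 1].
  exact: ((continuous_nrmP _).1 ev y 1 ltr01).
exists (nrm (y x) + 1) => z [/= yz _].
have := nrm_dist_triangle (z x) (y x) 0; rewrite !subr0 (nrmB (z x)).
by move: yz; lra.
Qed.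

Lemma seminorm_sum p (h : nat -> X) m : is_seminorm p ->
  p (\sum_(i < m) h i) <= \sum_(i < m) p (h i).
Proof.
move=> sp; elim: m => [|m IH]; first by rewrite !big_ord0 seminorm0.
by rewrite !big_ord_recr /=; have [_ pD _] := sp; rewrite (le_trans (pD _ _))// lerD2r.
Qed.

End seminorms.

(** * Weighted spaces and truncation *)

Section sup_facts.
Context (R : realType).
Implicit Types (A : set R) (a : nat -> R).

(** The default value [sup set0 = 0] is the convention for non-negative quantities; [0 <= c] pays
    for it. *)
Lemma sup_le_ub0 A c : 0 <= c -> (forall x, A x -> x <= c) -> sup A <= c.
Proof.
move=> c0 Ac; have [->|/set0P A0] := eqVneq A set0; first by rewrite sup0.
by apply: ge_sup => // x; exact: Ac.
Qed.

Lemma le_sup_of A c x : (forall x, A x -> x <= c) -> A x -> x <= sup A.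
Proof. by move=> Ac Ax; apply: ub_le_sup => //; exists c. Qed.

Lemma sup_ge0 A c : (forall x, A x -> x <= c) -> (forall x, A x -> 0 <= x) -> 0 <= sup A.
Proof.
move=> Ac A0; have [->|/set0P[x Ax]] := eqVneq A set0; first by rewrite sup0.
exact: le_trans (A0 _ Ax) (le_sup_of Ac Ax).
Qed.

Lemma c0_plus_near a e : c0_plus a -> 0 < e -> exists n0, forall n, (n0 <= n)%N -> a n < e.
Proof.
move=> [a0 /cvgrPdist_lt acvg] e0; have [n0 _ n0P] := acvg _ e0.
exists n0 => n n0n; have := n0P n n0n; rewrite /= sub0r normrN; exact/le_lt_trans/ler_norm.
Qed.

Lemma c0_plus_bounded a : c0_plus a -> exists2 A, 0 < A & forall n, a n <= A.
Proof.
move=> ca; have [n0 n0P] := c0_plus_near ca ltr01.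
have [A [A0 AP]] : exists A : R, 0 < A /\ forall n, (n < n0)%N -> a n <= A.
  elim: n0 {n0P} => [|k [A [A0 AP]]]; first by exists 1.
  exists (Num.max A (a k)); split; first by rewrite lt_max A0.
  move=> n; rewrite ltnS leq_eqVlt => /predU1P[->|nk]; first by rewrite le_max lexx orbT.
  by rewrite le_max AP.
exists (Num.max A 1); first by rewrite lt_max A0.
move=> n; have [nn0|n0n] := ltnP n n0; first by rewrite le_max AP.
by rewrite le_max (ltW (n0P _ n0n)) orbT.
Qed.

Lemma c0_plusP a : (forall n, 0 <= a n) ->
  (forall e, 0 < e -> exists n0, forall n, (n0 <= n)%N -> a n <= e) -> c0_plus a.
Proof.
move=> a0 aP; split => //; apply/cvgrPdist_le => e e0.
have [n0 n0P] := aP _ e0; exists n0 => // n /= n0n.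
by rewrite sub0r normrN ger0_norm// n0P.
Qed.

End sup_facts.

Section sup_seminorm.
Context (R : realType) (s : scalars) (X : lmodType (scalar_field R s)).

Lemma seminorm_sup (I : Type) (D : set I) (q : I -> X -> R) :
  (forall i, D i -> is_seminorm (q i)) ->
  (forall x, exists M, forall i, D i -> q i x <= M) ->
  is_seminorm (fun x => sup [set q i x | i in D]).
Proof.
move=> sq bq.
have ub x : exists M, forall r, [set q i x | i in D] r -> r <= M.
  by have [M MP] := bq x; exists M => _ [i Di <-]; exact: MP.
have q0 x : 0 <= sup [set q i x | i in D].
  have [M MP] := ub x; apply: sup_ge0 MP _ => _ [i Di <-].
  by have [] := sq i Di.
have leq x i : D i -> q i x <= sup [set q i x | i in D].
  by move=> Di; have [M MP] := ub x; apply: le_sup_of MP _; exists i.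
have sZ a x : sup [set q i (a *: x) | i in D] <= nrm a * sup [set q i x | i in D].
  apply: sup_le_ub0; first by rewrite mulr_ge0// nrm_ge0.
  move=> _ [i Di <-]; have [_ _ ->] := sq i Di.
  by rewrite ler_wpM2l ?nrm_ge0// leq.
split => // [x y|a x].
  apply: sup_le_ub0; first by rewrite addr_ge0.
  move=> _ [i Di <-]; have [_ qD _] := sq i Di.
  by rewrite (le_trans (qD _ _))// lerD// leq.
apply/eqP; rewrite eq_le sZ/=.
have [->|a0] := eqVneq a 0; first by rewrite nrm0 mul0r.
have na0 : 0 < nrm a.
  rewrite lt_neqAle nrm_ge0 andbT eq_sym; apply: contra a0 => /eqP/nrm_eq0.
  by move=> ->.
(* The reverse inequality is [sZ] itself, applied to [a^-1] and [a *: x]. *)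
have := sZ a^-1 (a *: x); rewrite scalerA mulVf// scale1r.
rewrite -(ler_pM2l na0) mulrA -nrmM mulfV// nrm1 mul1r; exact.
Qed.

End sup_seminorm.

Section weighted.
Context (R : realType) (s : scalars).
Local Notation K := (scalar_field R s).
Context (Omega : topologicalType) (v : Omega -> {posnum R}).
Context (E : normedModType K).
Local Notation X := (Cv v E).
Local Notation N := (Cv_norm v E).
Implicit Types (f g : X) (x : Omega) (C : set Omega).

Lemma Cv_ext f g : (forall x, f x = g x) -> f = g.
Proof. by move=> fg; apply: val_inj; apply/funext. Qed.

Lemma Cv_funD f g x : (f + g) x = f x + g x.
Proof. by []. Qed.

Lemma Cv_funZ (a : K) f x : (a *: f) x = a *: f x.
Proof. by []. Qed.

Lemma Cv_funN f x : (- f) x = - f x.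
Proof. by []. Qed.

Lemma Cv_fun0 x : (0 : X) x = 0.
Proof. by []. Qed.

Lemma Cv_continuous f : continuous f.
Proof. by have := Cv_funP f; rewrite inE => -[]. Qed.

Lemma Cv_bounded f : exists M, forall x, wval f x <= M.
Proof. by have := Cv_funP f; rewrite inE => -[]. Qed.

Lemma Cv_exists (h : Omega -> E) (M : R) : continuous h ->
  (forall x, nrm (h x) * (v x)%:num <= M) -> exists f, forall x, f x = h x.
Proof.
move=> ch hM; have hP : h \in @Cv_pred R s Omega v E by rewrite inE; split => //; exists M.
by exists (MkCv hP).
Qed.

Lemma wval_ge0 f x : 0 <= wval f x.
Proof. by rewrite mulr_ge0// nrm_ge0. Qed.

Lemma seminorm_wval x c : 0 <= c -> is_seminorm (fun f => wval f x * c).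
Proof.
move=> c0; split=> [f|f g|a f]; first by rewrite mulr_ge0// wval_ge0.
- by rewrite -!mulrDl; rewrite ler_wpM2r// ler_wpM2r// Cv_funD nrmD.
- by rewrite /wval Cv_funZ nrmZ !mulrA.
Qed.

Lemma wvalD f g x : wval (f + g) x <= wval f x + wval g x.
Proof. by rewrite -mulrDl ler_wpM2r// Cv_funD nrmD. Qed.

Lemma wvalZ (a : K) f x : wval (a *: f) x = nrm a * wval f x.
Proof. by rewrite /wval Cv_funZ nrmZ mulrA. Qed.

Lemma wvalN f x : wval (- f) x = wval f x.
Proof. by rewrite /wval Cv_funN nrmN. Qed.

Lemma wval0 x : wval (0 : X) x = 0.
Proof. by rewrite /wval Cv_fun0 nrm0 mul0r. Qed.

Lemma wval_eq0 f x : wval f x = 0 -> f x = 0.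
Proof.
move=> /eqP; rewrite mulf_eq0 => /orP[/eqP/nrm_eq0//|].
by rewrite gt_eqF.
Qed.

Lemma wval_le_norm f x : wval f x <= N f.
Proof. by have [M MP] := Cv_bounded f; apply: (@le_sup_of _ _ M); [move=> _ [y _ <-]|exists x]. Qed.

Lemma Cv_norm_le f c : 0 <= c -> (forall x, wval f x <= c) -> N f <= c.
Proof. by move=> c0 fc; apply: sup_le_ub0 => // _ [x _ <-]. Qed.

Lemma seminorm_norm : is_seminorm N.
Proof.
apply: (@seminorm_sup _ _ _ _ _ (fun x f => wval f x)) => [x _|f].
  have := seminorm_wval x ler01; rewrite (_ : (fun f => _ * 1) = (fun f => wval f x))//.
  by apply/funext => f; rewrite mulr1.
by have [M MP] := Cv_bounded f; exists M => x _.
Qed.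

Lemma Cv_norm_ge0 f : 0 <= N f.
Proof. by have [] := seminorm_norm. Qed.

Lemma norm_norm : is_norm N.
Proof.
split; first exact: seminorm_norm.
move=> f f0; apply: Cv_ext => x; apply: wval_eq0; apply/eqP.
by rewrite eq_le wval_ge0 -f0 wval_le_norm.
Qed.

Definition sup_on C f : R := sup [set wval f x | x in C].

Lemma sup_on_ge C f x : C x -> wval f x <= sup_on C f.
Proof.
move=> Cx; have [M MP] := Cv_bounded f.
by apply: (@le_sup_of _ _ M); [move=> _ [y _ <-]|exists x].
Qed.

Lemma sup_on_le C f c : 0 <= c -> (forall x, C x -> wval f x <= c) -> sup_on C f <= c.
Proof. by move=> c0 fc; apply: sup_le_ub0 => // _ [x Cx <-]; exact: fc. Qed.

Lemma seminorm_sup_on C : is_seminorm (sup_on C).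
Proof.
apply: (@seminorm_sup _ _ _ _ _ (fun x f => wval f x)) => [x _|f].
  have := seminorm_wval x ler01; rewrite (_ : (fun f => _ * 1) = (fun f => wval f x))//.
  by apply/funext => f; rewrite mulr1.
by have [M MP] := Cv_bounded f; exists M => x _.
Qed.

Lemma sup_on_ge0 C f : 0 <= sup_on C f.
Proof. by have [] := seminorm_sup_on C. Qed.

Lemma sup_on_le_norm C f : sup_on C f <= N f.
Proof. by apply: sup_on_le; [exact: Cv_norm_ge0|move=> x _; exact: wval_le_norm]. Qed.

Definition co_seminorms : set (X -> R) := [set p | exists2 C, compact C & p = sup_on C].

Lemma co_seminorms_seminorm p : co_seminorms p -> is_seminorm p.
Proof. by move=> [C _ ->]; exact: seminorm_sup_on. Qed.

Lemma co_seminorms_directed : directed_system co_seminorms.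
Proof.
split; first by exists (sup_on set0), set0 => //; exact: compact0.
move=> _ _ [C cC ->] [D cD ->]; exists (sup_on (C `|` D)).
  by exists (C `|` D) => //; exact: compactU.
move=> f; split; apply: sup_on_le (sup_on_ge0 _ _) _ => x Cx; apply: sup_on_ge.
  by left.
by right.
Qed.

(** The nested suprema match those of [compact_seminorms] literally, so that membership holds by
    conversion. *)
Definition seq_seminorm (C : nat -> set Omega) (a : nat -> R) f : R :=
  sup [set sup [set wval f x * a n | x in C n] | n in [set: nat]].

Section seq_seminorm.
Context (C : nat -> set Omega) (a : nat -> R).
Hypothesis (ca : c0_plus a).

Let bound f : exists2 M, 0 <= M & forall n x, wval f x * a n <= M.
Proof.
have [A A0 AP] := c0_plus_bounded ca; exists (N f * A).
  by rewrite mulr_ge0 ?Cv_norm_ge0// ltW.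
by move=> n x; rewrite ler_pM ?wval_ge0 ?wval_le_norm//; exact: ca.1.
Qed.

Lemma seq_seminorm_ge f n x : C n x -> wval f x * a n <= seq_seminorm C a f.
Proof.
move=> Cx; have [M M0 MP] := bound f.
apply: (@le_trans _ _ (sup [set wval f x * a n | x in C n])).
  by apply: (@le_sup_of _ _ M); [move=> _ [y _ <-]|exists x].
apply: (@le_sup_of _ _ M); last by exists n.
by move=> _ [k _ <-]; apply: sup_le_ub0 => // _ [y _ <-].
Qed.

Lemma seq_seminorm_le f c : 0 <= c -> (forall n x, C n x -> wval f x * a n <= c) ->
  seq_seminorm C a f <= c.
Proof.
move=> c0 fc; apply: sup_le_ub0 => // _ [n _ <-].
by apply: sup_le_ub0 => // _ [x Cx <-]; exact: fc.
Qed.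

Lemma seminorm_seq_seminorm : is_seminorm (seq_seminorm C a).
Proof.
have b f : exists M, forall n x, wval f x * a n <= M.
  by have [M _ MP] := bound f; exists M.
apply: seminorm_sup => [n _|f].
  apply: (seminorm_sup (D := C n) (q := fun x f => wval f x * a n)) => [x _|f].
    by apply: seminorm_wval; exact: ca.1.
  by have [M MP] := b f; exists M.
have [M M0 MP] := bound f; exists M => n _.
by apply: sup_le_ub0 => // _ [x _ <-].
Qed.

Lemma seq_seminorm_ge0 f : 0 <= seq_seminorm C a f.
Proof. by have [] := seminorm_seq_seminorm. Qed.

End seq_seminorm.

Lemma compact_seminorms_seminorm p : compact_seminorms v E p -> is_seminorm p.
Proof. by move=> [C [a [_ ca ->]]]; exact: seminorm_seq_seminorm. Qed.

Lemma c0_plus_max (a b : nat -> R) : c0_plus a -> c0_plus b ->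
  c0_plus (fun n => Num.max (a n) (b n)).
Proof.
move=> ca cb; apply: c0_plusP => [n|e e0]; first by rewrite le_max ca.1.
have [n1 h1] := c0_plus_near ca e0; have [n2 h2] := c0_plus_near cb e0.
exists (maxn n1 n2) => n; rewrite geq_max => /andP[/h1 an /h2 bn].
by rewrite ge_max !ltW.
Qed.

Lemma compact_seminorms_directed : directed_system (compact_seminorms v E).
Proof.
split.
  exists (seq_seminorm (fun=> set0) (fun=> 0)), (fun=> set0), (fun=> 0); split => //.
    by move=> _; exact: compact0.
  by apply: c0_plusP => // e e0; exists 0%N => _ _; exact: ltW.
move=> _ _ [C [a [cC ca ->]]] [D [b [cD cb ->]]].
have cab := c0_plus_max ca cb.
exists (seq_seminorm (fun n => C n `|` D n) (fun n => Num.max (a n) (b n))).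
  exists (fun n => C n `|` D n), (fun n => Num.max (a n) (b n)); split => // n.
  exact: compactU.
move=> f; split; apply: seq_seminorm_le (seq_seminorm_ge0 _ cab f) _ => n x Cx.
  apply: le_trans (seq_seminorm_ge cab f (or_introl Cx)).
  by rewrite ler_wpM2l ?wval_ge0// le_max lexx.
apply: le_trans (seq_seminorm_ge cab f (or_intror Cx)).
by rewrite ler_wpM2l ?wval_ge0// le_max lexx orbT.
Qed.

Hypothesis (v_cont : continuous (fun x => (v x)%:num : R^o)).

Lemma continuous_wval f : continuous (wval f).
Proof.
move=> x; apply: cvgM; last exact: v_cont.
apply: (@continuous_comp _ _ _ f (fun u : E => nrm u)); first exact: Cv_continuous.
exact: continuous_nrm.
Qed.

Lemma weight_bounds C : compact C -> exists2 d, 0 < d & exists2 M, 0 < M &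
  forall x, C x -> d <= (v x)%:num <= M.
Proof.
move=> cC; pose P (A : set Omega) := exists2 d : R, 0 < d & exists2 M : R, 0 < M &
  forall x, A x -> d <= (v x)%:num <= M.
apply: (compact_induction (P := P) cC).
- by exists 1 => //; exists 1.
- move=> A B AB [d d0 [M M0 MP]]; exists d => //; exists M => // x /AB; exact: MP.
- move=> A B [d d0 [M M0 MP]] [d' d'0 [M' M'0 M'P]].
  exists (Num.min d d'); first by rewrite lt_min d0.
  exists (Num.max M M'); first by rewrite lt_max M0.
  move=> x [/MP/andP[dv vM]|/M'P/andP[dv vM]].
    by rewrite ge_min dv/= le_max vM.
  by rewrite ge_min dv orbT/= le_max vM orbT.
move=> x Cx; exists [set y | `|(v x)%:num - (v y)%:num| < (v x)%:num / 2].
  have := @v_cont x; move/cvgrPdist_lt; apply; by rewrite divr_gt0.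
have v0 := [gt0 of (v x)%:num].
exists ((v x)%:num / 2); first by rewrite divr_gt0.
exists (2 * (v x)%:num); first by rewrite mulr_gt0.
move=> y [h _]; have : `|(v x)%:num - (v y)%:num| < (v x)%:num / 2 by exact: h.
by rewrite ltr_norml => /andP[h1 h2]; apply/andP; split; lra.
Qed.

(** Chosen with default 0, so that the product is total in [c]; [Cv_scaleE] identifies it when [c]
    is continuous and bounded. *)
Definition Cv_scale (c : Omega -> R) f : X :=
  xget 0 [set g : X | forall x, g x = kreal s (c x) *: f x].

Lemma Cv_scaleE (c : Omega -> R) M f : continuous c -> (forall x, `|c x| <= M) ->
  forall x, Cv_scale c f x = kreal s (c x) *: f x.
Proof.
move=> cc cM; have [g gP] : exists g : X, forall x, g x = kreal s (c x) *: f x.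
  have M0 x : 0 <= M by exact: le_trans (cM x).
  apply: (@Cv_exists _ (M * N f)).
    move=> x; apply: (@cvgZ K E Omega (nbhs x)); last exact: Cv_continuous.
    apply: (@continuous_comp _ _ _ c (kreal s : R -> K^o)); first exact: cc.
    exact: continuous_kreal.
  move=> x; rewrite nrmZ nrm_kreal -mulrA; apply: ler_pM => //.
    exact: wval_ge0.
  exact: wval_le_norm.
by move=> x; rewrite /Cv_scale; case: xgetP => [h -> /= //|/(_ g)]; case.
Qed.

Lemma wval_Cv_scale (c : Omega -> R) M f x : continuous c -> (forall x, `|c x| <= M) ->
  wval (Cv_scale c f) x = `|c x| * wval f x.
Proof. by move=> cc cM; rewrite /wval (Cv_scaleE f cc cM) nrmZ nrm_kreal mulrA. Qed.

(* Radial truncation; the junk value [0 / 0 = 0] gives [trunc 0 f = 0]. *)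
Definition trunc_coef (t : R) f x : R := t / Num.max t (wval f x).
Definition trunc t f : X := Cv_scale (trunc_coef t f) f.

Lemma trunc_coef_bound t f : 0 <= t -> forall x, `|trunc_coef t f x| <= 1.
Proof.
move=> t0 x; rewrite /trunc_coef ger0_norm; last by rewrite divr_ge0// le_max t0.
have [->|tn0] := eqVneq t 0; first by rewrite mul0r.
have tp : 0 < t by rewrite lt_neqAle eq_sym tn0.
by rewrite ler_pdivrMr ?lt_max ?tp// mul1r le_max lexx.
Qed.

Lemma continuous_trunc_coef t f : 0 <= t -> continuous (trunc_coef t f).
Proof.
move=> t0; have [->|tn0] := eqVneq t 0.
  rewrite (_ : trunc_coef 0 f = cst 0); first exact: cst_continuous.
  by apply/funext => x; rewrite /trunc_coef mul0r.
have tp : 0 < t by rewrite lt_neqAle eq_sym tn0.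
move=> x; apply: cvgM; first exact: cvg_cst.
apply: cvgV; first by rewrite gt_eqF// lt_max tp.
apply: (@continuous_max _ _ (cst t) (wval f)); [exact: cvg_cst|exact: continuous_wval].
Qed.

Lemma truncE t f x : 0 <= t -> trunc t f x = kreal s (trunc_coef t f x) *: f x.
Proof.
by move=> t0; exact: (Cv_scaleE f (@continuous_trunc_coef t f t0) (trunc_coef_bound f t0)).
Qed.

Lemma trunc_coefM t f x : 0 <= t -> trunc_coef t f x * wval f x = Num.min t (wval f x).
Proof.
move=> t0; rewrite /trunc_coef; have [tw|wt] := leP t (wval f x).
  have [w0|wn0] := eqVneq (wval f x) 0.
    by rewrite w0 mulr0; apply/eqP; rewrite eq_le t0 -w0 tw.
  by rewrite divfK.
have tp : 0 < t by apply: le_lt_trans wt; exact: wval_ge0.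
by rewrite mulfV ?gt_eqF// mul1r.
Qed.

Lemma wval_trunc t f x : 0 <= t -> wval (trunc t f) x = Num.min t (wval f x).
Proof.
move=> t0; rewrite -trunc_coefM//.
rewrite (wval_Cv_scale f x (@continuous_trunc_coef t f t0) (trunc_coef_bound f t0)).
by rewrite ger0_norm// divr_ge0// le_max t0.
Qed.

Lemma trunc_id t f x : 0 <= t -> wval f x <= t -> trunc t f x = f x.
Proof.
move=> t0 ft; rewrite truncE// /trunc_coef (max_idPl ft).
have [t00|tn0] := eqVneq t 0; last by rewrite mulfV// kreal1 scale1r.
rewrite (_ : f x = 0) ?scaler0//; apply: wval_eq0; apply/eqP.
by rewrite eq_le wval_ge0 andbT -t00.
Qed.

Lemma trunc_norm t f : 0 <= t -> N (trunc t f) <= t.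
Proof. by move=> t0; apply: Cv_norm_le => // x; rewrite wval_trunc// ge_min lexx. Qed.

Definition layer (n : nat) f : X := trunc n.+1%:R f - trunc n%:R f.

Lemma wval_layer n f x :
  wval (layer n f) x = Num.min n.+1%:R (wval f x) - Num.min n%:R (wval f x).
Proof.
rewrite {1}/wval /layer Cv_funD Cv_funN !truncE// -scalerBl -krealB nrmZ nrm_kreal -mulrA.
have -> : nrm (f x) * (v x)%:num = wval f x by [].
rewrite -[X in _ * X = _](ger0_norm (wval_ge0 f x)) -normrM mulrBl !trunc_coefM//.
rewrite ger0_norm// subr_ge0 le_min ge_min ler_nat leqnSn/=.
by rewrite ge_min lexx orbT.
Qed.

Lemma layer_norm n f : N (layer n f) <= 1.
Proof.
apply: Cv_norm_le => // x; rewrite wval_layer -natr1.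
by rewrite /Num.min; case: ltP => h1; case: ltP => h2; lra.
Qed.

Lemma layer_eq0 n f x : wval f x <= n%:R -> layer n f x = 0.
Proof.
move=> fn; rewrite /layer Cv_funD Cv_funN !trunc_id ?subrr// (le_trans fn)//.
by rewrite ler_nat.
Qed.

Lemma sum_layer m f : N f <= m%:R -> f = \sum_(i < m) layer i f.
Proof.
move=> fm; rewrite -(big_mkord xpredT (fun i => layer i f)) telescope_sumr//.
apply: Cv_ext => x; rewrite Cv_funD Cv_funN trunc_id//; last exact: le_trans (wval_le_norm f x) fm.
by rewrite truncE// /trunc_coef mul0r kreal0 scale0r subr0.
Qed.

(** Layer 0 vanishes only where [f] does, so on [C 0] it can merely be made small; this is why [e]
    enters. All the other layers can be made to vanish on their compact sets. *)
Lemma layer_decomposition (C : nat -> set Omega) (e : R) :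
  (forall n, compact (C n)) -> 0 < e ->
  exists2 p, compact_seminorms v E p & forall f, p f < 1 ->
    (forall x, C 0%N x -> wval (layer 0 f) x <= e) /\
    (forall n x, C n.+1 x -> layer n.+1 f x = 0).
Proof.
(* With these coefficients [p f < 1] forces [wval f < e] on [C 0] and [wval f < n + 1] on [C n.+1],
   exactly where layer [n.+1] is zero. *)
move=> cC e0; pose a n : R := if n is n'.+1 then n'.+1%:R^-1 else e^-1.
have ca : c0_plus a.
  apply: c0_plusP => [[|n]/=|d d0]; rewrite ?invr_ge0 ?(ltW e0)//.
  exists (Num.truncn d^-1).+1 => -[//|n]; rewrite ltnS => dn /=.
  rewrite invf_ple ?posrE//; apply/ltW; apply: (lt_le_trans (truncnS_gt _)).
  by rewrite ler_nat.
exists (seq_seminorm C a); first by exists C, a.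
move=> f pf; split=> [x Cx|n x Cx].
  have := le_lt_trans (seq_seminorm_ge ca f Cx) pf.
  rewrite /= ltr_pdivrMr// mul1r => fe; rewrite wval_layer.
  have -> : Num.min 0%:R (wval f x) = 0 by rewrite min_l ?wval_ge0.
  by rewrite subr0 ge_min (ltW fe) orbT.
apply: layer_eq0; have := le_lt_trans (seq_seminorm_ge ca f Cx) pf.
by rewrite /= ltr_pdivrMr// mul1r => /ltW.
Qed.

End weighted.

(** * The mixed topology *)

Lemma entourage_nrmP (R : realType) (s : scalars) (V : normedModType (scalar_field R s))
    (A : set (V * V)) :
  entourage A <-> exists2 r : R, 0 < r & forall x y : V, nrm (x - y) < r -> A (x, y).
Proof.
rewrite -entourage_ballE; split=> [[e /= e0 eA]|[r r0 rA]].
  exists (real_of e); first by rewrite -(kreal_gt0 s) kreal_real_of ?ltW.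
  move=> x y xy; apply: eA => /=; rewrite -ball_normE /=.
  by rewrite -kreal_nrm -(@kreal_real_of _ _ e) ?kreal_lt// ltW.
exists (kreal s r); first by rewrite /= kreal_gt0.
by move=> [x y] /=; rewrite -ball_normE /= -kreal_nrm kreal_lt; exact: rA.
Qed.

Lemma coincide_on_coarser (X : choiceType) (B : set X) (T tau : topology X) :
  coarser tau T ->
  (forall U x, opens T U -> B x -> U x ->
    exists V, [/\ opens tau V, V x & V `&` B `<=` U]) ->
  coincide_on B T tau.
Proof.
move=> tauT loc; apply/seteqP; split=> _ [U oU <-]; last by exists U => //; exact: tauT.
pose W := [set V | opens tau V /\ V `&` B `<=` U].
exists (\bigcup_(V : {V | W V}) sval V).
  by apply: opens_bigU => V; exact: (svalP V).1.
apply/seteqP; split=> x; first by move=> [[V _ Vx] Bx]; split => //; exact: (svalP V).2.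
move=> [Ux Bx]; split => //; have [V [oV Vx VU]] := loc _ _ oU Bx Ux.
by exists (exist W V (conj oV VU)).
Qed.

(** Repeated halving, [W n.+1 + W n.+1] inside [W n], replaces convexity. The sequence [V] is fixed
    before the number [m] of summands. *)
Lemma linear_nbhs_sum (R : realType) (s : scalars) (X : lmodType (scalar_field R s))
    (T : topology X) (U : set X) :
  linear_topology T -> nbhs ((0 : X) : topologized T) U ->
  exists V : nat -> set X, (forall n, nbhs ((0 : X) : topologized T) (V n)) /\
    forall m (h : nat -> X), (forall i, (i < m)%N -> V i (h i)) -> U (\sum_(i < m) h i).
Proof.
move=> lT nU.
have /choice[split_ splitP] : forall A : set X, exists B : set X,
    nbhs ((0 : X) : topologized T) A -> nbhs ((0 : X) : topologized T) B /\
    forall x y, B x -> B y -> A (x + y).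
  move=> A; have [nA|nA] := pselect (nbhs ((0 : X) : topologized T) A); last by exists A.
  by have [B nB BA] := linear_nbhs_split lT nA; exists B.
pose W n := iter n split_ U.
have nW n : nbhs ((0 : X) : topologized T) (W n).
  by elim: n => //= n; exact: (fun h => (splitP _ h).1).
have WD n x y : W n.+1 x -> W n.+1 y -> W n (x + y) by exact: (splitP _ (nW n)).2.
have sumW m : forall k h, (forall i, (i < m)%N -> W (k + i).+1 (h i)) -> W k (\sum_(i < m) h i).
  elim: m => [|m IH] k h hW.
    by rewrite big_ord0; exact: (@nbhs_singleton (topologized T) _ _ (nW k)).
  rewrite big_ord_recl; apply: WD; first by have := hW 0%N; rewrite addn0; exact.
  by apply: (IH k.+1 (fun i => h i.+1)) => i im; have := hW i.+1 im; rewrite addnS addSn.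
exists (fun n => W n.+1); split => [n|m h hW]; [exact: nW|exact: (sumW m 0%N)].
Qed.

Section mixed.
Context (R : realType) (s : scalars).
Local Notation K := (scalar_field R s).
Context (Omega : topologicalType) (v : Omega -> {posnum R}).
Context (E : normedModType K).
Hypothesis (v_cont : continuous (fun x => (v x)%:num : R^o)).
Local Notation X := (Cv v E).
Local Notation N := (Cv_norm v E).
Local Notation gamma := (seminorm_topology (compact_seminorms v E)).

(** On a compact set [v] lies between two positive constants, so weighted and unweighted uniform
    convergence on compact sets agree. *)
Lemma tau_coE : tau_co v E = seminorm_topology (@co_seminorms R s Omega v E).
Proof.
have sP := @co_seminorms_seminorm R s Omega v E.
have dP := @co_seminorms_directed R s Omega v E.
apply: topology_ext => U oU.
  have {oU}[W oW <-] := oU.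
  pose T := topologized (seminorm_topology (@co_seminorms R s Omega v E)).
  suff : open ((@Cv_fun R s Omega v E) @^-1` W : set T) by [].
  rewrite openE => f Wf; rewrite /interior /=.
  pose Phi (g : T) : {family compact, Omega -> E} := Cv_fun g.
  suff : Phi @ nbhs f --> Phi f by apply; apply: open_nbhs_nbhs.
  apply/fam_cvgP => A cA P /uniform_nbhs[Ent [/entourage_nrmP[e e0 eEnt] EP]].
  have [d d0 [M M0 dM]] := weight_bounds v_cont cA.
  apply/(nbhs_seminormP _ _ sP dP); exists (sup_on A); first by exists A.
  exists (e * d); first by rewrite mulr_gt0.
  move=> g gf; apply: EP => x Ax /=; apply: eEnt.
  have := le_lt_trans (sup_on_ge ((g : X) - (f : X)) Ax) gf.
  rewrite /wval Cv_funD Cv_funN nrmB => h; have [dv _] := andP (dM x Ax).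
  rewrite -(ltr_pM2r d0); apply: le_lt_trans h.
  by rewrite ler_wpM2l ?nrm_ge0.
suff : open (U : set (topologized (tau_co v E))) by [].
rewrite openE => f Uf; rewrite /interior /=.
have : nbhs (f : topologized (seminorm_topology (@co_seminorms R s Omega v E))) U.
  exact: open_nbhs_nbhs.
move=> /(nbhs_seminormP _ _ sP dP)[_ [A cA ->] [e e0 eU]].
have [d d0 [M M0 dM]] := weight_bounds v_cont cA.
pose r := e / (2 * M); have r0 : 0 < r by rewrite divr_gt0// mulr_gt0.
have : nbhs (Cv_fun f : {family compact, Omega -> E})
    [set h | forall y, A y -> [set xy : E * E | nrm (xy.1 - xy.2) < r] (f y, h y)].
  by apply: fam_nbhs => //; apply/entourage_nrmP; exists r.
rewrite nbhsE => -[W [oW Wf] Wr].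
apply/nbhs_topologized; exists ((@Cv_fun R s Omega v E) @^-1` W); split => //; first by exists W.
move=> g /Wr gr; apply: eU; apply: (@le_lt_trans _ _ (e / 2)); last by lra.
apply: sup_on_le; first by rewrite divr_ge0// ltW.
move=> x Ax; have /= := gr x Ax; rewrite nrmB /wval Cv_funD Cv_funN => h.
have [_ vM] := andP (dM x Ax).
apply: (@le_trans _ _ (r * M)); first by rewrite ler_pM ?nrm_ge0// ltW.
by rewrite /r invfM mulrA divfK ?gt_eqF.
Qed.

Lemma co_seminorms_separate (f : X) :
  (forall p, co_seminorms p -> p f = 0) -> f = 0.
Proof.
move=> f0; apply: Cv_ext => x; apply: wval_eq0; apply/eqP; rewrite eq_le wval_ge0 andbT.
rewrite -(f0 (sup_on [set x])); last by exists [set x] => //; exact: compact_set1.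
exact: sup_on_ge.
Qed.

Lemma coarser_tau_co_norm : coarser (tau_co v E) (norm_topology N).
Proof.
rewrite tau_coE; apply: coarser_seminorm_le => _ [C cC ->]; exists N => //.
exact: sup_on_le_norm.
Qed.

(** Singletons are compact, so the seminorms [sup_on C] together recover the full weighted norm. *)
Lemma saks_Cv : saks_space N (tau_co v E).
Proof.
have sP := @co_seminorms_seminorm R s Omega v E.
have dP := @co_seminorms_directed R s Omega v E.
split; [exact: norm_norm| |exact: coarser_tau_co_norm|].
  rewrite tau_coE; apply: seminorm_topology_lch => //; exact: co_seminorms_separate.
exists (@co_seminorms R s Omega v E); split => //.
- move=> q Pq; split; first exact: sP.
  rewrite tau_coE; apply/(continuous_seminormP sP dP); first exact: sP.
  by exists q => //; exists 1 => // x; rewrite mul1r.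
- exact: tau_coE.
move=> f; apply/eqP; rewrite eq_le; apply/andP; split.
  by apply: ge_ereal_sup => _ [_ [C cC ->] <-]; rewrite lee_fin sup_on_le_norm.
set S := [set _ | q in _].
have Sx x : ((wval f x)%:E <= ereal_sup S)%E.
  apply: (@le_trans _ _ (sup_on [set x] f)%:E); first by rewrite lee_fin sup_on_ge.
  apply: ereal_sup_ubound; exists (sup_on [set x]) => //.
  by exists [set x] => //; exact: compact_set1.
have S0 : (0 <= ereal_sup S)%E.
  apply: (@le_trans _ _ (sup_on set0 f)%:E); first by rewrite lee_fin sup_on_ge0.
  apply: ereal_sup_ubound; exists (sup_on set0) => //.
  by exists set0 => //; exact: compact0.
case: (ereal_sup S) Sx S0 => [r Sx S0|_ _|_]; [|exact: leey|by []].
by rewrite lee_fin; apply: Cv_norm_le => // x; have := Sx x; rewrite lee_fin.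
Qed.

Lemma coarser_tau_co_gamma : coarser (tau_co v E) gamma.
Proof.
rewrite tau_coE; apply: coarser_seminorm_le => _ [C cC ->].
have ca : c0_plus (fun n => (n == 0%N)%:R : R).
  by apply: c0_plusP => // e e0; exists 1%N => -[|n] //= _; exact: ltW.
exists (seq_seminorm (fun=> C) (fun n => (n == 0%N)%:R)).
  by exists (fun=> C), (fun n => (n == 0%N)%:R).
move=> f; apply: sup_on_le; first exact: seq_seminorm_ge0.
by move=> x Cx; have := @seq_seminorm_ge _ _ _ _ _ (fun=> C) _ ca f 0%N x Cx; rewrite mulr1.
Qed.

Lemma compact_seminorms_le_norm p : compact_seminorms v E p ->
  exists2 A, 0 < A & forall f, p f <= A * N f.
Proof.
move=> [C [a [cC ca ->]]]; have [A A0 AP] := c0_plus_bounded ca; exists A => // f.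
apply: seq_seminorm_le; first by rewrite mulr_ge0 ?Cv_norm_ge0// ltW.
move=> n x _; rewrite mulrC; apply: ler_pM => //; [exact: ca.1|exact: wval_ge0|].
exact: wval_le_norm.
Qed.

Lemma coarser_gamma_norm : coarser gamma (norm_topology N).
Proof.
apply: coarser_seminorm.
- split; first by exists N.
  by move=> _ _ -> ->; exists N.
- by move=> _ ->; exact: seminorm_norm.
by move=> p Pp; exists N => //; exact: compact_seminorms_le_norm.
Qed.

(* On a norm-bounded set all but finitely many terms of a generating seminorm
   are negligible. *)
Lemma compact_seminorms_bounded p (M e : R) : compact_seminorms v E p -> 0 < e ->
  exists2 C, compact C & exists2 d, 0 < d &
    forall f, N f <= M -> sup_on C f < d -> p f <= e.
Proof.
move=> [C [a [cC ca ->]]] e0; have [A A0 AP] := c0_plus_bounded ca.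
have e1 : 0 < e / (`|M| + 1) by rewrite divr_gt0// ltr_pwDr.
have [n0 n0P] := c0_plus_near ca e1.
exists (\big[setU/set0]_(i < n0) C i); first by apply: bigsetU_compact => i _; exact: cC.
exists (e / A); first by rewrite divr_gt0.
move=> f fM fd; apply: seq_seminorm_le (ltW e0) _ => n x Cx.
have [nn0|n0n] := ltnP n n0.
  have Dx : (\big[setU/set0]_(i < n0) C i) x by rewrite (bigD1 (Ordinal nn0))//=; left.
  apply: (@le_trans _ _ (e / A * A)); last by rewrite divfK ?gt_eqF.
  apply: ler_pM => //; [exact: wval_ge0|exact: ca.1|].
  by apply/ltW; apply: le_lt_trans fd; exact: sup_on_ge.
apply: (@le_trans _ _ ((`|M| + 1) * (e / (`|M| + 1)))); last first.
  by rewrite mulrC divfK// gt_eqF// ltr_pwDr.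
apply: ler_pM; [exact: wval_ge0|exact: ca.1| |exact/ltW/n0P].
apply: (le_trans (wval_le_norm f x)); apply: (le_trans fM).
by apply: (le_trans (ler_norm M)); rewrite lerDl.
Qed.

Lemma mixable_gamma : mixable N (tau_co v E) gamma.
Proof.
have sP := @compact_seminorms_seminorm R s Omega v E.
have dP := @compact_seminorms_directed R s Omega v E.
split; [exact: seminorm_topology_linear|exact: coarser_tau_co_gamma|exact: coarser_gamma_norm|].
move=> B [M BM]; apply: coincide_on_coarser; first exact: coarser_tau_co_gamma.
move=> U f oU Bf Uf.
have : nbhs (f : topologized gamma) U by exact: (@open_nbhs_nbhs (topologized gamma)).
move=> /(nbhs_seminormP _ _ sP dP)[p Pp [e e0 eU]].
have e20 : 0 < e / 2 by rewrite divr_gt0.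
(* Differences of two elements of [B] have norm at most [M + M]. *)
have [C cC [d d0 Cd]] := compact_seminorms_bounded (M + M) Pp e20.
exists [set g | sup_on C (g - f) < d]; split.
- rewrite tau_coE; apply: seminorm_topology_open_ball; first by exists C.
  exact: seminorm_sup_on.
- by rewrite /= subrr seminorm0//; exact: seminorm_sup_on.
move=> g [/= gd Bg]; apply: eU; apply: (@le_lt_trans _ _ (e / 2)); last by lra.
apply: Cd => //; have [_ ND _] := @seminorm_norm R s Omega v E.
by apply: (le_trans (ND _ _)); rewrite (seminormN _ (@seminorm_norm R s Omega v E)) lerD// BM.
Qed.

Lemma mixable_coarser_gamma T : mixable N (tau_co v E) T -> coarser T gamma.
Proof.
have sP := @compact_seminorms_seminorm R s Omega v E.
have dP := @compact_seminorms_directed R s Omega v E.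
move=> [lT _ _ coin] U oU.
suff : open (U : set (topologized gamma)) by [].
rewrite openE => f Uf; rewrite /interior /=.
have : nbhs (f : topologized T) U by exact: (@open_nbhs_nbhs (topologized T)).
move=> /(linear_nbhs_translate lT)/(linear_nbhs_sum lT)[V [nV VU]].
have bB : norm_bounded N [set g : X | N g <= 1] by exists 1.
(* Each [V n] only has to be understood on the unit ball, where all layers live. There [T] and the
   compact-open topology have the same traces, so [V n] contains the unit-ball trace of a
   neighbourhood given by one compact set. *)
have /choice[C CP] n : exists C, compact C /\ exists2 d, 0 < d &
    forall g : X, N g <= 1 -> sup_on C g < d -> V n g.
  have /nbhs_topologized[W [oW W0 WV]] := nV n.
  have : [set U `&` [set g : X | N g <= 1] | U in opens T] (W `&` [set g : X | N g <= 1]).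
    by exists W.
  rewrite (coin _ bB) => -[W' oW' W'W].
  have W'0 : W' 0.
    suff : (W' `&` [set g : X | N g <= 1]) 0 by case.
    by rewrite W'W; split => //=; rewrite (seminorm0 (@seminorm_norm R s Omega v E)).
  have : nbhs ((0 : X) : topologized (tau_co v E)) W'.
    exact: (@open_nbhs_nbhs (topologized (tau_co v E))).
  rewrite tau_coE => /(nbhs_seminormP _ _ (@co_seminorms_seminorm R s Omega v E)
    (@co_seminorms_directed R s Omega v E))[_ [C cC ->] [d d0 dW']].
  exists C; split => //; exists d => // g g1 gd; apply: WV.
  suff : (W' `&` [set g : X | N g <= 1]) g by rewrite W'W => -[].
  by split => //; apply: dW'; rewrite subr0.
have [_ [d0 d00 V0]] := CP 0%N.
have e0 : 0 < d0 / 2 by rewrite divr_gt0.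
have [p Pp pP] := layer_decomposition E v_cont (fun n => (CP n).1) e0.
apply/(nbhs_seminormP _ _ sP dP); exists p => //; exists 1 => // g /pP[g0 gS].
pose h := (g : X) - f.
have -> : g = f + h by rewrite /h addrC subrK.
have [m hm] : exists m : nat, N h <= m%:R.
  by exists (Num.truncn (N h)).+1; exact/ltW/truncnS_gt.
rewrite (sum_layer v_cont hm); apply: (VU m (fun i => layer i h)) => -[_|i _].
  apply: V0; first exact: layer_norm.
  apply: (@le_lt_trans _ _ (d0 / 2)); last by lra.
  by apply: sup_on_le; [exact: ltW|exact: g0].
have [_ [d dp Vi]] := CP i.+1; apply: Vi; first exact: layer_norm.
apply: le_lt_trans dp; apply: sup_on_le => // x Cx.
by rewrite /wval gS// nrm0 mul0r.
Qed.

Lemma mixed_gamma : mixed_topology N (tau_co v E) gamma.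
Proof. by split; [exact: mixable_gamma|exact: mixable_coarser_gamma]. Qed.

(* Subtracting the truncation of [f] at its supremum over [C] leaves a function
   that vanishes on [C]. *)
Lemma max_saks_le_sup_on q : max_saks_system N (tau_co v E) q ->
  exists2 C, compact C & forall f, q f <= sup_on C f.
Proof.
rewrite tau_coE => -[sq cq qN].
have /(continuous_seminormP (@co_seminorms_seminorm R s Omega v E)
  (@co_seminorms_directed R s Omega v E) sq)[_ [C cC ->] [M M0 qM]] := cq.
exists C => // f; pose t := sup_on C f; have t0 : 0 <= t by exact: sup_on_ge0.
have [_ qD _] := sq.
have -> : f = (f - trunc t f) + trunc t f by rewrite subrK.
apply: (le_trans (qD _ _)); rewrite subrK -[leRHS]add0r; apply: lerD; last first.
  by apply: (le_trans (qN _)); exact: trunc_norm.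
apply: (le_trans (qM _)); rewrite -(mulr0 M) ler_pM2l//; apply: sup_on_le => // x Cx.
rewrite /wval Cv_funD Cv_funN trunc_id ?subrr ?nrm0 ?mul0r//.
exact: sup_on_ge.
Qed.

Lemma sup_on_max_saks C : compact C -> max_saks_system N (tau_co v E) (sup_on C).
Proof.
move=> cC; split; [exact: seminorm_sup_on| |exact: sup_on_le_norm].
rewrite tau_coE; have [_] := continuous_seminormP (@co_seminorms_seminorm R s Omega v E)
  (@co_seminorms_directed R s Omega v E) (@seminorm_sup_on R s Omega v E C); apply.
by exists (sup_on C); [exists C|exists 1 => // x; rewrite mul1r].
Qed.

(** By [max_saks_le_sup_on] and [sup_on_max_saks] the seminorms [sup_on C] are cofinal in the
    maximal Saks system with constant 1, so the same null sequence serves on both sides. *)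
Lemma submixed_gamma : gamma = submixed_topology N (tau_co v E).
Proof.
apply: topology_ext; apply: coarser_seminorm_le.
  move=> _ [C [a [cC ca ->]]].
  exists (fun f => sup [set sup_on (C n) f * a n | n in [set: nat]]).
    by exists (fun n => sup_on (C n)), a; split => // n; exact: sup_on_max_saks.
  move=> f; have [A A0 AP] := c0_plus_bounded ca.
  have ub r : [set sup_on (C n) f * a n | n in [set: nat]] r -> r <= N f * A.
    move=> [n _ <-]; apply: ler_pM => //; [exact: sup_on_ge0|exact: ca.1|].
    exact: sup_on_le_norm.
  apply: seq_seminorm_le => //.
    by apply: sup_ge0 ub _ => _ [n _ <-]; rewrite mulr_ge0 ?sup_on_ge0//; exact: ca.1.
  move=> n x Cx; apply: (@le_trans _ _ (sup_on (C n) f * a n)).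
    by rewrite ler_wpM2r ?sup_on_ge//; exact: ca.1.
  by apply: le_sup_of ub _; exists n.
move=> _ [q [a [qM ca ->]]].
have /choice[C CP] n : exists C, compact C /\ forall f, q n f <= sup_on C f.
  by have [C cC qC] := max_saks_le_sup_on (qM n); exists C.
exists (seq_seminorm C a); first by exists C, a; split => // n; exact: (CP n).1.
move=> f; apply: sup_le_ub0; first exact: seq_seminorm_ge0.
move=> _ [n _ <-]; have := ca.1 n; rewrite le_eqVlt => /predU1P[<-|an0].
  by rewrite mulr0 seq_seminorm_ge0.
rewrite -ler_pdivlMr//; apply: (le_trans ((CP n).2 f)).
apply: sup_on_le; first by rewrite divr_ge0 ?seq_seminorm_ge0// ltW.
by move=> x Cx; rewrite ler_pdivlMr//; exact: seq_seminorm_ge.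
Qed.

End mixed.

(** * C-sequentiality, weights and completeness *)

Lemma convex_set_half (R : realType) (s : scalars) (X : lmodType (scalar_field R s))
    (U : set (convex_lmodType X)) (x y : X) :
  convex_set U -> U x -> U y -> U (kreal s 2^-1 *: x + kreal s 2^-1 *: y).
Proof.
move=> cU Ux Uy; have h0 : 0 <= 2^-1 :> scalar_field R s by rewrite invr_ge0.
have h1 : 2^-1 <= 1 :> scalar_field R s by rewrite invf_le1 ?ler1n.
(* Convex combinations take their coefficients in the unit interval of [K]; [l] is one half
   there. *)
pose l := Itv01 h0 h1.
have := cU x y l; rewrite !inE => /(_ Ux Uy).
have kl : kreal s 2^-1 = l%:num.
  apply: (@mulfI _ 2%:R); first by rewrite pnatr_eq0.
  rewrite /= mulfV ?pnatr_eq0// -[X in _ = X](kreal1 R s).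
  rewrite -[2%:R]/(1 + 1) -(kreal1 R s) -krealD -krealM; congr (kreal s _).
  by rewrite -[1 + 1]/2%:R mulfV// pnatr_eq0.
rewrite (_ : (conv l (x : convex_lmodType X) (y : convex_lmodType X) : X) =
  kreal s 2^-1 *: x + kreal s 2^-1 *: y)//.
rewrite {2}(_ : kreal s 2^-1 = 1 - l%:num) ?kl//.
by rewrite -kl -kreal1 -krealB; congr (kreal s _); lra.
Qed.

(** The sum is the convex combination of the points [x + 2 ^+ i.+1 *: h i] with weights [2 ^- i.+1]
    and of [x] with the remaining weight [2 ^- m]. *)
Lemma convex_set_dyadic (R : realType) (s : scalars) (X : lmodType (scalar_field R s))
    (U : set (convex_lmodType X)) (x : X) (h : nat -> X) (m : nat) :
  convex_set U -> U x -> (forall i, (i < m)%N -> U (x + kreal s (2 ^+ i.+1) *: h i)) ->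
  U (x + \sum_(i < m) h i).
Proof.
move=> cU Ux hU.
have : forall h : nat -> X, (forall i, (i < m)%N -> U (x + h i)) ->
    U (x + \sum_(i < m) kreal s (2 ^- i.+1) *: h i).
  elim: m {h hU} => [|m IH] h hU; first by rewrite big_ord0 addr0.
  have -> : x + \sum_(i < m.+1) kreal s (2 ^- i.+1) *: h i =
      kreal s 2^-1 *: (x + h 0%N) +
      kreal s 2^-1 *: (x + \sum_(i < m) kreal s (2 ^- i.+1) *: h i.+1).
    rewrite big_ord_recl !scalerDr addrACA -scalerDl -krealD.
    rewrite (_ : 2^-1 + 2^-1 = 1 :> R); last by lra.
    rewrite kreal1 scale1r expr1; congr (_ + (_ + _)); rewrite scaler_sumr.
    by apply: eq_bigr => i _; rewrite scalerA -krealM -invfM -exprS.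
  apply: (convex_set_half cU); first exact: hU.
  by apply: (IH (fun i => h i.+1)) => i im; exact: hU.
move=> /(_ (fun i => kreal s (2 ^+ i.+1) *: h i) hU).
rewrite (eq_bigr (fun i : 'I_m => h i)) // => i _.
by rewrite scalerA -krealM mulVf ?kreal1 ?scale1r// expf_neq0.
Qed.

Section consequences.
Context (R : realType) (s : scalars).
Local Notation K := (scalar_field R s).
Context (Omega : topologicalType) (v : Omega -> {posnum R}).
Context (E : normedModType K).
Hypothesis (v_cont : continuous (fun x => (v x)%:num : R^o)).
Local Notation X := (Cv v E).
Local Notation N := (Cv_norm v E).
Local Notation gamma := (seminorm_topology (compact_seminorms v E)).

Let sP := @compact_seminorms_seminorm R s Omega v E.
Let dP := @compact_seminorms_directed R s Omega v E.

Lemma hemicompact_increasing : hemicompact Omega -> exists D : nat -> set Omega,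
  [/\ forall n, compact (D n), forall m n, (m <= n)%N -> D m `<=` D n &
      forall C, compact C -> exists n, C `<=` D n].
Proof.
move=> [C [cC exC]]; exists (fun n => \big[setU/set0]_(i < n.+1) C i); split.
- by move=> n; apply: bigsetU_compact => i _; exact: cC.
- by move=> m n mn; exact: subset_bigsetU.
move=> D /exC[n Dn]; exists n => x /Dn Cx.
by rewrite (bigD1 (@ord_max n))//=; left.
Qed.

Lemma gamma_C_sequential : hemicompact Omega -> C_sequential gamma.
Proof.
move=> /hemicompact_increasing[D [cD Dinc Dex]] U cU sU.
suff : open (U : set (topologized gamma)) by [].
rewrite openE => f Uf; rewrite /interior /=.
(* On the ball of radius [M] the exhaustion describes the neighbourhoods of 0 by countably many
   conditions. If all of them failed, a bounded sequence of [h n] would make [f + h n] converge to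
   [f] outside [U]. *)
have /choice[n nP] M : exists n, forall h : X, N h <= M -> sup_on (D n) h < n.+1%:R^-1 -> U (f + h).
  apply: contrapT => /forallNP noN.
  have /choice[h hP] n : exists h : X, [/\ N h <= M, sup_on (D n) h < n.+1%:R^-1 & ~ U (f + h)].
    apply: contrapT => /forallNP noh; apply: (noN n) => h hM hD.
    by apply: contrapT => nU; apply: (noh h).
  have : (fun n => f + h n : topologized gamma) @ \oo --> (f : topologized gamma).
    move=> A /(nbhs_seminormP _ _ sP dP)[p Pp [e e0 eA]].
    have e20 : 0 < e / 2 by rewrite divr_gt0.
    have [C cC [d d0 Cd]] := compact_seminorms_bounded M Pp e20.
    have [n0 Cn0] := Dex _ cC.
    exists (maxn n0 (Num.truncn d^-1)) => // n /=; rewrite geq_max => /andP[n0n dn].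
    apply: eA; rewrite (addrC f) addrK; apply: (@le_lt_trans _ _ (e / 2)); last by lra.
    have [hM hD _] := hP n; apply: Cd => //; apply: (@le_lt_trans _ _ (sup_on (D n) (h n))).
      apply: sup_on_le (sup_on_ge0 _ _) _ => x /Cn0 Dx; apply: sup_on_ge.
      exact: Dinc Dx.
    apply: (lt_le_trans hD); rewrite invf_ple ?posrE//; apply/ltW.
    by apply: (lt_le_trans (truncnS_gt _)); rewrite ler_nat.
  move=> /(sU _ _ Uf)[n _ nU]; have [_ _] := hP n; apply; exact: (nU n (leqnn n)).
(* [convex_set_dyadic] enlarges layer [i] by the factor [2 ^+ i.+1], so its norm may reach [M i].
   The divisor 4 below keeps the doubled layer 0 at half of the admissible bound, hence strictly
   below it. *)
pose M i : R := 2 ^+ i.+1; pose k i := n (M i).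
have e0 : 0 < (k 0%N).+1%:R^-1 / 4 :> R by rewrite divr_gt0.
have [p Pp pP] := layer_decomposition E v_cont (fun i => cD (k i)) e0.
apply/(nbhs_seminormP _ _ sP dP); exists p => //; exists 1 => // g /pP[g0 gS].
pose h := (g : X) - f.
have -> : g = f + h by rewrite /h addrC subrK.
have [m hm] : exists m : nat, N h <= m%:R.
  by exists (Num.truncn (N h)).+1; exact/ltW/truncnS_gt.
have [_ _ NZ] := @seminorm_norm R s Omega v E.
rewrite (sum_layer v_cont hm).
apply: (@convex_set_dyadic R s X U f (fun i => layer i h) m cU Uf) => i _.
apply: (nP (M i)).
  by rewrite NZ nrm_kreal ger0_norm ?exprn_ge0// ler_piMr ?exprn_ge0// layer_norm.
have k0 j : 0 < (k j).+1%:R^-1 :> R by rewrite invr_gt0.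
case: i => [|i].
  apply: (@le_lt_trans _ _ ((k 0%N).+1%:R^-1 / 2)); last first.
    change ((k 0%N).+1%:R^-1 / 2 < (k 0%N).+1%:R^-1 :> R).
    by move: (k0 0%N); move: (_.+1%:R^-1 : R) => z z0; lra.
  apply: sup_on_le; first by rewrite divr_ge0// ltW.
  move=> x Dx; rewrite wvalZ nrm_kreal ger0_norm ?exprn_ge0// expr1.
  by move: (g0 x Dx); move: ((k 0%N).+1%:R^-1 : R) (wval (layer 0 h) x) => z w; lra.
apply: le_lt_trans (k0 _); apply: sup_on_le => // x Dx.
by rewrite wvalZ /wval gS// nrm0 mul0r mulr0.
Qed.

(** * Weights vanishing at infinity and their envelopes *)

Section weights.

Let wsup (w : Omega -> R) (f : X) : R := sup [set wval f x * w x | x in [set: Omega]].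

Let wsup_ge w M f x : (forall x, 0 <= w x) -> (forall x, w x <= M) ->
  wval f x * w x <= wsup w f.
Proof.
move=> w0 wM; apply: (@le_sup_of _ _ (N f * M)); last by exists x.
move=> _ [y _ <-]; apply: ler_pM => //; [exact: wval_ge0|exact: wval_le_norm].
Qed.

Lemma weight_seminorm_le w : Wb0 R Omega w ->
  exists2 p, compact_seminorms v E p & forall f, wsup w f <= p f.
Proof.
move=> [w0 wv [M wM]].
(* For the least [n] with [x] in [C n], [w x] is at most [M] if [n = 0] and below [1 / n] otherwise;
   this explains the index shift in [a]. *)
pose C n := [set x | n.+1%:R^-1 <= w x].
pose a n : R := if n is n'.+1 then n'.+1%:R^-1 else `|M|.
have ca : c0_plus a.
  apply: c0_plusP => [[|n]//=|e e0]; exists (Num.truncn e^-1).+1 => -[//|n].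
  rewrite ltnS => en /=; rewrite invf_ple ?posrE//; apply/ltW.
  by apply: (lt_le_trans (truncnS_gt _)); rewrite ler_nat.
exists (seq_seminorm C a).
  by exists C, a; split => // n; apply: wv; rewrite invr_gt0.
move=> f; apply: sup_le_ub0; first exact: seq_seminorm_ge0.
move=> _ [x _ <-]; have [wx0|wx0] := leP (w x) 0.
  have -> : w x = 0 by apply/eqP; rewrite eq_le wx0 w0.
  by rewrite mulr0 seq_seminorm_ge0.
have exn : exists n, n.+1%:R^-1 <= w x.
  exists (Num.truncn (w x)^-1); rewrite invf_ple ?posrE//; exact/ltW/truncnS_gt.
case: (ex_minnP exn) => n nw nmin.
apply: (@le_trans _ _ (wval f x * a n)); last exact: seq_seminorm_ge.
rewrite ler_wpM2l ?wval_ge0//; case: n nw nmin => [|n] nw nmin /=.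
  by apply: (le_trans (wM x)); exact: ler_norm.
rewrite leNgt; apply/negP => /ltW /nmin; by rewrite ltnn.
Qed.

Lemma usc_vanishing_bounded w : Wusc0 R Omega w -> Wb0 R Omega w.
Proof.
move=> [w0 wv wusc]; split => //.
have [M MP] : exists M, forall x, 1 <= w x -> w x <= M.
  apply: (compact_induction (P := fun B => exists M, forall x, B x -> w x <= M) (wv _ ltr01)).
  - by exists 0.
  - by move=> A B AB [M MP]; exists M => x /AB; exact: MP.
  - move=> A B [M MP] [M' M'P]; exists (Num.max M M') => x [/MP|/M'P] h.
      by rewrite le_max h.
    by rewrite le_max h orbT.
  move=> x _; exists [set y | w y < w x + 1]; first by apply: wusc; rewrite ltrDl.
  by exists (w x + 1) => y [/= /ltW].
exists (Num.max M 1) => x; have [x1|/ltW x1] := leP 1 (w x).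
  by rewrite le_max MP.
by rewrite le_max x1 orbT.
Qed.

Lemma continuous_vanishing_usc w : C0_plus R Omega w -> Wusc0 R Omega w.
Proof.
move=> [w0 wv cw]; split => // x a xa.
by apply: (cw x [set r | r < a]); exact: (@lt_nbhsl R (w x) a).
Qed.

Lemma closed_usc (w : Omega -> R) (e : R) :
  upper_semicontinuous w -> closed [set x : Omega | e <= w x].
Proof.
move=> wusc; rewrite -openC openE => x /= /negP; rewrite -ltNge => wx.
by apply: filterS (wusc x e wx) => y; rewrite /= ltNge => /negP.
Qed.

(** Reduces each family of weights to an envelope problem: one weight has to dominate every [a n] on
    [C n]. *)
Lemma gamma_weight_seminorms (W : set (Omega -> R)) : W `<=` Wb0 R Omega ->
  (forall C a, (forall n, compact (C n)) -> c0_plus a ->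
     exists2 w : Omega -> R, W w & forall n x, C n x -> a n <= w x) ->
  gamma = seminorm_topology (weight_seminorms v E W).
Proof.
move=> WW exW; apply: topology_ext; apply: coarser_seminorm_le.
  move=> _ [C [a [cC ca ->]]]; have [w Ww aw] := exW _ _ cC ca.
  exists (wsup w); first by exists w.
  have [w0 _ [M wM]] := WW _ Ww.
  have wP f x : wval f x * w x <= wsup w f by exact: wsup_ge wM.
  move=> f; apply: seq_seminorm_le.
    apply: (sup_ge0 (c := N f * M)) => _ [x _ <-]; last by rewrite mulr_ge0 ?wval_ge0.
    by apply: ler_pM => //; [exact: wval_ge0|exact: wval_le_norm].
  by move=> n x Cx; apply: le_trans (wP f x); rewrite ler_wpM2l ?wval_ge0// aw.
by move=> _ [w Ww ->]; exact: weight_seminorm_le (WW _ Ww).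
Qed.

(** The weight at [x] is the supremum of the [a n] with [x] in [C n]. Above a positive level only
    finitely many [n] count; their compact sets are closed, so points near [x] avoid those that miss
    [x], and their union contains the level set. *)
Lemma usc_envelope (Omega_haus : hausdorff_space Omega) (C : nat -> set Omega) (a : nat -> R) :
  (forall n, compact (C n)) -> c0_plus a ->
  exists2 w, Wusc0 R Omega w & forall n x, C n x -> a n <= w x.
Proof.
move=> cC ca; have [A A0 AP] := c0_plus_bounded ca.
pose S x := [set a n | n in [set n | C n x]].
have ub x r : S x r -> r <= A by move=> [n _ <-]; exact: AP.
have aw n x : C n x -> a n <= sup (S x) by move=> Cx; apply: le_sup_of (@ub x) _; exists n.
have w0 x : 0 <= sup (S x) by apply: sup_ge0 (@ub x) _ => _ [n _ <-]; exact: ca.1.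
have wusc : upper_semicontinuous (fun x => sup (S x)).
  move=> x b xb; pose c := (sup (S x) + b) / 2.
  have c0 : 0 < c by have := w0 x; rewrite /c; lra.
  have [n0 n0P] := c0_plus_near ca c0.
  have near_n : \forall y \near x, forall i : 'I_n0, C i y -> C i x.
    apply: filter_forall => i; have [Cx|nCx] := pselect (C i x).
      by apply: filterE => y _.
    have : nbhs x (~` C i).
      apply: open_nbhs_nbhs; split => //.
      by apply: closed_openC; exact: compact_closed (cC i).
    by apply: filterS => y nCy /nCy.
  apply: filterS near_n => y ny; apply: (@le_lt_trans _ _ c); last by rewrite /c; lra.
  apply: sup_le_ub0; first exact: ltW.
  move=> _ [n Cy <-]; have [nn0|n0n] := ltnP n n0; last exact/ltW/n0P.
  by apply: (le_trans (aw n x (ny (Ordinal nn0) Cy))); rewrite /c; lra.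
exists (fun x => sup (S x)) => //; split => // e e0.
have e20 : 0 < e / 2 by rewrite divr_gt0.
have [n0 n0P] := c0_plus_near ca e20.
apply: (@subclosed_compact _ _ (\big[setU/set0]_(i < n0) C i)).
- exact: closed_usc.
- by apply: bigsetU_compact => i _; exact: cC.
move=> x /= ex; apply: contrapT => nCx.
suff : sup (S x) <= e / 2 by lra.
apply: sup_le_ub0; first exact: ltW.
move=> _ [n Cx <-]; have [nn0|n0n] := ltnP n n0; last exact/ltW/n0P.
by exfalso; apply: nCx; rewrite (bigD1 (Ordinal nn0))//=; left.
Qed.

Lemma locally_compact_bump (Omega_creg : completely_regular_space Omega) (C : set Omega) :
  locally_compact [set: Omega] -> compact C ->
  exists g : Omega -> R, [/\ continuous g, forall x, 0 <= g x <= 1,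
    forall x, C x -> g x = 1 & exists2 L, compact L & forall x, ~ L x -> g x = 0].
Proof.
move=> lc cC.
apply: (compact_induction (P := fun B => exists g : Omega -> R, [/\ continuous g,
  forall x, 0 <= g x <= 1, forall x, B x -> g x = 1 &
  exists2 L, compact L & forall x, ~ L x -> g x = 0]) cC).
- exists (cst 0); split => //; [exact: cst_continuous|by move=> x /=; rewrite lexx ler01|].
  by exists set0 => //; exact: compact0.
- move=> A B AB [g [cg g01 gB gL]]; exists g; split => // x /AB; exact: gB.
- move=> A B [g [cg g01 gA [L cL gL]]] [h [ch h01 hB [M cM hM]]].
  exists (fun x => Num.max (g x) (h x)); split.
  + by move=> x; apply: (@continuous_max _ _ g h); [exact: cg|exact: ch].
  + move=> x; have /andP[g0 g1] := g01 x; have /andP[h0 h1] := h01 x.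
    by rewrite le_max g0/= ge_max g1.
  + move=> x; have /andP[g0 g1] := g01 x; have /andP[h0 h1] := h01 x.
    move=> [/gA|/hB] E1; apply/eqP; rewrite eq_le ge_max g1 h1/= le_max E1 lexx ?orbT//.
  + exists (L `|` M); first exact: compactU.
    by move=> x /not_orP[/gL -> /hM ->]; rewrite maxxx.
move=> x _; have [L /= xL' [cL clL]] := lc x I.
have xL : nbhs x L by apply: (@filterS _ (nbhs x) _ [set y | setT y -> L y]) xL' => y h; exact: h.
have sep : uniform_separator [set x] (~` L°).
  apply: Omega_creg; first by apply: open_closedC; exact: open_interior.
  by move=> nL; exact: (nL xL).
have [f [cf f01 f0 f1]] := (@uniform_separatorP Omega R _ _).1 sep.
have f01' y : 0 <= f y <= 1 by have := f01 (f y); rewrite /= in_itv /=; apply; exists y.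
have fx : f x = 0 by apply: f0; exists x.
exists [set y | f y < 2^-1].
  apply: (cf x [set r | r < 2^-1]); rewrite fx; exact: (@lt_nbhsl R 0 2^-1).
(* The separating function controls only the point [x]; doubling and clipping makes the value 1 hold
   on the whole neighbourhood [f < 1 / 2], still with zeros off [L]. *)
exists (fun y => Num.min 1 (2 * (1 - f y))); split.
- move=> y; apply: (@continuous_min _ _ (cst 1) (fun y => 2 * (1 - f y))); first exact: cvg_cst.
  apply: cvgM; first exact: cvg_cst.
  by apply: cvgB; [exact: cvg_cst|exact: cf].
- move=> y; have /andP[g0 g1] := f01' y; rewrite ge_min lexx/= le_min ler01/=; lra.
- move=> y [/= yf _]; rewrite min_l//; lra.
exists L => // y nLy; have -> : f y = 1.
  by apply: f1; exists y => // /interior_subset.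
by rewrite subrr mulr0 min_r.
Qed.

(** The supremum of [a n * g n] with bumps [g n]. It is continuous since terms beyond some index are
    uniformly small, and the remaining finitely many vary little near a point. *)
Lemma continuous_envelope (Omega_creg : completely_regular_space Omega)
    (C : nat -> set Omega) (a : nat -> R) : locally_compact [set: Omega] ->
  (forall n, compact (C n)) -> c0_plus a ->
  exists2 w, C0_plus R Omega w & forall n x, C n x -> a n <= w x.
Proof.
move=> lc cC ca; have [A A0 AP] := c0_plus_bounded ca.
have /choice[g gP] n := locally_compact_bump Omega_creg lc (cC n).
have g0 n x : 0 <= g n x by have [_ /(_ x)/andP[]] := gP n.
have g1 n x : g n x <= 1 by have [_ /(_ x)/andP[]] := gP n.
pose S x := [set a n * g n x | n in [set: nat]].
have ag n x : a n * g n x <= a n by rewrite ler_piMr//; exact: ca.1.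
have ub x r : S x r -> r <= A by move=> [n _ <-]; exact: le_trans (ag n x) (AP n).
have aw n x : a n * g n x <= sup (S x) by apply: le_sup_of (@ub x) _; exists n.
have w0 x : 0 <= sup (S x).
  by apply: sup_ge0 (@ub x) _ => _ [n _ <-]; rewrite mulr_ge0//; exact: ca.1.
have cw : continuous (fun x => sup (S x)).
  move=> x; apply/cvgrPdist_le => e e0; have [n0 n0P] := c0_plus_near ca e0.
  have near_n : \forall y \near x, forall i : 'I_n0, `|g i x - g i y| < e / A.
    apply: filter_forall => i; have [cg _ _ _] := gP i.
    by have := cg x; move/cvgrPdist_lt; apply; rewrite divr_gt0.
  apply: filterS near_n => y ny.
  have main z t : (forall i : 'I_n0, `|g i z - g i t| < e / A) -> sup (S z) <= sup (S t) + e.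
    move=> zt; apply: sup_le_ub0; first by rewrite addr_ge0// ltW.
    move=> _ [n _ <-]; have [nn0|n0n] := ltnP n n0; last first.
      by apply: (le_trans (ag n z)); rewrite (le_trans (ltW (n0P _ n0n)))// lerDr.
    rewrite -lerBlDl; apply: (@le_trans _ _ (a n * (g n z - g n t))).
      by rewrite mulrBr lerB.
    apply: (@le_trans _ _ (A * (e / A))); last by rewrite mulrC divfK// gt_eqF.
    apply: (@le_trans _ _ (a n * `|g n z - g n t|)).
      by rewrite ler_wpM2l ?ler_norm//; exact: ca.1.
    by apply: ler_pM => //; [exact: ca.1|exact/ltW/(zt (Ordinal nn0))].
  have h1 := main _ _ ny.
  have h2 : sup (S y) <= sup (S x) + e by apply: main => i; rewrite distrC.
  by rewrite ler_norml; apply/andP; split; lra.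
exists (fun x => sup (S x)); last first.
  move=> n x Cx; have [_ _ gC _] := gP n.
  by have := aw n x; rewrite gC// mulr1.
split => // e e0; have e20 : 0 < e / 2 by rewrite divr_gt0.
have [n0 n0P] := c0_plus_near ca e20.
have /choice[L LP] n : exists L, compact L /\ forall x, ~ L x -> g n x = 0.
  by have [_ _ _ [L cL gL]] := gP n; exists L.
apply: (@subclosed_compact _ _ (\big[setU/set0]_(i < n0) L i)).
- apply: (@preimage_closed _ R (fun x => sup (S x)) [set r | e <= r]); last exact: closed_ge.
  by move=> x _; exact: cw.
- by apply: bigsetU_compact => i _; exact: (LP i).1.
move=> x /= ex; apply: contrapT => nLx.
suff : sup (S x) <= e / 2 by lra.
apply: sup_le_ub0; first exact: ltW.
move=> _ [n _ <-]; have [nn0|n0n] := ltnP n n0; last first.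
  by apply: (le_trans (ag n x)); exact/ltW/n0P.
rewrite (LP n).2 ?mulr0 ?(ltW e20)// => Lx.
by apply: nLx; rewrite (bigD1 (Ordinal nn0))//=; left.
Qed.

End weights.

(** * Completeness over k_R-spaces *)

Lemma gamma_complete : kR_space Omega -> banach E -> complete_topology gamma.
Proof.
move=> kR banE F FF Fc.
have Fp p e : compact_seminorms v E p -> 0 < e ->
    exists2 A, F A & forall f g : X, A f -> A g -> p (f - g) < e.
  move=> Pp e0; have [|A FA AP] := Fc [set h : X | p h < e]; last by exists A.
  apply/(nbhs_seminormP _ _ sP dP); exists p => //; exists e => // y.
  by rewrite subr0.
have point_c : c0_plus (fun n => (n == 0%N)%:R : R).
  by apply: c0_plusP => // e e0; exists 1%N => -[|n] //= _; exact: ltW.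
have /choice[h hP] x : exists u : E, forall e : R, 0 < e -> F [set f | nrm (u - (f : X) x) < e].
  pose ev (f : topologized gamma) : E := (f : X) x.
  have : cauchy (ev @ F).
    move=> A /entourage_nrmP[e e0 eA].
    have [|B FB BP] := @Fp (seq_seminorm (fun=> [set x]) (fun n => (n == 0%N)%:R))
      (e * (v x)%:num) _ (mulr_gt0 e0 [gt0 of (v x)%:num]).
      exists (fun=> [set x]), (fun n => (n == 0%N)%:R); split => // _; exact: compact_set1.
    have FevB : F (ev @^-1` (ev @` B)) by apply: filterS FB => f Bf; exists f.
    exists (ev @` B, ev @` B); first by split.
    move=> [_ _] [/= [f Bf <-] [g Bg <-]]; apply: eA.
    have := @seq_seminorm_ge _ _ _ _ _ (fun=> [set x]) _ point_c ((f : X) - g) 0%N x erefl.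
    move=> /le_lt_trans /(_ (BP _ _ Bf Bg)).
    by rewrite /= mulr1 /wval Cv_funD Cv_funN ltr_pM2r.
  move=> /banE cvgF; exists (lim (ev @ F)) => e e0.
  have := cvgF _; move/(_ [set u | nrm (lim (ev @ F) - u) < e]); apply.
  by apply/nbhs_nrmP; exists e.
(* The Cauchy estimate passes to the pointwise limit: [A] is fixed first, and for each point some
   [g] in [A] close to [h] at that point is inserted. *)
have Flim C a e : (forall n, compact (C n)) -> c0_plus a -> 0 < e ->
    exists2 A, F A & forall f : X, A f -> forall n x, C n x ->
      nrm (h x - f x) * (v x)%:num * a n <= e.
  move=> cC ca e0; have [|A FA AP] := @Fp (seq_seminorm C a) e _ e0; first by exists C, a.
  exists A => // f Af n x Cx; apply/ler_addgt0Pr => d d0.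
  have [B B0 aB] := c0_plus_bounded ca.
  pose d' := d / ((v x)%:num * B); have d'0 : 0 < d' by rewrite divr_gt0// mulr_gt0.
  have [g [Ag gh]] := filter_ex (filterI FA (hP x _ d'0)).
  have := le_lt_trans (seq_seminorm_ge ca ((g : X) - f) Cx) (AP _ _ Ag Af).
  rewrite /wval Cv_funD Cv_funN => h1.
  have h2 := nrm_dist_triangle (h x) ((g : X) x) (f x).
  have va0 : 0 <= (v x)%:num * a n by rewrite mulr_ge0//; exact: ca.1.
  have := ler_wpM2r va0 h2; rewrite mulrDl !mulrA => h3; apply: (le_trans h3).
  rewrite addrC; apply: lerD; first exact: ltW.
  rewrite -mulrA; apply: (@le_trans _ _ (d' * ((v x)%:num * B))).
    apply: ler_pM => //; [exact: nrm_ge0|exact: ltW|by rewrite ler_wpM2l].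
  by rewrite /d' divfK// gt_eqF// mulr_gt0.
have ch : continuous h.
  apply: kR => [|C cC]; first exact: (@uniform_completely_regular R).
  apply/subspace_continuousP => x Cx; apply/cvg_nrmP => e e0.
  have [d d0 [M M0 dM]] := weight_bounds v_cont cC.
  have e30 : 0 < e / 3 by rewrite divr_gt0.
  have [A FA AP] := Flim (fun=> C) _ (e / 3 * d) (fun=> cC) point_c (mulr_gt0 e30 d0).
  have [f Af] := filter_ex FA.
  have hf y : C y -> nrm (h y - (f : X) y) <= e / 3.
    move=> Cy; have := AP f Af 0%N y Cy; rewrite /= mulr1 => h1.
    have [dv _] := andP (dM y Cy); rewrite -(ler_pM2r d0); apply: le_trans h1.
    by rewrite ler_wpM2l ?nrm_ge0.
  have cf := @Cv_continuous _ _ _ _ _ (f : X).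
  suff : \forall y \near x, C y -> nrm (h x - h y) < e by [].
  apply: filterS ((continuous_nrmP _).1 cf x _ e30) => y fxy Cy.
  have t1 := nrm_dist_triangle (h x) ((f : X) x) (h y).
  have t2 := nrm_dist_triangle ((f : X) x) ((f : X) y) (h y).
  have := hf x Cx; have := hf y Cy; rewrite (nrmB (h y)); lra.
have [M hM] : exists M : R, forall x, nrm (h x) * (v x)%:num <= M.
  apply: contrapT => /forallNP noM.
  (* With the weights [1 / (n + 1)] at these points some [f] is within [n + 1] of [h] at every
     [x n]. For [n] the integer part of the norm of [f] this bounds [h] at [x n] by [2 (n + 1)],
     hence the factor 2. *)
  have /choice[x xP] n : exists x, 2 * n.+1%:R < nrm (h x) * (v x)%:num.
    have /existsNP[x /negP] := noM (2 * n.+1%:R); rewrite -ltNge => hx; by exists x.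
  pose a n : R := n.+1%:R^-1.
  have ca : c0_plus a.
    apply: c0_plusP => [n|e e0]; first by rewrite /a invr_ge0.
    exists (Num.truncn e^-1) => n en.
    rewrite /a invf_ple ?posrE//; apply/ltW.
    by apply: (lt_le_trans (truncnS_gt _)); rewrite ler_nat.
  have [A FA AP] := Flim (fun n => [set x n]) a 1 (fun=> compact_set1 (x := _)) ca ltr01.
  have [f Af] := filter_ex FA; pose n := Num.truncn (N f).
  have := AP f Af n (x n) erefl; rewrite ler_pdivrMr// mul1r => h1.
  have := wval_le_norm (f : X) (x n); rewrite /wval => h2.
  have h3 : N f < n.+1%:R := truncnS_gt _.
  have := nrm_dist_triangle (h (x n)) ((f : X) (x n)) 0; rewrite !subr0 => h4.
  have := ler_wpM2r (ltW [gt0 of (v (x n))%:num]) h4; rewrite mulrDl.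
  by have := xP n; lra.
have [f fh] := Cv_exists ch hM.
exists f => U /(nbhs_seminormP _ _ sP dP)[_ [C [a [cC ca ->]]] [e e0 eU]].
have e20 : 0 < e / 2 by rewrite divr_gt0.
have [A FA AP] := Flim _ _ _ cC ca e20.
apply: filterS FA => g Ag; apply: eU; apply: (@le_lt_trans _ _ (e / 2)); last by lra.
apply: seq_seminorm_le; first exact: ltW.
by move=> n x Cx; rewrite /wval Cv_funD Cv_funN fh nrmB; exact: AP Cx.
Qed.

End consequences.

(** * Uniform boundedness and the discrete case *)

(** [P] receives the list of all earlier choices, because the hump constructions depend on the whole
    history. *)
Lemma dependent_sequence (T : Type) (P : seq T -> T -> Prop) :
  (forall l, exists t, P l t) -> exists b : nat -> T, forall n, P (mkseq b n) (b n).
Proof.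
move=> /choice[c cP]; pose L n := iter n (fun l => rcons l (c l)) [::].
exists (fun n => c (L n)) => n.
suff -> : mkseq (fun n => c (L n)) n = L n by exact: cP.
by elim: n => //= n IH; rewrite mkseqS IH.
Qed.

Section uniform_boundedness.
Context (R : realType) (s : scalars).
Local Notation K := (scalar_field R s).

(** [2 z = (u + z) - (u - z)]. This is the choice of signs in both gliding hump arguments. *)
Lemma nrm_max_pm (u z : K^o) : nrm z <= nrm (u + z) \/ nrm z <= nrm (u - z).
Proof.
have [h|h] := leP (nrm z) (nrm (u + z)); [by left|right].
have : nrm (z + z) <= nrm (u + z) + nrm (u - z).
  have := nrmD (u + z) (- (u - z)); rewrite nrmN.
  by rewrite opprB addrC addrA subrK.
have -> : z + z = kreal s 2 *: z by rewrite -[2]/(1 + 1) krealD kreal1 scalerDl scale1r.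
by rewrite (@nrmZ R s K^o) nrm_kreal ger0_norm//; lra.
Qed.

(* The gliding hump of Sokal's proof of the uniform boundedness theorem; the
   third and fourth hypotheses stand for the signs and the convergence of the
   series of general term [3 ^- k.+1 * b k]. *)
Lemma uniform_boundedness (I T : Type) (A : set T) (phi : I -> T -> K^o) :
  (forall a, A a -> exists M, forall i, nrm (phi i a) <= M) ->
  (forall i, exists M, forall a, A a -> nrm (phi i a) <= M) ->
  (forall a, A a -> exists2 a', A a' & forall i, phi i a' = - phi i a) ->
  (forall b : nat -> T, (forall n, A (b n)) -> exists2 a, A a &
    forall i n M, (forall a', A a' -> nrm (phi i a') <= M) ->
      nrm (phi i a - \sum_(k < n) kreal s (3 ^- k.+1) *: phi i (b k)) <= M * (3 ^- n / 2)) ->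
  exists M, forall i a, A a -> nrm (phi i a) <= M.
Proof.
move=> bI bA opA serA; apply: contrapT => /forallNP noM.
pose S i := sup [set nrm (phi i a) | a in A].
have Sge i a : A a -> nrm (phi i a) <= S i.
  move=> Aa; have [M MP] := bA i.
  by apply: (@le_sup_of _ _ M); [move=> _ [b Ab <-]; exact: MP|exists a].
(* The tail after term [n] is at most half of [3 ^- n.+1 * S], so a hump reaching [9 / 10] of [S]
   leaves [2 / 5] of it. The growth [n * 3 ^+ n.+1] turns this into a lower bound [2 / 5 * n]. *)
have /choice[ia iaP] n : exists ia : I * T, [/\ A ia.2, n%:R * 3 ^+ n.+1 < S ia.1 &
    9 / 10 * S ia.1 < nrm (phi ia.1 ia.2)].
  have /existsNP[i /existsNP[a /not_implyP[Aa /negP]]] := noM (n%:R * 3 ^+ n.+1).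
  rewrite -ltNge => nS.
  have Sn : n%:R * 3 ^+ n.+1 < S i by apply: lt_le_trans nS (Sge _ _ Aa).
  have S0 : 0 < S i by apply: le_lt_trans Sn; rewrite mulr_ge0// exprn_ge0.
  apply: contrapT => /forallNP noa.
  suff : S i <= 9 / 10 * S i by lra.
  apply: sup_le_ub0; first by rewrite mulr_ge0// ltW.
  move=> _ [b Ab <-]; rewrite leNgt; apply/negP => bS.
  by apply: (noa (i, b)); split.
pose i n := (ia n).1; pose a n := (ia n).2; pose c n : R := 3 ^- n.+1.
have Aa n : A (a n) by have [] := iaP n.
have c0 n : 0 <= c n by rewrite invr_ge0 exprn_ge0.
have [|b bP] := @dependent_sequence T (fun l t => A t /\
  c (size l) * nrm (phi (i (size l)) (a (size l))) <=
  nrm (\sum_(k < size l) kreal s (c k) *: phi (i (size l)) (nth (a 0%N) l k) +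
    kreal s (c (size l)) *: phi (i (size l)) t)).
  move=> l; set n := size l; set u := \sum_(k < n) _.
  have cn : c n * nrm (phi (i n) (a n)) = nrm (kreal s (c n) *: phi (i n) (a n)).
    by rewrite (@nrmZ R s K^o) nrm_kreal ger0_norm.
  rewrite cn; have [h|h] := nrm_max_pm u (kreal s (c n) *: phi (i n) (a n)).
    by exists (a n).
  have [a' Aa' a'P] := opA _ (Aa n); exists a'; split => //.
  by rewrite a'P scalerN.
have Ab n : A (b n) := (bP n).1.
have [x Ax xP] := serA b Ab; have [M MP] := bI _ Ax.
(* [5 / 2] is the inverse of [9 / 10 - 1 / 2]. *)
pose n := (Num.truncn (5 / 2 * `|M|)).+1.
have nM : 5 / 2 * `|M| < n%:R by exact: truncnS_gt.
have [_ nS Sa] := iaP n; have [_] := bP n; rewrite size_mkseq.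
rewrite (eq_bigr (fun k : 'I_n => kreal s (c k) *: phi (i n) (b k))); last first.
  by move=> k _; rewrite nth_mkseq.
have -> : \sum_(k < n) kreal s (c k) *: phi (i n) (b k) + kreal s (c n) *: phi (i n) (b n) =
  \sum_(k < n.+1) kreal s (c k) *: phi (i n) (b k) by rewrite [RHS]big_ord_recr.
set sm := \sum_(k < n.+1) _ => h1.
have h2 : nrm (phi (i n) x - sm) <= S (i n) * (3 ^- n.+1 / 2) by apply: xP => a' /Sge.
have h3 := MP (i n); have h4 := ler_norm M.
have h5 := nrm_dist_triangle sm (phi (i n) x) 0.
rewrite !subr0 nrmB in h5.
have h6 : c n * (9 / 10 * S (i n)) <= c n * nrm (phi (i n) (a n)).
  by rewrite ler_wpM2l// ltW.
have h7 : n%:R <= c n * S (i n).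
  by rewrite mulrC ler_pdivlMr ?exprn_gt0// ltW.
move: h2; rewrite -/(c n) => h2; move: h7 h6 h5 h4 h3 h2 h1 nM.
move: (S (i n)) (c n) (c0 n) (nrm (phi (i n) (a n))) => z w w0 t.
have -> : z * (w / 2) = w * z / 2 by ring.
have -> : w * (9 / 10 * z) = 9 / 10 * (w * z) by ring.
by move: (w * z) (w * t) (n%:R : R) => {z t w w0} p q r; lra.
Qed.

Section compact_disc.
Context (X : lmodType K) (B : set (X -> K^o)).
Hypotheses (cB : weakly_compact B) (aB : absolutely_convex B).

Lemma absolutely_convex_series (b : nat -> X -> K^o) n : (forall n, B (b n)) ->
  B (fun x => \sum_(k < n) kreal s (3 ^- k.+1) *: b k x).
Proof.
elim: n b => [|n IH] b Bb.
  rewrite (_ : (fun _ => _) = fun x => (0 : K) *: b 0%N x + (0 : K) *: b 0%N x).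
    by apply: aB; rewrite ?Bb// nrm0 addr0.
  by apply/funext => x; rewrite big_ord0 !scale0r addr0.
rewrite (_ : (fun _ => _) = fun x => kreal s 3^-1 *: b 0%N x +
    kreal s 3^-1 *: \sum_(k < n) kreal s (3 ^- k.+1) *: b k.+1 x).
  have h3 : nrm (kreal s 3^-1) + nrm (kreal s 3^-1) <= 1 :> R.
    by rewrite nrm_kreal ger0_norm; lra.
  exact: (aB (Bb 0%N) (IH (fun k => b k.+1) (fun k => Bb k.+1)) h3).
apply/funext => x; rewrite big_ord_recl expr1; congr (_ + _).
by rewrite scaler_sumr; apply: eq_bigr => k _; rewrite scalerA -krealM -invfM -exprS.
Qed.

(** Functionals and vectors exchange roles: [B] is the set of points and the [x i] act by
    evaluation. Compactness provides the sum of the series, as a cluster point of partial sums that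
    lie in [B] by absolute convexity. *)
Lemma compact_disc_bounded (I : Type) (x : I -> X) :
  (forall y, B y -> exists M, forall i, nrm (y (x i)) <= M) ->
  exists M, forall i y, B y -> nrm (y (x i)) <= M.
Proof.
have ev (z : X) : continuous (fun y : {ptws X -> K^o} => y z).
  exact: (@proj_continuous X (fun=> K^o) z).
move=> bB; apply: (@uniform_boundedness I _ B (fun i y => y (x i))) => //.
- by move=> i; exact: weakly_compact_bounded.
- move=> y By; exists (fun x => (-1 : K) *: y x + (0 : K) *: y x).
    by apply: aB => //; rewrite nrm0 addr0 nrmN nrm1.
  by move=> i; rewrite scale0r addr0 scaleN1r.
move=> b Bb; pose t n : {ptws X -> K^o} := fun x => \sum_(k < n) kreal s (3 ^- k.+1) *: b k x.
have Bt n : B (t n) by exact: absolutely_convex_series.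
have [y [By yt]] : B `&` cluster (t @ \oo) !=set0.
  by apply: cB; exists 0%N => // n _; exact: Bt.
exists y => // i n M MP.
(* The exact value of the partial geometric sum makes the induction close; the term [3 ^- m] is
   dropped afterwards. *)
have tail m : (n <= m)%N -> nrm (t m (x i) - t n (x i)) <= M * ((3 ^- n - 3 ^- m) / 2).
  move=> nm; rewrite -(subnKC nm); elim: (m - n)%N => [|k IH].
    by rewrite addn0 !subrr nrm0 mul0r mulr0.
  rewrite addnS {1}/t big_ord_recr /= -/(t _ _) addrAC.
  apply: (le_trans (nrmD _ _)); rewrite (@nrmZ R s K^o) nrm_kreal ger0_norm; last first.
    by rewrite invr_ge0 exprn_ge0.
  have := MP _ (Bb (n + k)%N); set e := (3 ^- (n + k).+1 : R) => h.
  have e0 : 0 <= e by rewrite invr_ge0 exprn_ge0.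
  have := ler_wpM2l e0 h; move: IH; rewrite (_ : 3 ^- (n + k) = 3 * e :> R); last first.
    by rewrite /e exprS invfM mulrA mulfV ?mul1r.
  by lra.
apply/ler_addgt0Pr => e e0.
have tn : (t @ \oo) (t @` [set m | (n <= m)%N]).
  by exists n => // m /= nm; exists m.
have yn : nbhs (y : {ptws X -> K^o}) [set z : {ptws X -> K^o} | nrm (y (x i) - z (x i)) < e].
  exact: ((continuous_nrmP _).1 (ev (x i)) y e e0).
have [_ [[m /= nm <-] ye]] := yt _ _ tn yn.
have := nrm_dist_triangle (y (x i)) (t m (x i)) (t n (x i)).
rewrite /= in ye; have := tail m nm.
have M0 : 0 <= M by exact: le_trans (nrm_ge0 _) (MP _ By).
have : 0 <= M * 3 ^- m by rewrite mulr_ge0// invr_ge0 exprn_ge0.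
move: ye; rewrite -/(t n (x i)).
have -> : M * ((3 ^- n - 3 ^- m) / 2) = M * (3 ^- n / 2) - M * 3 ^- m / 2 by ring.
by move: (M * 3 ^- m) (M * (3 ^- n / 2)) => z z'; lra.
Qed.

End compact_disc.
End uniform_boundedness.

(** * Discrete spaces *)

Section discrete.
Context (R : realType) (s : scalars).
Local Notation K := (scalar_field R s).
Context (Omega : topologicalType) (v : Omega -> {posnum R}).
Context (E : normedModType K).
Hypothesis (v_cont : continuous (fun x => (v x)%:num : R^o)).
Local Notation X := (Cv v E).
Local Notation gamma := (seminorm_topology (compact_seminorms v E)).

Lemma is_seminorm_nrm_id : is_seminorm (fun z : E => nrm z).
Proof. by split=> [z|z t|a z]; [exact: nrm_ge0|exact: nrmD|exact: nrmZ]. Qed.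

Lemma continuous_linear_bounded (e : E -> K^o) : linear e -> continuous e ->
  exists2 C, 0 <= C & forall z, nrm (e z) <= C * nrm z.
Proof.
move=> le ce; have := (continuous_nrmP e).1 ce 0 1 ltr01.
move=> /nbhs_nrmP[r r0 rP]; exists (2 / r); first by rewrite divr_ge0// ltW.
apply: (seminorm_bound is_seminorm_nrm_id (is_seminorm_nrm le) r0) => z zr.
have := rP z; rewrite sub0r nrmN => /(_ zr).
have e0 : e 0 = 0 by have := linear_subr 0 0 le; rewrite !subrr.
by rewrite e0 sub0r nrmN => /ltW.
Qed.

Lemma Cv_set_sub_sigma : Cv_set v E `<=` Cv_sigma v E.
Proof.
move=> f [cf [M fM]] e le ce; split.
  by move=> x; apply: continuous_comp; [exact: cf|exact: ce].
have [C C0 eC] := continuous_linear_bounded le ce; exists (C * M) => x /=.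
apply: (@le_trans _ _ (C * (nrm (f x) * (v x)%:num))); last by rewrite ler_wpM2l.
by rewrite mulrA ler_wpM2r.
Qed.

(** Weakly bounded sets are bounded. Since [E] may be incomplete, uniform boundedness is applied on
    the dual side, to the weakly compact dual unit ball, and the Hahn-Banach theorem recovers the
    norm. *)
Lemma sigma_bounded f : Cv_sigma v E f -> exists M, forall x, nrm (f x) * (v x)%:num <= M.
Proof.
move=> sf; pose B := [set e : E -> K^o | linear e /\ forall z, nrm (e z) <= nrm z].
have cB : weakly_compact B := polar_compact is_seminorm_nrm_id.
have aB : absolutely_convex B by exact: polar_absolutely_convex.
have [|M MP] := @compact_disc_bounded R s E B cB aB Omega (fun x => kreal s (v x)%:num *: f x).
  move=> e [le en]; have ce : continuous e.
    apply/continuous_nrmP => x d d0; apply/nbhs_nrmP; exists d => // y xy.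
    by rewrite -linear_subr//; exact: le_lt_trans (en _) xy.
  have [_ [M MP]] := sf e le ce; exists M => x.
  have [_ _ eZ] := is_seminorm_nrm le.
  by rewrite eZ nrm_kreal ger0_norm// mulrC; exact: MP.
exists M => x; have [e [le en eu]] := hahn_banach (kreal s (v x)%:num *: f x) is_seminorm_nrm_id.
have := MP x e (conj le en); rewrite eu nrmZ nrm_kreal ger0_norm// mulrC; exact.
Qed.

Hypothesis (disc : discrete_space Omega).

Lemma discrete_continuous (T : topologicalType) (f : Omega -> T) : continuous f.
Proof. by apply/continuousP => A _; exact: disc. Qed.

Lemma discrete_Cv_set : Cv_set v E = Cv_sigma v E.
Proof.
apply/seteqP; split; first exact: Cv_set_sub_sigma.
by move=> f sf; split; [exact: discrete_continuous|exact: sigma_bounded].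
Qed.

Lemma discrete_compact (C : set Omega) : compact C <-> finite_set C.
Proof.
split=> [cC|]; last exact: finite_compact.
apply: (compact_induction (P := @finite_set Omega) cC); [exact: finite_set0| | |].
- by move=> A B; exact: sub_finite_set.
- by move=> A B fA fB; rewrite finite_setU.
move=> x _; exists [set x]; first by apply: open_nbhs_nbhs; split => //; exact: disc.
by apply: sub_finite_set (@finite_set1 _ x) => y [].
Qed.

Lemma discrete_tau_N : tau_N v E = tau_co v E.
Proof.
rewrite tau_coE//; congr seminorm_topology; apply/seteqP; split=> p [C cC ->].
  by exists C => //; exact/discrete_compact.
by exists C => //; exact/discrete_compact.
Qed.

(** The envelope [w] of [(C, a)] gives each point a single weight. Its level sets are compact, hence
    finite, so its support is countable and the weights listed along it form a null sequence. *)
Lemma discrete_point_seminorms (x0 : Omega) : hausdorff_space Omega ->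
  gamma = seminorm_topology (point_seminorms v E).
Proof.
move=> hO; apply: topology_ext; apply: coarser_seminorm_le.
  move=> _ [C [a [cC ca ->]]].
  have [w ww aw] := usc_envelope hO cC ca.
  have [w0 wv _] := ww; have [_ _ [M wM]] := usc_vanishing_bounded ww.
  have : countable (\bigcup_n [set x | n.+1%:R^-1 <= w x]).
    apply: bigcup_countable => // n _; apply: finite_set_countable.
    by apply/discrete_compact/wv; rewrite invr_gt0.
  move=> /countable_injP[g ginj].
  have Sw x : 0 < w x -> x \in \bigcup_n [set x | n.+1%:R^-1 <= w x].
    move=> wx; rewrite inE; exists (Num.truncn (w x)^-1) => //=.
    by rewrite invf_ple ?posrE//; exact/ltW/truncnS_gt.
  pose Q n := [set x | 0 < w x /\ g x = n].
  have Q1 n x y : Q n x -> Q n y -> x = y.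
    by move=> [wx gx] [wy gy]; apply: ginj; rewrite ?gx ?gy//; exact: Sw.
  (* Indices that [g] does not take on the support of [w] receive the dummy point [x0] with weight
     0. *)
  pose x_ n := xget x0 (Q n).
  pose b n : R := if `[< Q n (x_ n) >] then w (x_ n) else 0.
  have cb : c0_plus b.
    apply: c0_plusP => [n|e e0]; first by rewrite /b; case: ifP.
    have /discrete_compact/finite_seqP[l lP] := wv _ e0.
    exists (\max_(x <- l) g x).+1 => n ln; rewrite /b.
    case: asboolP => [[wn gn]|_]; last exact: ltW.
    rewrite leNgt; apply/negP => /ltW ew.
    have xl : x_ n \in l by have : [set` l] (x_ n) by rewrite -lP.
    have := @leq_bigmax_seq _ l xpredT g _ xl isT; rewrite gn => nl.
    by move: (leq_trans ln nl); rewrite ltnn.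
  exists (fun f => sup [set wval f (x_ n) * b n | n in [set: nat]]); first by exists x_, b.
  move=> f; have [A A0 AP] := c0_plus_bounded cb.
  have ub r : [set wval f (x_ n) * b n | n in [set: nat]] r -> r <= Cv_norm v E f * A.
    move=> [n _ <-]; apply: ler_pM => //; [exact: wval_ge0|exact: cb.1|exact: wval_le_norm].
  have s0 : 0 <= sup [set wval f (x_ n) * b n | n in [set: nat]].
    by apply: sup_ge0 ub _ => _ [n _ <-]; rewrite mulr_ge0 ?wval_ge0//; exact: cb.1.
  apply: seq_seminorm_le => // n x Cx; have := w0 x; rewrite le_eqVlt => /predU1P[wx|wx].
    have -> : a n = 0 by apply/eqP; rewrite eq_le ca.1 wx aw.
    by rewrite mulr0.
  have Qx : Q (g x) (x_ (g x)) by rewrite /x_; apply: xgetPex; exists x.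
  have xE : x_ (g x) = x by apply: (Q1 (g x)).
  apply: (@le_trans _ _ (wval f (x_ (g x)) * b (g x))).
    by rewrite /b asboolT// xE ler_wpM2l ?wval_ge0// aw.
  by apply: le_sup_of ub _; exists (g x).
move=> _ [x_ [a [ca ->]]]; exists (seq_seminorm (fun n => [set x_ n]) a).
  by exists (fun n => [set x_ n]), a; split => // n; exact: compact_set1.
move=> f; apply: sup_le_ub0; first exact: seq_seminorm_ge0.
by move=> _ [n _ <-]; exact: seq_seminorm_ge.
Qed.

End discrete.

(** * Mackey spaces *)

Section duality.
Context (R : realType) (s : scalars).
Local Notation K := (scalar_field R s).
Context (Omega : topologicalType) (v : Omega -> {posnum R}).
Context (E : normedModType K).
Hypothesis (v_cont : continuous (fun x => (v x)%:num : R^o)).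
Local Notation X := (Cv v E).
Local Notation N := (Cv_norm v E).
Local Notation gamma := (seminorm_topology (compact_seminorms v E)).
Local Notation Y := (top_dual gamma).

Let sP := @compact_seminorms_seminorm R s Omega v E.
Let dP := @compact_seminorms_directed R s Omega v E.

Lemma dual_linear y : Y y -> linear y.
Proof. by case. Qed.

Lemma dual_bound y : Y y ->
  exists2 p, compact_seminorms v E p & exists2 C, 0 < C & forall f, nrm (y f) <= C * p f.
Proof. by move=> [ly cy]; exact/(continuous_functionalP sP dP ly). Qed.

Lemma dual_norm_bound y : Y y -> exists2 M, 0 < M & forall f, nrm (y f) <= M * N f.
Proof.
move=> /dual_bound[p Pp [C C0 yp]]; have [A A0 pA] := compact_seminorms_le_norm Pp.
exists (C * A) => [|f]; first by rewrite mulr_gt0.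
by apply: (le_trans (yp f)); rewrite -mulrA ler_pM2l.
Qed.

Lemma dual_tight y (M e : R) : Y y -> 0 < e -> exists2 C, compact C &
  forall h : X, N h <= M -> (forall x, C x -> h x = 0) -> nrm (y h) <= e.
Proof.
move=> /dual_bound[p Pp [A A0 yp]] e0; have eA : 0 < e / A by rewrite divr_gt0.
have [C cC [d d0 Cd]] := compact_seminorms_bounded M Pp eA.
exists C => // h hM hC; apply: (le_trans (yp h)); rewrite mulrC -ler_pdivlMr//.
apply: Cd => //; apply: le_lt_trans d0; apply: sup_on_le => // x Cx.
by rewrite /wval hC// nrm0 mul0r.
Qed.

Lemma coarser_gamma_mackey : coarser gamma (mackey_topology Y).
Proof.
apply: coarser_seminorm_le => p Pp; have sp := sP Pp.
pose B := [set y : X -> K^o | linear y /\ forall f, nrm (y f) <= p f].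
exists (fun f => sup [set nrm (y f) | y in B]).
  exists B; split => //; [|exact: polar_absolutely_convex|exact: polar_compact].
  move=> y [ly yp]; split => //; apply/(continuous_functionalP sP dP ly).
  by exists p => //; exists 1 => // f; rewrite mul1r.
move=> f; have [y [ly yp yf]] := hahn_banach f sp.
by rewrite -yf; apply: (@le_sup_of _ _ (p f)); [move=> _ [z [_ zp] <-]|exists y].
Qed.

Definition uniformly_bounded (B : set (X -> K^o)) : Prop :=
  exists M, forall y f, B y -> N f <= 1 -> nrm (y f) <= M.

(** Tightness of a family of measures, expressed through test functions that vanish on [C]. *)
Definition uniformly_tight (B : set (X -> K^o)) : Prop :=
  forall e, 0 < e -> exists2 C, compact C & forall y (f : X), B y -> N f <= 1 ->
    (forall x, C x -> f x = 0) -> nrm (y f) <= e.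

Lemma unit_ball_bound (y : X -> K^o) M : linear y ->
  (forall f, N f <= 1 -> nrm (y f) <= M) -> forall f, nrm (y f) <= M * N f.
Proof.
move=> ly yM f; have [_ _ NZ] := @seminorm_norm R s Omega v E.
have [_ _ yZ] := is_seminorm_nrm ly.
have [f0|f0] := eqVneq (N f) 0.
  have -> : f = 0 by apply: (@norm_norm R s Omega v E).2.
  by rewrite (seminorm0 (is_seminorm_nrm ly)) (seminorm0 (@seminorm_norm R s Omega v E)) mulr0.
have fp : 0 < N f by rewrite lt_neqAle eq_sym f0 Cv_norm_ge0.
have fi : 0 <= (N f)^-1 by rewrite invr_ge0 ltW.
have := yM (kreal s (N f)^-1 *: f); rewrite NZ yZ !nrm_kreal !ger0_norm// mulVf// => /(_ (lexx 1)).
by rewrite ler_pdivrMl// mulrC.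
Qed.

Lemma wval_sub_trunc t (f : X) x : 0 <= t -> wval (f - trunc t f) x <= wval f x.
Proof.
move=> t0; have /andP[c0 c1] : 0 <= trunc_coef t f x <= 1.
  have := trunc_coef_bound f t0 x; rewrite ger0_norm; last by rewrite divr_ge0// le_max t0.
  by move=> ->; rewrite divr_ge0// le_max t0.
rewrite {1}/wval Cv_funD Cv_funN truncE//.
rewrite -{1}[f x]scale1r -(kreal1 R s) -scalerBl -krealB nrmZ nrm_kreal.
rewrite ger0_norm ?subr_ge0// -mulrA ler_piMl//; first exact: wval_ge0.
by rewrite gerBl.
Qed.

Lemma norm_sub_trunc t (f : X) : 0 <= t -> N (f - trunc t f) <= N f.
Proof.
move=> t0; apply: Cv_norm_le; first exact: Cv_norm_ge0.
by move=> x; apply: (le_trans (wval_sub_trunc f x t0)); exact: wval_le_norm.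
Qed.

Lemma sub_trunc_eq0 t (f : X) x : 0 <= t -> wval f x <= t -> (f - trunc t f) x = 0.
Proof. by move=> t0 ft; rewrite Cv_funD Cv_funN trunc_id// subrr. Qed.

Lemma equicontinuous_bound B : B `<=` Y -> uniformly_bounded B -> uniformly_tight B ->
  exists2 p, compact_seminorms v E p & forall y f, B y -> nrm (y f) <= 2 * p f.
Proof.
move=> BY [M0 BM0] tB.
have [M Mp BM] : exists2 M, 0 < M & forall y f, B y -> nrm (y f) <= M * N f.
  exists (Num.max M0 1); first by rewrite lt_max ltr01 orbT.
  move=> y f By; apply: unit_ball_bound => [|g g1]; first exact: (dual_linear (BY _ By)).
  by rewrite le_max (BM0 _ _ By g1).
have /choice[C CP] n : exists C, compact C /\ forall y (f : X), B y -> N f <= 1 ->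
    (forall x, C x -> f x = 0) -> nrm (y f) <= 2 ^- n.+2.
  by have [|C cC CP] := tB (2 ^- n.+2); [rewrite invr_gt0 exprn_gt0|exists C].
(* Budget: layer 0 costs [1 / 4] by tightness and [1 / 4] through [M], and the layers [i >= 1] cost
   [2 ^- i.+2] each, in all less than [3 / 4]. *)
have e0 : 0 < (4 * M)^-1 by rewrite invr_gt0 mulr_gt0.
have [p Pp pP] := layer_decomposition E v_cont (fun n => (CP n).1) e0.
exists p => // y f By; have ly := dual_linear (BY _ By).
have sy := is_seminorm_nrm ly; move: f; rewrite -[2]divr1.
apply: (seminorm_bound (sP Pp) sy ltr01) => f /pP[f0 fS].
have [m hm] : exists m : nat, N f <= m%:R.
  by exists (Num.truncn (N f)).+1; exact/ltW/truncnS_gt.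
rewrite (sum_layer v_cont hm); apply: (le_trans (seminorm_sum (fun i => layer i f) m sy)).
pose c i : R := if i is 0%N then 1 / 2 else 2 ^- i.+2.
apply: (@le_trans _ _ (\sum_(i < m) c i)).
  apply: ler_sum => -[[|i] im] _ /=; last first.
    by apply: (CP i.+1).2 => //; [exact: layer_norm|exact: fS].
  set g := layer 0 f; have t0 := ltW e0.
  (* Layer 0 is small on [C 0] but need not vanish there; subtracting its truncation at that small
     level makes tightness applicable. *)
  rewrite -[g](subrK (trunc (4 * M)^-1 g)); have [_ yD _] := sy.
  apply: (le_trans (yD _ _)); rewrite (_ : 1 / 2 = 2 ^- 2 + 4^-1); last by lra.
  apply: lerD.
    apply: (CP 0%N).2 => //.
      by apply: (le_trans (norm_sub_trunc _ t0)); exact: layer_norm.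
    by move=> x Cx; apply: sub_trunc_eq0 => //; exact: f0.
  apply: (le_trans (BM _ _ By)); apply: (@le_trans _ _ (M * (4 * M)^-1)).
    by rewrite ler_pM2l// trunc_norm.
  by rewrite invfM mulrCA mulfV ?gt_eqF// mulr1.
have aux (z : R) : 3 / 4 - 2^-1 * (2^-1 * z) + 2^-1 * (2^-1 * (2^-1 * z)) =
    3 / 4 - 2^-1 * (2^-1 * (2^-1 * z)) by lra.
have cs k : \sum_(i < k.+1) c i = 3 / 4 - 2 ^- k.+2.
  elim: k => [|k IH]; first by rewrite big_ord_recr big_ord0 /= add0r /c; lra.
  by rewrite big_ord_recr /= IH /c /= !exprS !invfM; exact: aux.
case: m hm => [|k] _; first by rewrite big_ord0.
rewrite cs; have : 0 <= 2 ^- k.+2 :> R by rewrite invr_ge0 exprn_ge0.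
by lra.
Qed.

Lemma disc_uniformly_bounded B : B `<=` Y -> absolutely_convex B -> weakly_compact B ->
  uniformly_bounded B.
Proof.
move=> BY aB cB.
have [|M MP] := @compact_disc_bounded R s X B cB aB {f : X | N f <= 1} (fun f => sval f).
  move=> y By; have [M M0 yM] := dual_norm_bound (BY _ By); exists M => -[f f1] /=.
  by apply: (le_trans (yM f)); rewrite ler_piMr// ltW.
by exists M => y f By f1; exact: (MP (exist _ f f1)).
Qed.

Lemma pow3_small (e : R) : 0 < e -> exists n, 3 ^- n < e.
Proof.
move=> e0; exists (Num.truncn e^-1).+1; rewrite invf_plt ?posrE ?exprn_gt0//.
apply: (lt_trans (truncnS_gt _)); rewrite -natrX ltr_nat.
exact: ltn_expl.
Qed.

(** The series hypothesis of [uniform_boundedness] for the unit ball. The estimates are weighted, so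
    continuity of the sum uses that [v] exceeds [v x / 2] near [x]: the convergence is locally
    uniform. *)
Lemma banach_series (b : nat -> X) : banach E -> (forall n, N (b n) <= 1) ->
  exists f : X, forall n,
    N (f - \sum_(k < n) kreal s (3 ^- k.+1) *: b k) <= 3 ^- n / 2.
Proof.
move=> banE b1; pose t n : X := \sum_(k < n) kreal s (3 ^- k.+1) *: b k.
have tail m n x : (n <= m)%N -> wval (t m - t n) x <= (3 ^- n - 3 ^- m) / 2.
  move=> nm; rewrite -(subnKC nm); elim: (m - n)%N => [|k IH].
    by rewrite addn0 !subrr mul0r wval0.
  rewrite addnS {1}/t big_ord_recr /= -/(t _) addrAC.
  apply: (le_trans (wvalD _ _ _)); rewrite wvalZ nrm_kreal ger0_norm; last first.
    by rewrite invr_ge0 exprn_ge0.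
  have := le_trans (wval_le_norm (b (n + k)%N) x) (b1 _).
  set e := (3 ^- (n + k).+1 : R) => h.
  have e0 : 0 <= e by rewrite invr_ge0 exprn_ge0.
  have := ler_wpM2l e0 h; move: IH; rewrite (_ : 3 ^- (n + k) = 3 * e :> R); last first.
    by rewrite /e exprS invfM mulrA mulfV ?mul1r.
  by lra.
have tail' m n x : (n <= m)%N -> nrm (t m x - t n x) * (v x)%:num <= 3 ^- n / 2.
  move=> nm; have := tail m n x nm; have : 0 <= 3 ^- m :> R by rewrite invr_ge0 exprn_ge0.
  by rewrite /wval Cv_funD Cv_funN; move: (_ * _%:num) => z; lra.
have /choice[h hP] x : exists u : E, forall n, nrm (u - t n x) * (v x)%:num <= 3 ^- n / 2.
  have : cauchy ((fun n => t n x) @ \oo).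
    move=> A /entourage_nrmP[e e0 eA].
    have [n en] := pow3_small (mulr_gt0 e0 [gt0 of (v x)%:num]).
    have tn : ((fun n => t n x) @ \oo) [set t m x | m in [set m | (n <= m)%N]].
      by exists n => // m /= nm; exists m.
    exists ([set t m x | m in [set m | (n <= m)%N]], [set t m x | m in [set m | (n <= m)%N]]).
      by split.
    move=> [_ _] [/= [m nm <-] [m' nm' <-]]; apply: eA.
    rewrite -(ltr_pM2r [gt0 of (v x)%:num]); apply: le_lt_trans en.
    have h1 := tail' m n x nm; have h2 := tail' m' n x nm'.
    have := nrm_dist_triangle (t m x) (t n x) (t m' x); rewrite (nrmB (t n x)) => h3.
    have := ler_wpM2r (ltW [gt0 of (v x)%:num]) h3; rewrite mulrDl; lra.
  move=> /banE cvgt; set u := lim _ in cvgt; exists u => n.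
  apply/ler_addgt0Pr => e e0.
  have ev : 0 < e / (v x)%:num by rewrite divr_gt0.
  have [m0 _ m0P] := (cvg_nrmP _ _ _).1 cvgt _ ev.
  pose m := maxn m0 n; have nm : (n <= m)%N by rewrite leq_maxr.
  have h1 := m0P m (leq_maxl _ _); rewrite /= ltr_pdivlMr// in h1.
  have h2 := tail' m n x nm; have h3 := nrm_dist_triangle u (t m x) (t n x).
  by have := ler_wpM2r (ltW [gt0 of (v x)%:num]) h3; rewrite mulrDl; lra.
have ch : continuous h.
  apply/continuous_nrmP => x e e0; have v0 := [gt0 of (v x)%:num].
  have ev0 : 0 < e / 3 * (v x)%:num by rewrite mulr_gt0// divr_gt0.
  have [n en] := pow3_small ev0.
  have near_v : \forall y \near x, (v x)%:num / 2 < (v y)%:num.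
    have := @v_cont x; move/cvgrPdist_lt => /(_ ((v x)%:num / 2)).
    move=> /(_ (ltac:(by rewrite divr_gt0))); apply: filterS => y.
    by rewrite ltr_norml => /andP[_]; lra.
  have e30 : 0 < e / 3 by rewrite divr_gt0.
  have near_t := (continuous_nrmP _).1 (@Cv_continuous _ _ _ _ _ (t n)) x _ e30.
  have ht z : (v x)%:num / 2 < (v z)%:num -> nrm (h z - t n z) < e / 3.
    move=> vz; have h1 := hP z n; rewrite -(ltr_pM2r v0).
    apply: le_lt_trans en; have := ler_wpM2l (nrm_ge0 (h z - t n z)) (ltW vz).
    by move: h1; move: (nrm _) (3 ^- n : R) => a c; lra.
  apply: filterS (filterI near_v near_t) => y [vy ty].
  have t1 := nrm_dist_triangle (h x) (t n x) (h y).
  have t2 := nrm_dist_triangle (t n x) (t n y) (h y).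
  have h1 : nrm (h x - t n x) < e / 3 by apply: ht; lra.
  by have := ht y vy; rewrite nrmB; lra.
have [|f fh] := @Cv_exists R s Omega v E h (3 ^- 0 / 2) ch.
  by move=> x; have := hP x 0%N; rewrite /t big_ord0 Cv_fun0 subr0.
exists f => n; apply: Cv_norm_le; first by rewrite divr_ge0// invr_ge0 exprn_ge0.
by move=> x; rewrite /wval Cv_funD Cv_funN fh; exact: hP.
Qed.

(** Compared with [compact_disc_bounded] the roles are switched: [B] is the index set, and the
    points are those of the unit ball. *)
Lemma banach_uniformly_bounded B : banach E -> B `<=` Y -> weakly_compact B ->
  uniformly_bounded B.
Proof.
move=> banE BY cB.
have [||||M MP] := @uniform_boundedness R s {y | B y} X [set f | N f <= 1] (fun y f => sval y f).
- move=> f _; have [M MP] := weakly_compact_bounded f cB; exists M => -[y By] /=; exact: MP.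
- move=> [y By] /=; have [M M0 yM] := dual_norm_bound (BY _ By); exists M => f f1.
  by apply: (le_trans (yM f)); rewrite ler_piMr// ltW.
- move=> f /= f1; exists (- f).
    by rewrite /= (seminormN _ (@seminorm_norm R s Omega v E)).
  move=> [y By] /=; have ly := dual_linear (BY _ By).
  have := linear_subr 0 f ly; rewrite !sub0r => ->.
  by have := linear_subr 0 0 ly; rewrite !subrr => ->; rewrite sub0r.
- move=> b b1; have [f fP] := banach_series banE b1; exists f.
    have := fP 0%N; rewrite big_ord0 subr0 /=; lra.
  move=> [y By] n M /= yM; have ly := dual_linear (BY _ By).
  have -> : \sum_(k < n) kreal s (3 ^- k.+1) *: y (b k) =
      y (\sum_(k < n) kreal s (3 ^- k.+1) *: b k).
    elim: n => [|n IH]; first by rewrite !big_ord0; have := linear_subr 0 0 ly; rewrite !subrr.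
    by rewrite !big_ord_recr /= IH [in RHS]addrC ly addrC.
  rewrite -linear_subr//; apply: (le_trans (unit_ball_bound ly yM _)).
  by apply: ler_wpM2l (fP n); apply: le_trans (yM (b 0%N) (b1 _)); exact: nrm_ge0.
by exists M => y f By f1; exact: (MP (exist _ y By)).
Qed.

(** The two conclusions differ only in the source of the norm bound: absolute convexity of [B], or
    completeness of [E]. *)
Lemma gamma_strong_mackey : (forall B, B `<=` Y -> weakly_compact B -> uniformly_tight B) ->
  mackey_space gamma /\ (banach E -> strong_mackey_space gamma).
Proof.
move=> tight; have mackey : mackey_space gamma.
  apply: topology_ext; first exact: coarser_gamma_mackey.
  apply: coarser_seminorm => // _ [B [BY aB cB ->]].
  have [p Pp Bp] := equicontinuous_bound BY (disc_uniformly_bounded BY aB cB) (tight _ BY cB).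
  exists p => //; exists 2 => // f; have [p0 _ _] := sP Pp.
  by apply: sup_le_ub0; [rewrite mulr_ge0|move=> _ [y By <-]; exact: Bp].
split => // banE; split => // B BY cB f U /entourage_nrmP[e e0 eU].
have [p Pp Bp] := equicontinuous_bound BY (banach_uniformly_bounded banE BY cB) (tight _ BY cB).
apply/(nbhs_seminormP _ _ sP dP); exists p => //; exists (e / 2); first by rewrite divr_gt0.
move=> g gf y By; apply: eU; rewrite -linear_subr; last exact: (dual_linear (BY _ By)).
apply: (le_lt_trans (Bp _ _ By)); rewrite (seminormB _ _ (sP Pp)).
by move: gf; lra.
Qed.

End duality.

(** * Tightness of weakly compact sets *)

Section gliding_hump.
Context (R : realType) (s : scalars).
Local Notation K := (scalar_field R s).
Context (Omega : topologicalType) (v : Omega -> {posnum R}).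
Context (E : normedModType K).
Hypothesis (v_cont : continuous (fun x => (v x)%:num : R^o)).
Local Notation X := (Cv v E).
Local Notation N := (Cv_norm v E).
Local Notation gamma := (seminorm_topology (compact_seminorms v E)).
Local Notation Y := (top_dual gamma).

Let X0 : X := 0.

(** Two instances are used: [id], the constant 1 and a compact exhaustion for hemicompact
    k_R-spaces; [thickening r], [metric_bump (r / 4)] and empty sets for metric spaces. *)
Context (collar : set Omega -> set Omega) (bump : set Omega -> Omega -> R)
  (exhaustion : nat -> set Omega).
Hypotheses (collar_sub : forall A, A `<=` collar A)
  (collar_mono : forall A B, A `<=` B -> collar A `<=` collar B)
  (bump_cont : forall A, continuous (bump A))
  (bump01 : forall A x, 0 <= bump A x <= 1)
  (bump1 : forall A x, A x -> bump A x = 1)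
  (bump_mono : forall A B x, A `<=` B -> bump B x = 0 -> bump A x = 0)
  (exhaustion_compact : forall n, compact (exhaustion n)).

(* With open collars the limit is continuous because [g] is locally eventually
   constant; on a hemicompact [kR]-space the sets [exhaustion n] make [g]
   eventually constant on every compact set. *)
Definition stable_limits : Prop := forall (C : nat -> set Omega) (g : nat -> X),
  (forall n, compact (C n)) -> (forall n, C n `<=` C n.+1) ->
  (forall n, exhaustion n `<=` C n.+1) -> (forall n, N (g n) <= 1) ->
  (forall n x, collar (C n) x -> g n.+1 x = g n x) ->
  (forall n x, bump (C n) x = 0 -> g n x = 0) ->
  exists2 h : X, N h <= 1 & forall L, compact L ->
    exists n0, forall n x, (n0 <= n)%N -> L x -> h x = g n x.

(* The factor [1 - wval f] makes room for [f]: both [u + z] and [u - z] stay in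
   the unit ball. *)
Lemma hump_step (C C' : set Omega) (f g : X) :
  C `<=` C' -> N f <= 1 -> (forall x, collar C x -> f x = 0) ->
  N g <= 1 -> (forall x, bump C x = 0 -> g x = 0) ->
  exists u z : X, [/\ forall x, collar C x -> z x = 0 /\ u x = g x,
    forall x, bump C' x = 0 -> u x = 0 /\ z x = 0,
    forall x, wval u x + wval z x <= 1, N (f - z) <= 1 &
    forall x, C' x -> (f - z) x = 0].
Proof.
move=> CC' f1 fC g1 gC.
have f01 x : 0 <= wval f x <= 1 by rewrite wval_ge0 (le_trans (wval_le_norm f x)).
have c1 : continuous (fun x => 1 - wval f x).
  by move=> x; apply: cvgB; [exact: cvg_cst|exact: continuous_wval].
have b1 x : `|1 - wval f x| <= 1.
  by have /andP[h0 h1] := f01 x; rewrite ger0_norm ?subr_ge0// gerBl.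
have b2 x : `|bump C' x| <= 1 by have /andP[h0 h1] := bump01 C' x; rewrite ger0_norm.
(* [z] agrees with [f] on [C'], so a functional that is tight on [C'] hardly distinguishes them,
   while the factor [bump C'] confines the new sum. *)
exists (Cv_scale (fun x => 1 - wval f x) g), (Cv_scale (bump C') f).
have uE := Cv_scaleE g c1 b1; have zE := Cv_scaleE f (@bump_cont C') b2.
have fzE x : (f - Cv_scale (bump C') f) x = kreal s (1 - bump C' x) *: f x.
  by rewrite Cv_funD Cv_funN zE krealB kreal1 scalerBl scale1r.
split.
- move=> x /fC fx; rewrite zE uE fx scaler0; split => //.
  by rewrite /wval fx nrm0 mul0r subr0 kreal1 scale1r.
- move=> x bx; rewrite uE zE bx kreal0 scale0r; split => //.
  by rewrite gC ?scaler0//; exact: bump_mono bx.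
- move=> x; rewrite (wval_Cv_scale g x c1 b1) (wval_Cv_scale f x (@bump_cont C') b2).
  have /andP[h0 h1] := f01 x; have /andP[h2 h3] := bump01 C' x.
  rewrite !ger0_norm ?subr_ge0//.
  have g01 := le_trans (wval_le_norm g x) g1.
  have : (1 - wval f x) * wval g x <= 1 - wval f x by rewrite ler_piMr// subr_ge0.
  have : bump C' x * wval f x <= wval f x by rewrite ler_piMl.
  by move: (_ * wval g x) (_ * wval f x) => p q; lra.
- apply: Cv_norm_le => // x; rewrite /wval fzE nrmZ nrm_kreal -mulrA.
  have /andP[h0 h1] := f01 x; have /andP[h2 h3] := bump01 C' x.
  rewrite ger0_norm ?subr_ge0//; apply: le_trans h1; rewrite ler_piMl//.
  by rewrite gerBl.
- by move=> x C'x; rewrite fzE bump1// subrr kreal0 scale0r.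
Qed.

Lemma near_ptws (y : {ptws X -> K^o}) (l : seq X) (d : R) : 0 < d ->
  \forall z \near y, forall j, (j < size l)%N ->
    nrm (y (nth X0 l j) - z (nth X0 l j)) < d.
Proof.
move=> d0; elim: l => [|h l IH].
  by apply: (@filterS _ (nbhs y) _ setT) (@filterT _ (nbhs y) _) => z _ j.
have ev : continuous (fun z : {ptws X -> K^o} => z h).
  exact: (@proj_continuous X (fun=> K^o) h).
have hd : nbhs y [set z : {ptws X -> K^o} | nrm (y h - z h) < d].
  exact: (continuous_nrmP _).1 ev y d d0.
apply: (@filterS _ (nbhs y) _ _ _ _ (@filterI _ (nbhs y) _ _ _ IH hd)).
by move=> z [zl zh] [|j] //= jl; exact: zl.
Qed.

Lemma gliding_hump (B : set (X -> K^o)) : stable_limits -> B `<=` Y -> weakly_compact B ->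
  forall e, 0 < e -> exists2 C, compact C & forall y (f : X), B y -> N f <= 1 ->
    (forall x, collar C x -> f x = 0) -> nrm (y f) <= e.
Proof.
move=> limP BY cB e e0; apply: contrapT => noC.
have /choice[yf yfP] A : exists yf : (X -> K^o) * X, compact A ->
    [/\ B yf.1, N yf.2 <= 1, forall x, collar A x -> yf.2 x = 0 & e < nrm (yf.1 yf.2)].
  have [cA|ncA] := pselect (compact A); last by exists (fun=> 0, 0).
  apply: contrapT => /forallNP h; apply: noC; exists A => // y f By f1 fA.
  by rewrite leNgt; apply/negP => ef; apply: (h (y, f)).
pose yy A : {ptws X -> K^o} := (yf A).1; pose ff A : X := (yf A).2.
(* The filter of statements true of all large compact sets: [yi] is a cluster point of the bad
   functionals along the directed family of all compact sets. *)
pose F : set_system (set Omega) := [set P | exists2 A, compact A &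
  forall C, compact C -> A `<=` C -> P C].
have FF : ProperFilter F.
  split; first by move=> [A cA /(_ A cA (@subset_refl _ A))].
  split; first by exists set0 => //; exact: compact0.
    move=> P Q [A cA AP] [A' cA' AQ]; exists (A `|` A'); first exact: compactU.
    move=> C cC AC; split; [apply: AP => // x Ax|apply: AQ => // x Ax].
      by apply: AC; left.
    by apply: AC; right.
  by move=> P Q PQ [A cA AP]; exists A => // C cC /(AP _ cC) /PQ.
have [yi [Byi yiF]] : B `&` cluster (yy @ F) !=set0.
  apply: cB; exists set0; first exact: compact0.
  by move=> C cC _; have [] := yfP C cC.
(* Eight errors of size [d] accumulate in the final estimate: three in [far] and five in the
   comparison of [y n.+1 h] with [yi h]. *)
pose d := e / 10; have d0 : 0 < d by rewrite divr_gt0.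
have pick_close (l : seq X) A : compact A -> exists C, [/\ compact C, A `<=` C &
    forall j, (j < size l)%N -> nrm (yi (nth X0 l j) - yy C (nth X0 l j)) < d].
  move=> cA; have FA : (yy @ F) [set yy C | C in [set C | compact C /\ A `<=` C]].
    by exists A => // C cC AC; exists C.
  have [_ [[C [cC AC] <-] Cl]] := yiF _ _ FA (near_ptws yi l d0).
  by exists C.
pose T := (set Omega * X)%type; pose t0 : T := (set0, 0).
pose inv (t : T) := [/\ compact t.1, N t.2 <= 1 & forall x, bump t.1 x = 0 -> t.2 x = 0].
(* In the last clause the sign in front of the hump is chosen so that [yy t.1]
   at the new function is far from [yi] at the old one; as both functionals are
   tight, the limit function separates [yi] from all the [yy t.1], although it
   does not separate [yi] from a cluster point of these. *)
pose step n (l : seq X) (t t' : T) :=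
  [/\ inv t', t.1 `<=` t'.1, exhaustion n `<=` t'.1,
    forall x, collar t.1 x -> t'.2 x = t.2 x &
  [/\ forall h : X, N h <= 2 -> (forall x, t'.1 x -> h x = 0) -> nrm (yy t.1 h) <= d,
    forall h : X, N h <= 2 -> (forall x, t'.1 x -> h x = 0) -> nrm (yi h) <= d,
    forall j, (j < size l)%N -> nrm (yi (nth X0 l j) - yy t'.1 (nth X0 l j)) < d &
    e - d <= nrm (yy t.1 t'.2 - yi t.2)]].
have stepP n l t : inv t -> exists t', step n l t t'.
  case: t => A g [/= cA g1 gA]; have [By f1 fA ef] := yfP A cA.
  have [L1 cL1 L1P] := dual_tight 2 (BY _ By) d0.
  have [L2 cL2 L2P] := dual_tight 2 (BY _ Byi) d0.
  have [C [cC AC Cl]] := pick_close l _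
    (compactU (compactU cA (@exhaustion_compact n)) (compactU cL1 cL2)).
  have AC1 : A `<=` C by move=> x Ax; apply: AC; left; left.
  have [u [z [zu0 uz0 uz1 fz1 fz0]]] := hump_step AC1 f1 fA g1 gA.
  have ly := dual_linear (BY _ By).
  have yz : e - d <= nrm (yy A z).
    have : nrm (yy A (ff A - z)) <= d.
      apply: L1P; first by apply: (le_trans fz1); rewrite ler1n.
      by move=> x L1x; apply: fz0; apply: AC; right; left.
    have := nrm_dist_triangle (yy A (ff A)) (yy A z) 0; rewrite !subr0 -linear_subr//.
    by move: ef; rewrite -/(yy A) -/(ff A); lra.
  have common (t : T) : t = (C, u + z) \/ t = (C, u - z) ->
      e - d <= nrm (yy A t.2 - yi g) -> step n l (A, g) t.
    move=> tE yt; have t1 : t.1 = C by case: tE => ->.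
    have t2 x : t.2 x = u x + z x \/ t.2 x = u x - z x by case: tE => ->; [left|right].
    split; rewrite ?t1 //.
    - split; rewrite ?t1 //.
        apply: Cv_norm_le => // x; apply: le_trans (uz1 x).
        by case: tE => ->; rewrite (le_trans (wvalD _ _ _))// wvalN.
      move=> x /uz0[u0 z0]; have := t2 x; rewrite u0 z0 subr0 addr0.
      by case.
    - by move=> x nx; apply: AC; left; right.
    - move=> x /zu0[z0 ug]; have := t2 x; rewrite z0 ug subr0 addr0.
      by case.
    split => //.
      by move=> h h2 hC; apply: L1P => // x Lx; apply: hC; apply: AC; right; left.
    by move=> h h2 hC; apply: L2P => // x Lx; apply: hC; apply: AC; right; right.
  have [h|h] := nrm_max_pm (yy A u - yi g) (yy A z).
    exists (C, u + z); apply: common; first by left.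
    apply: (le_trans yz); apply: (le_trans h) => /=.
    have -> : yy A (u + z) = yy A u + yy A z by have := ly 1 u z; rewrite !scale1r.
    by rewrite addrAC.
  exists (C, u - z); apply: common; first by right.
  apply: (le_trans yz); apply: (le_trans h) => /=.
  have -> : yy A (u - z) = yy A u - yy A z by exact: linear_subr.
  by rewrite addrAC.
have [|b bP] := @dependent_sequence T (fun l t => inv (last t0 l) ->
    step (size l) [seq u.2 | u <- t0 :: l] (last t0 l) t).
  move=> l; have [il|nil] := pselect (inv (last t0 l)); last by exists t0.
  by have [t tP] := stepP (size l) [seq u.2 | u <- t0 :: l] _ il; exists t.
pose st n : T := if n is n'.+1 then b n' else t0.
have lastE n : last t0 (mkseq b n) = st n by case: n => // n; rewrite mkseqS last_rcons.
have inv0 : inv t0.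
  split; [exact: compact0| |by []].
  by rewrite (seminorm0 (@seminorm_norm R s Omega v E)).
have inv_st n : inv (st n).
  elim: n => // n IH; have := bP n; rewrite lastE => /(_ IH).
  by case.
have stS n : step n [seq u.2 | u <- t0 :: mkseq b n] (st n) (st n.+1).
  by have := bP n (ltac:(by rewrite lastE)); rewrite size_mkseq lastE.
have nthE n j : (j <= n)%N -> nth X0 [seq u.2 | u <- t0 :: mkseq b n] j = (st j).2.
  move=> jn; rewrite (nth_map t0) /= ?size_mkseq//.
  by case: j jn => //= j jn; rewrite nth_mkseq.
pose C n := (st n).1; pose g n := (st n).2; pose y n := yy (C n).
have cC n : compact (C n) by have [] := inv_st n.
have g1 n : N (g n) <= 1 by have [] := inv_st n.
have Cinc n : C n `<=` C n.+1 by have [] := stS n.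
have gS n x : collar (C n) x -> g n.+1 x = g n x by have [_ _ _ h _] := stS n; exact: h.
have By n : B (y n) by have [] := yfP _ (cC n).
have [||||||h h1 hL] := limP C g => //.
- by move=> n; have [] := stS n.
- by move=> n x; have [_ _ gn] := inv_st n; exact: gn.
have g_stable m n x : (m <= n)%N -> collar (C m) x -> g n x = g m x.
  move=> mn Cx; rewrite -(subnKC mn); elim: (n - m)%N => [|k IH]; first by rewrite addn0.
  rewrite addnS gS//; apply: collar_mono Cx; elim: k {IH} => [|k IH]; first by rewrite addn0.
  by rewrite addnS => x' /IH; exact: Cinc.
have hg m x : C m x -> h x = g m x.
  move=> Cx; have [n0 n0P] := hL _ (@compact_set1 _ x).
  rewrite (n0P (maxn n0 m) x) ?leq_maxl//; apply: g_stable; first exact: leq_maxr.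
  exact: collar_sub.
have hg0 m x : C m x -> (h - g m) x = 0 by move=> Cx; rewrite Cv_funD Cv_funN (hg m)// subrr.
have hg2 m : N (h - g m) <= 2.
  have [_ ND _] := @seminorm_norm R s Omega v E; apply: (le_trans (ND _ _)).
  by rewrite (seminormN _ (@seminorm_norm R s Omega v E)) -[2]/(1 + 1) lerD.
have lyi := dual_linear (BY _ Byi).
(* Step [m] puts the compact set on which [yi] is tight into [C m.+1], hence the shifted index. *)
have yi_close m : nrm (yi h - yi (g m.+1)) <= d.
  rewrite -linear_subr//; have [_ _ _ _ [_ h2 _ _]] := stS m.
  by apply: h2 => // x; exact: hg0.
have far n : e - 3 * d <= nrm (y n.+1 h - yi h).
  have [_ _ _ _ [hy _ _ hd]] := stS n.+1.
  have h2 : nrm (y n.+1 h - y n.+1 (g n.+2)) <= d.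
    rewrite -linear_subr; last exact: (dual_linear (BY _ (By _))).
    by apply: hy => // x; exact: hg0.
  have h3 := yi_close n.
  have h4 : e - d <= nrm (y n.+1 (g n.+2) - yi (g n.+1)) := hd.
  have h5 := nrm_dist_triangle (y n.+1 (g n.+2)) (y n.+1 h) (yi (g n.+1)).
  have h6 := nrm_dist_triangle (y n.+1 h) (yi h) (yi (g n.+1)).
  by rewrite (nrmB (y n.+1 (g n.+2)) (y n.+1 h)) in h5; lra.
(* Along [y n.+1 h], [z h], [z (g j)], [y n.+1 (g j)], [yi (g j)], [yi h] consecutive values are
   within [d], which contradicts [far]. The index [j] depends on [z], and [n] is chosen after
   [j]. *)
have [z [Bz zy]] : B `&` cluster ((y : nat -> {ptws X -> K^o}) @ \oo) !=set0.
  by apply: cB; exists 0%N => // n _; exact: By.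
have [L cL LP] := dual_tight 2 (BY _ Bz) d0.
have [j0 j0P] := hL _ cL; pose j := j0.+1.
have lz := dual_linear (BY _ Bz).
have zh : nrm (z h - z (g j)) <= d.
  rewrite -linear_subr//; apply: LP => // x Lx.
  by rewrite Cv_funD Cv_funN (j0P j x)// subrr.
have yj : (y @ \oo) [set y n.+1 | n in [set n | (j <= n)%N]].
  by exists j.+1 => // -[//|n] /= jn; exists n.
have [_ [[n /= jn <-] zn]] := zy _ _ yj (near_ptws z [:: h; g j] d0).
have z1 := zn 0%N isT; have z2 := zn 1%N isT; rewrite /= in z1 z2.
have [_ _ _ _ [_ _ hc _]] := stS n.
have h7 : nrm (yi (g j) - y n.+1 (g j)) < d.
  have := hc j; rewrite nthE//; apply.
  by rewrite size_map /= size_mkseq ltnS.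
have h8 := yi_close j0; have h9 := far n.
have t1 := nrm_dist_triangle (y n.+1 h) (z h) (yi h).
have t2 := nrm_dist_triangle (z h) (z (g j)) (yi h).
have t3 := nrm_dist_triangle (z (g j)) (y n.+1 (g j)) (yi h).
have t4 := nrm_dist_triangle (y n.+1 (g j)) (yi (g j)) (yi h).
rewrite (nrmB (z h) (y n.+1 h)) in z1; rewrite (nrmB (yi (g j)) (y n.+1 (g j))) in h7.
rewrite (nrmB (yi h)) -/j in h8.
by move: h9 t1 t2 t3 t4 z1 z2 zh h7 h8; rewrite /d; lra.
Qed.

End gliding_hump.

Section tightness.
Context (R : realType) (s : scalars).
Local Notation K := (scalar_field R s).
Context (Omega : topologicalType) (v : Omega -> {posnum R}).
Context (E : normedModType K).
Hypothesis (v_cont : continuous (fun x => (v x)%:num : R^o)).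
Local Notation X := (Cv v E).
Local Notation N := (Cv_norm v E).
Local Notation gamma := (seminorm_topology (compact_seminorms v E)).
Local Notation Y := (top_dual gamma).

Lemma Cv_limit (g : nat -> X) (h : Omega -> E) : continuous h -> (forall n, N (g n) <= 1) ->
  (forall x, exists n, h x = g n x) -> exists2 f : X, N f <= 1 & forall x, f x = h x.
Proof.
move=> ch g1 hg; have h1 x : nrm (h x) * (v x)%:num <= 1.
  by have [n ->] := hg x; exact: le_trans (wval_le_norm (g n) x) (g1 n).
have [f fh] := Cv_exists ch h1; exists f => //.
by apply: Cv_norm_le => // x; rewrite /wval fh.
Qed.

(** With [collar := id] the conclusion of [gliding_hump] is already tightness; what remains is to
    produce the limit of the stabilising sums. *)
Lemma kR_tight B : hemicompact Omega -> kR_space Omega -> B `<=` Y -> weakly_compact B ->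
  uniformly_tight B.
Proof.
move=> /hemicompact_increasing[D [cD Dinc Dex]] kR BY cB.
apply: (@gliding_hump R s Omega v E v_cont id (fun _ => cst 1) D (fun A x Ax => Ax)
  (fun A A' AA' => AA') _ _ (fun _ _ _ => erefl) (fun _ _ _ _ => id) cD _ _ BY cB).
- by move=> A; exact: cst_continuous.
- by move=> A x; rewrite ler01 lexx.
move=> C g cC Cinc DC g1 gS _.
have gC m n x : (m <= n)%N -> C m x -> g n x = g m x.
  move=> mn Cx; rewrite -(subnKC mn); elim: (n - m)%N => [|k IH]; first by rewrite addn0.
  rewrite addnS gS//; elim: k {IH} => [|k IH]; first by rewrite addn0.
  by rewrite addnS; exact: Cinc.
have /choice[n nP] x : exists n, D n x.
  by have [n nP] := Dex _ (@compact_set1 _ x); exists n; exact: nP.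
(* The successor is needed because [D n] is only known to lie in [C n.+1]. *)
pose h x := g (n x).+1 x.
have hg m k x : D m x -> (m < k)%N -> h x = g k x.
  move=> Dx mk; rewrite (gC m.+1 k)//; last exact: DC.
  rewrite /h; have [mn|nm] := leqP m (n x).
    by apply: gC => //; exact: DC.
  by apply/esym/gC; [exact: ltnW|exact/DC].
have ch : continuous h.
  apply: kR => [|A cA]; first exact: (@uniform_completely_regular R).
  have [m AD] := Dex _ cA.
  apply/subspace_continuousP => x Ax; apply/cvg_nrmP => e e0.
  suff : \forall y \near x, A y -> nrm (h x - h y) < e by [].
  have cg := @Cv_continuous _ _ _ _ _ (g m.+1).
  apply: filterS ((continuous_nrmP _).1 cg x e e0) => y xy Ay.
  by rewrite !(hg m m.+1)//; exact: AD.
have [|f f1 fh] := Cv_limit ch g1; first by move=> x; exists (n x).+1.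
exists f => // L cL; have [m LD] := Dex _ cL; exists m.+1 => k x mk Lx.
by rewrite fh; apply: hg mk; exact: LD.
Qed.

(** * Completely metrisable spaces *)

Section metric.
Context (d : Omega -> Omega -> R).
Hypotheses (d_ge0 : forall x y, 0 <= d x y) (d_eq0 : forall x y, d x y = 0 <-> x = y)
  (d_sym : forall x y, d x y = d y x)
  (d_triangle : forall x y z, d x z <= d x y + d y z)
  (d_nbhs : forall (x : Omega) (A : set Omega),
     nbhs x A <-> exists2 e, 0 < e & [set y | d x y < e] `<=` A)
  (d_complete : forall x_ : nat -> Omega,
     (forall e, 0 < e -> exists n0, forall m n : nat,
        (n0 <= m)%N -> (n0 <= n)%N -> d (x_ m) (x_ n) < e) ->
     exists x : Omega, x_ n @[n --> \oo] --> x).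

Definition thickening (r : R) (A : set Omega) : set Omega :=
  [set x | exists2 k, A k & d k x < r].

Definition ramp (t : R) : R := Num.max 0 (Num.min 1 t).

Lemma ramp01 t : 0 <= ramp t <= 1.
Proof. by rewrite /ramp le_max lexx/= ge_max ler01 ge_min lexx. Qed.

Lemma ramp_le t u : ramp t <= ramp u + `|t - u|.
Proof.
have := ler_norm (t - u); have := normr_ge0 (t - u); move: `|t - u| => w w0 tu.
rewrite /ramp /Num.max /Num.min; case: (ltP 1 t) => h1; case: (ltP 1 u) => h2;
  rewrite ?ltr01; try case: (ltP 0 t) => h3; try case: (ltP 0 u) => h4; lra.
Qed.

(* A supremum of ramps, not a ramp of the distance to [A]: the infimum that
   defines the distance to the empty set would be the junk value [0]. *)
Definition metric_bump (r : R) (A : set Omega) (x : Omega) : R :=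
  sup [set ramp (2 - d k x / r) | k in A].

Lemma metric_bump01 r A x : 0 <= metric_bump r A x <= 1.
Proof.
have ub t : [set ramp (2 - d k x / r) | k in A] t -> t <= 1.
  by move=> [k _ <-]; have /andP[] := ramp01 (2 - d k x / r).
apply/andP; split; last exact: sup_le_ub0 ub.
by apply: sup_ge0 ub _ => _ [k _ <-]; have /andP[] := ramp01 (2 - d k x / r).
Qed.

Lemma metric_bump_ge r A k x : A k -> ramp (2 - d k x / r) <= metric_bump r A x.
Proof.
move=> Ak; apply: (@le_sup_of _ _ 1); last by exists k.
by move=> _ [l _ <-]; have /andP[] := ramp01 (2 - d l x / r).
Qed.

Lemma metric_bump1 r A k x : 0 < r -> A k -> d k x <= r -> metric_bump r A x = 1.
Proof.
move=> r0 Ak kx; apply/eqP; rewrite eq_le; have /andP[_ ->] := metric_bump01 r A x.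
apply: le_trans (metric_bump_ge _ _ Ak).
have h : d k x / r <= 1 by rewrite ler_pdivrMr// mul1r.
by rewrite /ramp le_max le_min lexx/=; apply/orP; right; lra.
Qed.

Lemma metric_bump_thickening r A x : 0 < r -> metric_bump r A x != 0 ->
  thickening (2 * r) A x.
Proof.
move=> r0; apply: contra_neqP => nA; apply/eqP; rewrite eq_le.
have /andP[-> _] := metric_bump01 r A x; rewrite andbT.
apply: sup_le_ub0 => // _ [k Ak <-].
have h : 2 <= d k x / r.
  by rewrite ler_pdivlMr// leNgt; apply/negP => kx; apply: nA; exists k.
rewrite /ramp ge_max lexx/= ge_min; apply/orP; right; lra.
Qed.

Lemma metric_bump_mono r A B x : A `<=` B -> metric_bump r A x <= metric_bump r B x.
Proof.
move=> AB; apply: sup_le_ub0; first by have /andP[] := metric_bump01 r B x.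
by move=> _ [k Ak <-]; apply: metric_bump_ge; exact: AB.
Qed.

Lemma continuous_metric_bump r A : 0 < r -> continuous (metric_bump r A).
Proof.
move=> r0.
have lip x y : metric_bump r A x <= metric_bump r A y + d x y / r.
  apply: sup_le_ub0.
    by rewrite addr_ge0 ?divr_ge0// ?(ltW r0)//; have /andP[] := metric_bump01 r A y.
  move=> _ [k Ak <-]; apply: (le_trans (ramp_le _ (2 - d k y / r))).
  apply: lerD; first exact: metric_bump_ge.
  rewrite opprB addrC addrA subrK -mulrBl normrM (@ger0_norm _ r^-1) ?invr_ge0 ?(ltW r0)//.
  rewrite ler_wpM2r ?invr_ge0 ?(ltW r0)// ler_norml.
  have := d_triangle k x y; have := d_triangle k y x; rewrite (d_sym y x).
  by move=> h1 h2; apply/andP; split; lra.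
move=> x; apply/cvgrPdist_lt => e e0; rewrite near_nbhs; apply/d_nbhs.
exists (e * r); first by rewrite mulr_gt0.
move=> y /= xy; have h : d x y / r < e by rewrite ltr_pdivrMr.
have := lip x y; have := lip y x; rewrite (d_sym y x) ltr_norml => h1 h2.
by apply/andP; split; lra.
Qed.

Lemma metric_ball_nbhs x e : 0 < e -> nbhs x [set y | d x y < e].
Proof. by move=> e0; apply/d_nbhs; exists e. Qed.

Lemma d_xx x : d x x = 0.
Proof. exact/d_eq0. Qed.

(** Total boundedness with compact sets in place of finite nets: an ultrafilter on [A] contains a
    ball of every radius, the centres form a Cauchy sequence, and the ultrafilter converges to their
    limit. *)
Lemma metric_compact A : closed A ->
  (forall r, 0 < r -> exists2 C, compact C & A `<=` thickening r C) -> compact A.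
Proof.
move=> clA tbA; rewrite compact_ultra => F FU FA.
have ball r : 0 < r -> exists c, F [set x | d c x < r].
  move=> r0; have r20 : 0 < r / 2 by rewrite divr_gt0.
  have [C cC AC] := tbA _ r20; apply: contrapT => /forallNP noF.
  have : ~ F (thickening (r / 2) C).
    apply: (compact_induction (P := fun D => ~ F (thickening (r / 2) D)) cC).
    - move=> F0; apply: (@filter_not_empty _ F _).
      by apply: filterS F0 => x [].
    - move=> D D' DD' nF FD; apply: nF; apply: filterS FD => x [k Dk kx].
      by exists k => //; exact: DD'.
    - move=> D D' nD nD' FDD'.
      have [//|nFD] := in_ultra_setVsetC (thickening (r / 2) D) FU.
      apply: nD'; apply: filterS (filterI FDD' nFD) => x [[k [Dk|D'k] kx] nDx].
        by exfalso; apply: nDx; exists k.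
      by exists k.
    move=> c _; exists [set x | d c x < r / 2]; first exact: metric_ball_nbhs.
    move=> Fc; apply: (noF c); apply: filterS Fc => x [k [/= ck _] kx] /=.
    by have := d_triangle c k x; lra.
  by apply; apply: filterS FA.
have n0 n : 0 < n.+1%:R^-1 :> R by rewrite invr_gt0.
have /choice[c cP] n : exists c, F [set x | d c x < n.+1%:R^-1] by exact: ball.
have small (e : R) : 0 < e -> exists n0, forall n, (n0 <= n)%N -> n.+1%:R^-1 < e.
  move=> e0; exists (Num.truncn e^-1) => n en.
  rewrite invf_plt ?posrE//; apply: (lt_le_trans (truncnS_gt _)); by rewrite ler_nat.
have [x cx] : exists x : Omega, c n @[n --> \oo] --> x.
  apply: d_complete => e e0; have e20 : 0 < e / 2 by rewrite divr_gt0.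
  have [k kP] := small _ e20; exists k => m n /kP hm /kP hn.
  have [z [/= mz nz]] := filter_ex (filterI (cP m) (cP n)).
  apply: (le_lt_trans (d_triangle (c m) z (c n))); rewrite (d_sym z) (splitr e).
  by apply: ltrD; [exact: lt_trans mz hm|exact: lt_trans nz hn].
have Fx : F --> x.
  move=> U /d_nbhs[e e0 eU]; have e20 : 0 < e / 2 by rewrite divr_gt0.
  have [k kP] := small _ e20; have [k' _ k'P] := cx _ (metric_ball_nbhs x e20).
  pose n := maxn k k'; have h1 := kP n (leq_maxl _ _).
  have h2 : d x (c n) < e / 2 := k'P n (leq_maxr _ _).
  apply: filterS (cP n) => z /= nz; apply: eU => /=.
  apply: (le_lt_trans (d_triangle x (c n) z)); rewrite (splitr e).
  by apply: ltrD => //; exact: lt_trans nz h1.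
exists x; split => //; apply: clA => U xU.
exact: filter_ex (filterI FA (Fx _ xU)).
Qed.

Lemma metric_hump B : B `<=` Y -> weakly_compact B -> forall r e, 0 < r -> 0 < e ->
  exists2 C, compact C & forall y (f : X), B y -> N f <= 1 ->
    (forall x, thickening r C x -> f x = 0) -> nrm (y f) <= e.
Proof.
move=> BY cB r e r0 e0; have r40 : 0 < r / 4 by rewrite divr_gt0.
(* With [r / 4] the bump of [C] is supported in the [r / 2]-thickening, so around a point outside
   all the [r]-thickenings every [g n] vanishes on a ball of radius [r / 2]. *)
apply: (@gliding_hump R s Omega v E v_cont (thickening r) (metric_bump (r / 4))
  (fun=> set0) _ _ _ _ _ _ (fun=> compact0) _ _ BY cB) => //.
- by move=> A x Ax; exists x => //; rewrite d_xx.
- by move=> A D AD x [k Ak kx]; exists k => //; exact: AD.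
- by move=> A; exact: continuous_metric_bump.
- by move=> A x; exact: metric_bump01.
- by move=> A x Ax; apply: (metric_bump1 r40 Ax); rewrite d_xx ltW.
- move=> A D x AD D0; apply/eqP; rewrite eq_le -{1}D0 metric_bump_mono//=.
  by have /andP[] := metric_bump01 (r / 4) A x.
move=> C g cC Cinc _ g1 gS g0.
have thC m k x : (m <= k)%N -> thickening r (C m) x -> thickening r (C k) x.
  move=> mk; rewrite -(subnKC mk); elim: (k - m)%N => [|j IH]; first by rewrite addn0.
  by rewrite addnS => /IH[c Cc cx]; exists c => //; exact: Cinc.
have gC m n x : (m <= n)%N -> thickening r (C m) x -> g n x = g m x.
  move=> mn Cx; rewrite -(subnKC mn); elim: (n - m)%N => [|k IH]; first by rewrite addn0.
  by rewrite addnS gS//; apply: thC Cx; exact: leq_addr.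
have gC2 m n x : thickening r (C m) x -> thickening r (C n) x -> g n x = g m x.
  move=> mx nx; have [mn|/ltnW nm] := leqP m n; first exact: gC.
  by apply/esym/gC.
have far x : (forall n, ~ thickening r (C n) x) -> forall n y, d x y < r / 2 -> g n y = 0.
  move=> nx n y xy; apply: g0; apply/eqP; apply: contrapT => /negP.
  move=> /(metric_bump_thickening r40)[k Ck ky]; apply: (nx n); exists k => //.
  by have := d_triangle k y x; rewrite (d_sym y x); lra.
have /choice[n nP] x : exists n, (exists m, thickening r (C m) x) -> thickening r (C n) x.
  have [[m mx]|h] := pselect (exists m, thickening r (C m) x); first by exists m.
  by exists 0%N.
pose h x : E := if `[< exists m, thickening r (C m) x >] then g (n x) x else 0.
have hC m x : thickening r (C m) x -> h x = g m x.
  move=> mx; rewrite /h asboolT; last by exists m.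
  by apply: gC2 => //; apply: nP; exists m.
have hN x : (forall m, ~ thickening r (C m) x) -> h x = 0.
  by move=> nx; rewrite /h asboolF// => -[m /nx].
have loc (x : Omega) : exists2 U, nbhs x U &
    exists n0, forall y, U y -> forall n, (n0 <= n)%N -> h y = g n y.
  have [[m mx]|h'] := pselect (exists m, thickening r (C m) x).
    exists (thickening r (C m)).
      have [k Ck kx] := mx; apply/d_nbhs; exists (r - d k x); first by rewrite subr_gt0.
      by move=> y /= xy; exists k => //; have := d_triangle k x y; lra.
    by exists m => y my k mk; rewrite (hC m)// (gC m k).
  have nx m : ~ thickening r (C m) x by move=> mx; apply: h'; exists m.
  exists [set y | d x y < r / 2]; first by apply: metric_ball_nbhs; rewrite divr_gt0.
  exists 0%N => y xy k _; rewrite (far _ nx)//.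
  have [[m my]|h''] := pselect (exists m, thickening r (C m) y).
    by rewrite (hC m)// (far _ nx).
  by apply: hN => m my; apply: h''; exists m.
have ch : continuous h.
  apply/continuous_nrmP => x t t0; have [U xU [n0 Un0]] := loc x.
  have cg := @Cv_continuous _ _ _ _ _ (g n0).
  apply: filterS (filterI xU ((continuous_nrmP _).1 cg x t t0)) => y [Uy].
  by rewrite !(Un0 _ _ n0)//; exact: nbhs_singleton xU.
have [|f f1 fh] := Cv_limit ch g1.
  by move=> x; have [U xU [n0 Un0]] := loc x; exists n0; apply: Un0 => //; exact: nbhs_singleton xU.
exists f => // L cL.
suff [n0 n0P] : exists n0, forall x, L x -> forall k, (n0 <= k)%N -> h x = g k x.
  by exists n0 => k x kn Lx; rewrite fh; exact: n0P.
apply: (compact_induction (P := fun D => exists n0, forall x, D x ->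
  forall k, (n0 <= k)%N -> h x = g k x) cL).
- by exists 0%N.
- by move=> A D AD [n0 n0P]; exists n0 => x /AD; exact: n0P.
- move=> A D [n0 n0P] [n1 n1P]; exists (maxn n0 n1) => x [Ax|Dx] k; rewrite geq_max => /andP[h0 h1].
    exact: n0P.
  exact: n1P.
move=> x _; have [U xU [n0 Un0]] := loc x; exists U => //.
by exists n0 => y [Uy _]; exact: Un0.
Qed.

Lemma metric_tight B : B `<=` Y -> weakly_compact B -> uniformly_tight B.
Proof.
move=> BY cB e e0; pose r n : R := n.+1%:R^-1.
have r0 n : 0 < r n by rewrite invr_gt0.
have /choice[C CP] n : exists C, compact C /\ forall y (f : X), B y -> N f <= 1 ->
    (forall x, thickening (r n) C x -> f x = 0) -> nrm (y f) <= e * 2 ^- n.+2.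
  have en : 0 < e * 2 ^- n.+2 by rewrite mulr_gt0// invr_gt0 exprn_gt0.
  by have [C cC CP] := metric_hump BY cB (r0 n) en; exists C.
have r20 n : 0 < 2 * r n by rewrite mulr_gt0.
(* A closed set between the [2 r n]-thickening of [C n], outside of which [psi n] below vanishes,
   and the [4 r n]-thickening, small enough for [metric_compact]. *)
pose Z n := [set x | 1 <= metric_bump (2 * r n) (C n) x].
have clZ n : closed (Z n).
  apply: (@preimage_closed _ R (metric_bump (2 * r n) (C n)) [set t | 1 <= t]);
    last exact: closed_ge.
  by move=> x _; exact: continuous_metric_bump.
have cZ : compact (\bigcap_(n in [set: nat]) Z n).
  apply: metric_compact; first by apply: closed_bigI => n _; exact: clZ.
  move=> t t0; pose n := Num.truncn (4 / t).
  exists (C n); first exact: (CP n).1.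
  move=> x /(_ n I) /= xn; have [] := @metric_bump_thickening (2 * r n) (C n) x (r20 n).
    by rewrite gt_eqF// (lt_le_trans ltr01).
  move=> k Ck kx; exists k => //; apply: (lt_le_trans kx).
  rewrite mulrA -natrM ler_pdivrMr// mulrC -ler_pdivrMr//.
  exact/ltW/truncnS_gt.
exists (\bigcap_(n in [set: nat]) Z n) => // y f By f1 fZ.
have ly := dual_linear (BY _ By); have sy := is_seminorm_nrm ly.
have [M M0 yM] := dual_norm_bound (BY _ By).
(* Budget: [e / 2] for all the cuts by [psi n] together, [e / 4] for what remains after [m] cuts,
   and [e / 4] for the truncation at level [t]. *)
pose t := e / (4 * M); have t0 : 0 < t by rewrite divr_gt0// mulr_gt0.
have e40 : 0 < e / 4 by rewrite divr_gt0.
have [L cL LP] := dual_tight 1 (BY _ By) e40.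
(* The part of [L] where [f] reaches the level [t] is compact and misses the intersection of the
   [Z n], so finitely many cuts annihilate [f - trunc t f] on [L]. *)
have [m mP] : exists m, forall x, L x -> t <= wval f x -> exists2 n, (n < m)%N & ~ Z n x.
  suff [m mP] : exists m, forall x, (L `&` [set x | t <= wval f x]) x ->
      exists2 n, (n < m)%N & ~ Z n x by exists m => x Lx tx; exact: mP.
  apply: (compact_induction (P := fun D => exists m, forall x, D x ->
      exists2 n, (n < m)%N & ~ Z n x)).
  - apply: compact_closedI => //.
    apply: (@preimage_closed _ R (wval f) [set u | t <= u]); last exact: closed_ge.
    by move=> x _; exact: continuous_wval.
  - by exists 0%N.
  - by move=> A D AD [k kP]; exists k => x /AD; exact: kP.
  - move=> A D [k kP] [j jP]; exists (maxn k j) => x [/kP|/jP] [n nk nZ]; exists n => //.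
      by rewrite leq_max nk.
    by rewrite leq_max nk orbT.
  move=> x [Lx tx]; have : ~ (\bigcap_(n in [set: nat]) Z n) x.
    move=> /fZ fx; move: tx; rewrite /= /wval fx nrm0 mul0r; lra.
  move=> /existsNP[n /not_implyP[_ nZ]]; exists (~` Z n).
    by apply: open_nbhs_nbhs; split => //; exact: closed_openC.
  by exists n.+1 => z [nz _]; exists n.
pose psi n := metric_bump (r n) (C n).
have cpsi n : continuous (psi n) by exact: continuous_metric_bump.
have psi01 n x : 0 <= psi n x <= 1 by exact: metric_bump01.
have psi1 n x : `|psi n x| <= 1 by have /andP[h0 h1] := psi01 n x; rewrite ger0_norm.
pose G := fix G n : X := if n is n'.+1 then Cv_scale (psi n') (G n') else f - trunc t f.
have GS n x : G n.+1 x = kreal s (psi n x) *: G n x by exact: (Cv_scaleE (G n) (@cpsi n) (psi1 n)).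
have G1 n : N (G n) <= 1.
  elim: n => [|n IH]; first by apply: (le_trans (norm_sub_trunc v_cont f (ltW t0))).
  apply: Cv_norm_le => // x; rewrite /wval GS nrmZ nrm_kreal -mulrA.
  apply: le_trans (le_trans (wval_le_norm (G n) x) IH).
  by rewrite ler_piMl// wval_ge0.
have GB n x : (G n - G n.+1) x = kreal s (1 - psi n x) *: G n x.
  by rewrite Cv_funD Cv_funN GS krealB kreal1 scalerBl scale1r.
have step n : nrm (y (G n - G n.+1)) <= e * 2 ^- n.+2.
  apply: (CP n).2 => //.
    apply: Cv_norm_le => // x; rewrite /wval GB nrmZ nrm_kreal -mulrA.
    have /andP[h0 h1] := psi01 n x; rewrite ger0_norm ?subr_ge0//.
    apply: le_trans (le_trans (wval_le_norm (G n) x) (G1 n)).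
    by rewrite ler_piMl ?wval_ge0// gerBl.
  move=> x [k Ck kx]; rewrite GB /psi (metric_bump1 (r0 n) Ck (ltW kx)).
  by rewrite subrr kreal0 scale0r.
(* Prohorov: the part of [f] cut off at step [n] vanishes near [C n]. *)
have sum n : nrm (y (G 0%N)) <= e / 2 * (1 - 2 ^- n) + nrm (y (G n)).
  elim: n => [|n IH]; first by rewrite expr0 invr1 subrr mulr0 add0r.
  apply: (le_trans IH); have := step n; rewrite linear_subr//.
  have := nrm_dist_triangle (y (G n)) (y (G n.+1)) 0; rewrite !subr0 !exprS !invfM.
  move: (nrm (y (G n))) (nrm (y (G n.+1))) (nrm _) (2 ^- n : R) => a b c p.
  have -> : e * (2^-1 * (2^-1 * p)) = e * p / 4 by field.
  have -> : e / 2 * (1 - p) = e / 2 - e * p / 2 by field.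
  have -> : e / 2 * (1 - 2^-1 * p) = e / 2 - e * p / 4 by field.
  by lra.
have Gm0 n x : G n x = 0 -> forall k, (n <= k)%N -> G k x = 0.
  move=> nx k nk; rewrite -(subnKC nk); elim: (k - n)%N => [|j IH]; first by rewrite addn0.
  by rewrite addnS GS IH scaler0.
have Gm : nrm (y (G m)) <= e / 4.
  apply: LP => // x Lx; have [tx|/ltW xt] := leP t (wval f x).
    have [n nm nZ] := mP x Lx tx; apply: (Gm0 n.+1) => //; rewrite GS.
    suff -> : psi n x = 0 by rewrite kreal0 scale0r.
    apply/eqP; apply: contrapT => /negP /(metric_bump_thickening (r0 n))[k Ck kx].
    by apply: nZ; rewrite /Z /= (metric_bump1 (r20 n) Ck)// ltW.
  apply: (Gm0 0%N) => //; apply: sub_trunc_eq0 => //; exact: ltW.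
have yt : nrm (y (trunc t f)) <= e / 4.
  apply: (le_trans (yM _)); apply: (@le_trans _ _ (M * t)).
    by rewrite ler_pM2l// trunc_norm// ltW.
  by rewrite /t (_ : M * (e / (4 * M)) = e / 4)//; field; rewrite gt_eqF.
rewrite -(subrK (trunc t f) f); have [_ yD _] := sy; apply: (le_trans (yD _ _)).
have := sum m; have : 0 <= e / 2 * 2 ^- m.
  by rewrite mulr_ge0 ?divr_ge0 ?(ltW e0)// invr_ge0 exprn_ge0.
by rewrite mulrBr mulr1 /=; move: (e / 2 * _) => z; lra.
Qed.

End metric.
End tightness.

Theorem corollary4p5 (R : realType) (s : scalars) (Omega : topologicalType)
    (Omega_neq0 : [set: Omega] !=set0)
    (Omega_creg : completely_regular_space Omega)
    (Omega_haus : hausdorff_space Omega)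
    (v : Omega -> {posnum R})
    (v_cont : continuous (fun x => (v x)%:num : R^o))
    (E : normedModType (scalar_field R s)) :
  exists2 gamma : topology (Cv v E),
    mixed_topology (Cv_norm v E) (tau_co v E) gamma &
  [/\ (* (a) *)
      [/\ saks_space (Cv_norm v E) (tau_co v E),
          gamma = submixed_topology (Cv_norm v E) (tau_co v E) &
          gamma = seminorm_topology (compact_seminorms v E)],
      (* (b) *)
      discrete_space Omega ->
        [/\ Cv_set v E = Cv_sigma v E,
            gamma = submixed_topology (Cv_norm v E) (tau_N v E) &
            gamma = seminorm_topology (point_seminorms v E)],
      (* (c) *)
      kR_space Omega -> banach E -> complete_topology gamma,
      (* (d) *)
      hemicompact Omega -> C_sequential gamma &
      (* (e) *)
      (hemicompact Omega /\ kR_space Omega \/ completely_metrisable R Omega ->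
        mackey_space gamma /\ (banach E -> strong_mackey_space gamma)) /\
      (* (f) *)
      [/\ gamma = seminorm_topology (weight_seminorms v E (Wb0 R Omega)),
          gamma = seminorm_topology (weight_seminorms v E (Wusc0 R Omega)) &
          locally_compact [set: Omega] ->
            gamma = seminorm_topology (weight_seminorms v E (C0_plus R Omega))]].
Proof.
exists (seminorm_topology (compact_seminorms v E)); first exact: mixed_gamma.
split.
- by split; [exact: saks_Cv|exact: submixed_gamma|].
- move=> disc; split; [exact: discrete_Cv_set| |].
    by rewrite discrete_tau_N//; exact: submixed_gamma.
  by have [x0 _] := Omega_neq0; exact: discrete_point_seminorms.
- exact: gamma_complete.
- exact: gamma_C_sequential.
split.
  move=> case_e; apply: gamma_strong_mackey => // B BY cB.
  case: case_e => [[hO kR]|[d [[d_ge0 d_eq0 d_sym d_tri] d_nbhs d_compl]]].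
    exact: kR_tight.
  exact: (metric_tight v_cont d_ge0 d_eq0 d_sym d_tri d_nbhs d_compl BY cB).
have usc C a : (forall n, compact (C n)) -> c0_plus a ->
    exists2 w, Wusc0 R Omega w & forall n x, C n x -> a n <= w x.
  exact: usc_envelope.
split.
- apply: gamma_weight_seminorms => // C a cC ca; have [w ww aw] := usc C a cC ca.
  by exists w => //; exact: usc_vanishing_bounded.
- by apply: gamma_weight_seminorms => // w; exact: usc_vanishing_bounded.
move=> lc; apply: gamma_weight_seminorms => [w Ww|C a cC ca].
  exact/usc_vanishing_bounded/continuous_vanishing_usc.
exact: continuous_envelope.
Qed.
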